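(* Let $b,k_1,k_2,k_3,k_4>0$ and $a=1$, and let $\mathcal H$, $\mathcal A$, $\mathcal A_0$ be as in the context (with $a=1$). Assume that $$k_1\neq k_3\quad\text{or}\quad \sqrt b\neq 2k\pi \text{ for all } k\in\mathbb N^*.$$ Then the large eigenvalues of the dissipative operator $\mathcal A$ are simple and can be split into two families $(\lambda_k^j)_{k\in\mathbb Z,\,|k|\ge k_0}$, $j=1,2$ (with $k_0\in\mathbb N$ chosen large enough). Moreover there are $\alpha_1,\alpha_2\in\mathbb R$ and $\beta_1,\beta_2>0$ such that, as $|k|\to\infty$, $$\lambda_k^1=ik\pi+i\frac{\alpha_1}{k}-\frac{\beta_1}{k^2}+o\Big(\frac1{k^2}\Big),\qquad \lambda_k^2=ik\pi+i\frac{\alpha_2}{k}-\frac{\beta_2}{k^2}+o\Big(\frac1{k^2}\Big).$$ Under the same condition, the large eigenvalues of the conservative operator $\mathcal A_0$ are simple and can be split into two families $(\lambda_k^{j,0})_{k\in\mathbb Z,\,|k|\ge k_0^0}$, $j=1,2$ (with $k_0^0\in\mathbb N$ chosen large enough), such that, as $|k|\to\infty$, $$\lambda_k^{1,0}=ik\pi+i\frac{\alpha_1}{k}+o\Big(\frac1{k^2}\Big),\qquad \lambda_k^{2,0}=ik\pi+i\frac{\alpha_2}{k}+o\Big(\frac1{k^2}\Big),$$ with the same $\alpha_1,\alpha_2$ as for $\mathcal A$.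
   Context: Let $\Omega=(0,1)$ and $H^1_L(\Omega)=\{f\in H^1(\Omega): f(0)=0\}$ (complex-valued functions). The energy space is $\mathcal H=H^1_L(\Omega)\times L^2(\Omega)\times H^1_L(\Omega)\times L^2(\Omega)\times\mathbb C\times\mathbb C$ with inner product, for $U=(u,v,y,z,\eta,\gamma)$ and $U_1=(u_1,v_1,y_1,z_1,\eta_1,\gamma_1)$, $$\langle U,U_1\rangle_{\mathcal H}=\int_0^1\Big(v\overline{v_1}+b^{-1}z\overline{z_1}+ab^{-1}y_x\overline{y_{1x}}+(u_x+y)\overline{(u_{1x}+y_1)}\Big)dx+\frac1{k_1}\eta\overline{\eta_1}+\frac1{k_3}\gamma\overline{\gamma_1}.$$ The operator $\mathcal A$ has domain $D(\mathcal A)=\{(u,v,y,z,\eta,\gamma)\in\mathcal H: u,y\in H^2(\Omega),\ v,z\in H^1_L(\Omega),\ \eta=v(1),\ \gamma=z(1)\}$ and $$\mathcal A U=\big(v,\ (u_x+y)_x,\ z,\ ay_{xx}-b(u_x+y),\ -k_1(u_x(1)+y(1))-k_2\eta,\ -k_3y_x(1)-k_4\gamma\big).$$ The conservative operator $\mathcal A_0$ has the same domain and formula but with $k_2=k_4=0$. Both have compact resolvent. ''The large eigenvalues'' means all eigenvalues of sufficiently large modulus, i.e. all but finitely many eigenvalues; $\mathbb N^*=\{1,2,\dots\}$. *)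

(* Defs.v *)
From mathcomp Require Import all_boot all_order all_algebra.
From mathcomp Require Import complex.
From mathcomp Require Import all_classical all_reals all_analysis.
Import Order.TTheory GRing.Theory Num.Theory.
Import numFieldNormedType.Exports.

Set Implicit Arguments.
Unset Strict Implicit.
Unset Printing Implicit Defensive.

Local Open Scope classical_set_scope.
Local Open Scope ring_scope.
Local Open Scope complex_scope.

(* Elements of L^2(0,1), H^1(0,1), H^2(0,1) are represented by functions
   f : R -> R[i]; only their restriction to (0,1) matters, and two functions
   that agree almost everywhere on (0,1) represent the same element (eq01). *)
Section Sobolev.
Variable R : realType.

Notation mu := (@lebesgue_measure R).
Notation Omega := (`]0, 1[%classic : set R).

Definition cintegral (f : R -> R[i]^o) : R[i] :=
  Rintegral mu Omega (fun x => complex.Re (f x))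
  +i* Rintegral mu Omega (fun x => complex.Im (f x)).

Definition eq01 (f g : R -> R[i]^o) : Prop :=
  {ae mu, forall x, Omega x -> f x = g x}.

Definition L2 (f : R -> R[i]^o) : Prop :=
  [/\ measurable_fun Omega (fun x => complex.Re (f x)),
      measurable_fun Omega (fun x => complex.Im (f x)) &
      (\int[mu]_(x in Omega)
         (complex.Re (f x) ^+ 2 + complex.Im (f x) ^+ 2)%:E < +oo)%E].

(* Test functions C^1_c(0,1), as in Brezis; they define the same H^1 and the
   same weak derivative as C^oo_c(0,1), and real-valued ones suffice by
   linearity. *)
Definition test_function (phi : R -> R) : Prop :=
  [/\ forall x, derivable phi x 1,
      continuous (derive1 phi) &
      exists c d : R, [/\ 0 < c, d < 1 &
        forall x, ~~ (c <= x <= d) -> phi x = 0]].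

Definition is_weak_deriv (f g : R -> R[i]^o) : Prop :=
  forall phi : R -> R, test_function phi ->
    cintegral (fun x => f x * (derive1 phi x)%:C)
    = - cintegral (fun x => g x * (phi x)%:C).

(* The weak derivative in L^2, determined up to eq01; 0 if there is none. *)
Definition wderiv (f : R -> R[i]^o) : R -> R[i]^o :=
  xget (fun=> 0) [set g | L2 g /\ is_weak_deriv f g].

Definition H1 (f : R -> R[i]^o) : Prop :=
  L2 f /\ exists g, L2 g /\ is_weak_deriv f g.

Definition H2 (f : R -> R[i]^o) : Prop := H1 f /\ H1 (wderiv f).

Definition continuous01 (g : R -> R[i]^o) : Prop :=
  {within `[0, 1], continuous (fun x => complex.Re (g x))} /\
  {within `[0, 1], continuous (fun x => complex.Im (g x))}.

(* For f in H^1(0,1) and x in [0,1], the value at x of the unique continuous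
   representative of f; this is the meaning of f(0), f(1), f_x(1). *)
Definition trace (f : R -> R[i]^o) (x : R) : R[i] :=
  xget 0 [set c | exists g, [/\ continuous01 g, eq01 f g & g x = c]].

Definition H1L (f : R -> R[i]^o) : Prop := H1 f /\ trace f 0 = 0.

End Sobolev.

Section Timoshenko.
Variable R : realType.

(* (u, v, y, z, eta, gamma) *)
Definition state : Type :=
  ((R -> R[i]^o) * (R -> R[i]^o) * (R -> R[i]^o) * (R -> R[i]^o)
   * R[i]^o * R[i]^o)%type.

Definition energy_space (U : state) : Prop :=
  let: (u, v, y, z, eta, gam) := U in
  [/\ H1L u, L2 v, H1L y & L2 z].

(* Equality of two elements of the energy space. *)
Definition eqH (U W : state) : Prop :=
  let: (u, v, y, z, eta, gam) := U in
  let: (u1, v1, y1, z1, eta1, gam1) := W in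
  [/\ eq01 u u1, eq01 v v1, eq01 y y1, eq01 z z1 & eta = eta1 /\ gam = gam1].

Definition timo_dom (U : state) : Prop :=
  energy_space U /\
  let: (u, v, y, z, eta, gam) := U in
  [/\ H2 u /\ H2 y, H1L v /\ H1L z, eta = trace v 1 & gam = trace z 1].

Definition timo_op (a b k1 k2 k3 k4 : R) (U : state) : state :=
  let: (u, v, y, z, eta, gam) := U in
  (v,
   wderiv (wderiv u + y),
   z,
   a%:C *: wderiv (wderiv y) - b%:C *: (wderiv u + y),
   - k1%:C * (trace (wderiv u) 1 + trace y 1) - k2%:C * eta,
   - k3%:C * trace (wderiv y) 1 - k4%:C * gam).

Definition timo_op0 (a b k1 k3 : R) : state -> state :=
  timo_op a b k1 0 k3 0.

(* Spectral notions for an operator A with domain timo_dom; they do not depend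
   on the choice of an inner product on the energy space. *)
Definition is_eigenvalue (A : state -> state) (l : R[i]) : Prop :=
  exists U, [/\ timo_dom U, ~ eqH U 0 & eqH (A U) (l *: U)].

(* U lies in the kernel of (A - l)^n, on its natural domain. *)
Fixpoint in_ker_pow (A : state -> state) (l : R[i]) (n : nat) (U : state)
    : Prop :=
  if n is n'.+1 then timo_dom U /\ in_ker_pow A l n' (A U - l *: U)
  else eqH U 0.

(* Algebraic simplicity: the generalized eigenspace, i.e. the union of the
   kernels of the (A - l)^n, is one-dimensional. *)
Definition is_simple_eigenvalue (A : state -> state) (l : R[i]) : Prop :=
  is_eigenvalue A l /\
  exists U0, forall n U, in_ker_pow A l n U -> exists c : R[i], eqH U (c *: U0).

(* The large eigenvalues of A are simple and split into the two families
   (lam j k) for k in Z, |k| >= k0; the values lam j k with |k| < k0 are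
   irrelevant. *)
Definition large_eigenvalues_split (A : state -> state) (k0 : nat)
    (lam : 'I_2 -> int -> R[i]) : Prop :=
  [/\ forall j k, (k0 <= `|k|)%N -> is_simple_eigenvalue A (lam j k),
      forall j k j' k', (k0 <= `|k|)%N -> (k0 <= `|k'|)%N ->
        lam j k = lam j' k' -> j = j' /\ k = k' &
      exists M : R, forall l : R[i], M%:C <= `|l| -> is_eigenvalue A l ->
        exists j k, (k0 <= `|k|)%N /\ l = lam j k].

(* e k = o(1 / k^2) as |k| tends to infinity *)
Definition o_inv_sq (e : int -> R[i]) : Prop :=
  forall eps : R, 0 < eps -> exists N : nat, forall k : int,
    (0 < `|k|)%N -> (N <= `|k|)%N -> `|e k| <= (eps / k%:~R ^+ 2)%:C.

End Timoshenko.

(* Main.v *)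
Require Import Defs.
From mathcomp Require Import all_boot all_order all_algebra.
From mathcomp Require Import complex.
From mathcomp Require Import all_classical all_reals all_analysis.
From mathcomp Require Import measurable_realfun.
From mathcomp Require Import ring lra.
Import Order.TTheory GRing.Theory Num.Theory.
Import numFieldNormedType.Exports.

Set Implicit Arguments.
Unset Strict Implicit.
Unset Printing Implicit Defensive.

Local Open Scope classical_set_scope.
Local Open Scope ring_scope.
Local Open Scope complex_scope.

(** With a = 1 both waves travel at speed one, and the eigenvalue problem is the
    first order system u' = w - y, w' = l^2 u, y' = p, p' = l^2 y + b w on (0,1)
    with u(0) = y(0) = 0 and two conditions at 1. Its exponents are +-r1, +-r2,
    where r1^2 = l^2 + i sqrt(b) l and r2^2 = l^2 - i sqrt(b) l. Solutions are
    explicit, and the conditions at 1 become a 2 x 2 linear system in the initial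
    data w(0), p(0), whose determinant is [charfun].

    Write r1 = rho + de and r2 = rho - de. For large l the number de stays near
    i sqrt(b) / 2, and the determinant is a quadratic polynomial in l tanh(rho)
    whose coefficients are regular functions of X = 1/l ([chardet_quadratic]).
    The hypothesis on k1, k3 and b says exactly that its discriminant at X = 0 is
    not zero ([dlt_gt0]), so that it has two distinct roots tau_j(X), and the
    characteristic equation splits into l tanh(rho) = tau_j(1/l), j = 1, 2. Taking
    the inverse hyperbolic tangent, this reads l = i k pi + E_j(1/l) for some
    integer k, where E_j is Lipschitz near 0 and vanishes at 0. Each such equation
    has one solution near i k pi, by contraction, and the expansion
    E_j(X) = (tau_j(0) - b/8) X + tau_j'(0) X^2 + O(X^3) gives the asymptotics
    ([large_roots]): alpha_j = (b/8 - tau_j(0)) / pi, in which k2 and k4 do not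
    occur, and beta_j = tau_j'(0) / pi^2. The slope tau_j'(0) turns out to be a
    weighted mean of k1 k2 and k3 k4 ([kappa_mean]): it is positive for the
    dissipative operator and zero for the conservative one.

    Simplicity is obtained without differentiating solutions in l. Let l0 be a
    zero of the determinant. An eigenfunction at l0 solves the problem at l0 + h up
    to an error O(h), and an eigenfunction plus h times a generalized
    eigenfunction above it does so up to O(h^2). Since solutions depend stably on
    residuals ([shooting]), two independent eigenfunctions, or a Jordan chain of
    length two, would force the determinant to be O(h^2) at l0 + h
    ([eigen_rank1], [chain_trivial]). But the factorization of the determinant
    bounds it from below by a multiple of |h| ([simple_zero]).

    These computations concern classical solutions. Functions with a weak
    derivative in L^2 have a continuous representative, which is
    differentiable when the weak derivative has one too; an equation in the
    energy space thus becomes the first order system above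
    ([resolvent_regularity]), and explicit solutions give elements of the domain
    ([smooth_eigenstate]). *)

(** * Test functions approximating steps *)

Section Bump.
Variable R : realType.
Implicit Types (x t h : R).

Definition pospart t : R := Num.max t 0.

(** The square of the positive part is C^1; its second differences supply C^1
    functions of compact support without any smooth bump. *)
Lemma pospart_sqr_is_derive t : is_derive t 1 (fun s => pospart s ^+ 2) (2 * pospart t).
Proof.
have key (s : R) : `|pospart (s + t) ^+ 2 - pospart t ^+ 2 - 2 * pospart t * s| <= s ^+ 2.
  rewrite ler_norml /pospart.
  have [?|?] := leP (s + t) 0; have [?|?] := leP t 0; nra.
have H : (fun s : R => s^-1 *: ((fun u => pospart u ^+ 2) (s *: (1:R) + t) - pospart t ^+ 2))
    @ 0^' --> 2 * pospart t.
  apply/cvgrPdist_le => /= e e0; near=> s.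
  have s0 : s != 0 by near: s; exact: nbhs_dnbhs_neq.
  rewrite /GRing.scale /= mulr1.
  have -> : 2 * pospart t - s^-1 * (pospart (s + t) ^+ 2 - pospart t ^+ 2) =
     - (s^-1 * (pospart (s + t) ^+ 2 - pospart t ^+ 2 - 2 * pospart t * s)).
    by field.
  rewrite normrN normrM normfV.
  have sp : 0 < `|s| by rewrite normr_gt0.
  rewrite ler_pdivrMl //; apply: le_trans (key s) _.
  have -> : s ^+ 2 = `|s| * `|s| by rewrite -expr2 real_normK ?num_real.
  rewrite ler_pM2l //; near: s.
  apply: dnbhs0_le => //.
by apply: DeriveDef; [apply/cvg_ex; exists (2 * pospart t)|apply: cvg_lim].
Unshelve. all: by end_near. Qed.

Lemma pospart_continuous : continuous pospart.
Proof. by move=> t; apply: (@continuous_max R R^o (fun t => t) (cst 0)); [exact: cvg_id|exact: cvg_cst]. Qed.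

(** The second difference of the positive part: a triangle of mass 1 on
    [x, x + 2h]. *)
Definition tent x h t : R :=
  (pospart (t - x) - 2 * pospart (t - x - h) + pospart (t - x - 2 * h)) / h ^+ 2.
(** The primitive of the triangle, which rises from 0 to 1 on [x, x + 2h]. A
    difference of two steps is an admissible test function. *)
Definition step x h t : R :=
  (2^-1 * pospart (t - x) ^+ 2 - pospart (t - x - h) ^+ 2
   + 2^-1 * pospart (t - x - 2 * h) ^+ 2) / h ^+ 2.

Lemma tent_bound x h t : 0 < h -> 0 <= tent x h t <= h^-1.
Proof.
move=> h0; have h2 : 0 < h ^+ 2 by rewrite exprn_gt0.
have -> : h^-1 = h / h ^+ 2 by field; rewrite gt_eqF.
rewrite /tent ler_pM2r ?invr_gt0 // pmulr_lge0 ?invr_gt0 // /pospart.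
apply/andP; split; have [?|?] := leP (t - x) 0; have [?|?] := leP (t - x - h) 0;
  have [?|?] := leP (t - x - 2 * h) 0; lra.
Qed.

Lemma tent_supp x h t : 0 < h -> ~~ (x <= t <= x + 2 * h) -> tent x h t = 0.
Proof.
move=> h0 H; rewrite /tent.
suff -> : pospart (t - x) - 2 * pospart (t - x - h) + pospart (t - x - 2 * h) = 0 by rewrite mul0r.
move: H; rewrite negb_and -!ltNge /pospart => /orP H.
have [?|?] := leP (t - x) 0; have [?|?] := leP (t - x - h) 0;
  have [?|?] := leP (t - x - 2 * h) 0; case: H => ?; lra.
Qed.

Lemma step_bound x h t : 0 < h -> 0 <= step x h t <= 1.
Proof.
move=> h0; have h2 : 0 < h ^+ 2 by rewrite exprn_gt0.
rewrite /step ler_pdivrMr // mul1r pmulr_lge0 ?invr_gt0 // /pospart.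
apply/andP; split; have [?|?] := leP (t - x) 0; have [?|?] := leP (t - x - h) 0;
  have [?|?] := leP (t - x - 2 * h) 0; nra.
Qed.

Lemma step_left x h t : 0 < h -> t <= x -> step x h t = 0.
Proof.
move=> h0 H; rewrite /step.
rewrite /pospart !max_r; first by field; rewrite gt_eqF.
all: lra.
Qed.

Lemma step_right x h t : 0 < h -> x + 2 * h <= t -> step x h t = 1.
Proof.
move=> h0 H; rewrite /step /pospart !max_l; first by field; rewrite gt_eqF.
all: lra.
Qed.

Lemma step_is_derive x h t : is_derive t 1 (step x h) (tent x h t).
Proof.
have shift c : is_derive t 1 (fun s => pospart (s - c) ^+ 2) (2 * pospart (t - c)).
  have -> : (fun s => pospart (s - c) ^+ 2) = (fun s => pospart s ^+ 2) \o (fun s => s - c) by [].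
  have D : is_derive t 1 (fun s : R => s - c) 1.
    by rewrite -[X in is_derive _ _ _ X]subr0; apply: is_deriveB.
  have := @is_derive1_comp _ (fun s => pospart s ^+ 2) (fun s => s - c) t _ _ (pospart_sqr_is_derive (t - c)) D.
  by rewrite mulr1.
have -> : step x h = (fun s : R => (h ^+ 2)^-1 *: (2^-1 *: pospart (s - x) ^+ 2 -
    pospart (s - (x + h)) ^+ 2 + 2^-1 *: pospart (s - (x + 2 * h)) ^+ 2)).
  apply/funext => s; rewrite /step /GRing.scale /= !opprD !addrA; ring.
have D := is_deriveZ (h ^+ 2)^-1 (is_deriveD (is_deriveB
  (is_deriveZ 2^-1 (shift x)) (shift (x + h))) (is_deriveZ 2^-1 (shift (x + 2 * h)))).
apply: is_derive_eq D _.
rewrite /tent /GRing.scale /= !opprD !addrA.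
by set q := (h ^+ 2)^-1; field.
Qed.

Lemma tent_continuous x h : continuous (tent x h).
Proof.
have shift c : continuous (fun s => pospart (s - c)).
  move=> t; apply: (@continuous_comp _ _ _ (fun s => s - c) pospart); last exact: pospart_continuous.
  by apply: cvgB; [exact: cvg_id|exact: cvg_cst].
move=> t; rewrite /tent.
have -> : (fun t0 => (pospart (t0 - x) - 2 * pospart (t0 - x - h) + pospart (t0 - x - 2 * h)) / h ^+ 2)
  = (fun t0 => (pospart (t0 - x) - 2 * pospart (t0 - (x + h)) + pospart (t0 - (x + 2 * h))) / h ^+ 2).
  by apply/funext => s; rewrite !opprD !addrA.
apply: cvgM; last exact: cvg_cst.
apply: cvgD; last exact: shift.
apply: cvgB; first exact: shift.
by apply: cvgM; [exact: cvg_cst|exact: shift].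
Qed.

Lemma step_derive1 x h : derive1 (step x h) = tent x h.
Proof. by apply/funext => t; rewrite derive1E; have [_ ->] := step_is_derive x h t. Qed.

Lemma step_continuous x h : continuous (step x h).
Proof.
move=> t; apply/differentiable_continuous/derivable1_diffP.
by have [] := step_is_derive x h t.
Qed.
End Bump.

(** * Functions with an integrable weak derivative *)

Section WeakReal.
Variable R : realType.
Notation mu := (@lebesgue_measure R).
Notation Omega := (`]0, 1[%classic : set R).
Implicit Types (f g : R -> R) (x t h : R).

Definition L1 f := mu.-integrable Omega (EFin \o f).

(** The real form of the weak derivative; the complex one splits into real and
    imaginary parts. *)
Definition weak_deriv f g := forall phi : R -> R, test_function phi ->
  \int[mu]_(x in Omega) (f x * derive1 phi x) = - \int[mu]_(x in Omega) (g x * phi x).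

Lemma aeS (P Q : R -> Prop) : (forall x, P x -> Q x) ->
  {ae mu, forall x, P x} -> {ae mu, forall x, Q x}.
Proof.
by move=> PQ; apply: filterS => //; exact: (ae_filter_ringOfSetsType mu).
Qed.

Lemma aeS2 (P Q S : R -> Prop) : (forall x, P x -> Q x -> S x) ->
  {ae mu, forall x, P x} -> {ae mu, forall x, Q x} -> {ae mu, forall x, S x}.
Proof.
by move=> PQ; apply: filterS2 => //; exact: (ae_filter_ringOfSetsType mu).
Qed.

Lemma integrable_scale (D : set R) f (r : R) : measurable D ->
  mu.-integrable D (EFin \o f) -> mu.-integrable D (EFin \o (fun t => r * f t)).
Proof.
move=> mD fi; rewrite (_ : _ \o _ = (fun t => r%:E * (EFin \o f) t))%E //.
exact: integrableZl.
Qed.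

Lemma L1_integralB f g : L1 f -> L1 g ->
  \int[mu]_(t in Omega) (f t - g t) =
  \int[mu]_(t in Omega) f t - \int[mu]_(t in Omega) g t.
Proof. by move=> fi gi; rewrite RintegralB. Qed.

Lemma L1_le_norm f : L1 f ->
  `|\int[mu]_(t in Omega) f t| <= \int[mu]_(t in Omega) `|f t|.
Proof. by move=> fi; apply: le_normr_Rintegral. Qed.

Lemma L1_mul_bounded g (h : R -> R) (M : R) : L1 g -> measurable_fun Omega h ->
  (forall t, Omega t -> `|h t| <= M) -> L1 (fun t => g t * h t).
Proof.
move=> ig mh bh.
rewrite /L1; have -> : (EFin \o (fun t => g t * h t)) = ((EFin \o g) \* (EFin \o h))%E.
  by [].
apply: integrableMl => //; exists M; split; first exact: num_real.
by move=> N MN t /= Ot; exact: le_trans (bh _ Ot) (ltW MN).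
Qed.

Lemma cont_mfun (h : R -> R) : continuous h -> measurable_fun Omega h.
Proof. by move=> ch; apply: measurable_funTS; exact: continuous_measurable_fun. Qed.

Let hn (n : nat) : R := n.+1%:R^-1.
Let hn_gt0 n : 0 < hn n. Proof. by rewrite invr_gt0. Qed.

Lemma step_abs x h t : 0 < h -> `|step x h t| <= 1.
Proof. by move=> h0; have /andP[a b] := step_bound x t h0; rewrite ger0_norm. Qed.

(** Dominated convergence: the steps at x are bounded by 1 and converge to the
    indicator function of the half-line beyond x. *)
Lemma step_integral_cvg g x : L1 g ->
  (fun n => \int[mu]_(t in Omega) (g t * step x (hn n) t)) @ \oo -->
  \int[mu]_(t in Omega `&` `]x, +oo[) g t.
Proof.
move=> ig; rewrite Rintegral_mkcondr.
pose F n t := (g t * step x (hn n) t)%:E.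
pose G t := ((g \_ `]x, +oo[) t)%:E.
have iF n : mu.-integrable Omega (F n).
  apply: (@L1_mul_bounded _ _ 1) => //; last by move=> t _; exact: step_abs.
  by apply: cont_mfun; exact: step_continuous.
have [||||||iG _ cv] := @dominated_convergence _ _ _ mu Omega _ F G (fun t => `|(g t)%:E|%E).
- exact: measurable_itv.
- by move=> n; exact: measurable_int (iF n).
- apply/measurable_EFinP; apply/measurable_restrict; [exact: measurable_itv|exact: measurable_itv|].
  have mg : measurable_fun Omega g by apply/measurable_EFinP; exact: measurable_int ig.
  by apply: measurable_funS mg; [exact: measurable_itv|move=> t []].
- apply: aeW => t _; rewrite /F /G; apply/cvg_EFin; first by near=> n.
  rewrite /comp /patch /=; have [|] := boolP (t \in `]x, +oo[%classic).
    rewrite inE /= in_itv /= andbT => xt.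
    have p : 0 < (t - x) / 2 by lra.
    apply: (@cvg_near_cst _ _ (g t : R^o)); near=> n.
    rewrite /= step_right ?mulr1 //.
    have : hn n < (t - x) / 2.
      by near: n; exact: (near_infty_natSinv_lt (PosNum p)).
    lra.
  rewrite notin_setE /= in_itv /= andbT => /negP; rewrite -leNgt => tx.
  apply: (@cvg_near_cst _ _ (0 : R^o)); near=> n.
  by rewrite /= step_left ?mulr0.
- exact: integrable_abse.
- apply: aeW => t n _; rewrite /F /= lee_fin normrM ler_piMr //; exact: step_abs.
rewrite /Rintegral; apply: fine_cvg.
by rewrite fineK //; exact: integrable_fin_num.
Unshelve. all: by end_near.
Qed.

Lemma L1_cont (h : R -> R) : continuous h -> L1 h.
Proof.
move=> ch; apply: (@integrableS _ _ _ mu `[0, 1]); first exact: measurable_itv.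
- exact: measurable_itv.
- exact: subset_itv_oo_cc.
- apply: continuous_compact_integrable; first exact: segment_compact.
  exact: continuous_subspaceT.
Qed.

Lemma tent_integral x h : 0 < h -> 0 < x -> x + 2 * h < 1 ->
  \int[mu]_(t in Omega) tent x h t = 1.
Proof.
move=> h0 x0 x1.
have ib : L1 (tent x h) by apply: L1_cont; exact: tent_continuous.
have ib' : mu.-integrable `[0, 1] (EFin \o tent x h).
  apply: continuous_compact_integrable; first exact: segment_compact.
  by apply: continuous_subspaceT; exact: tent_continuous.
have -> : \int[mu]_(t in Omega) tent x h t = \int[mu]_(t in `[0, 1]) tent x h t.
  rewrite (Rintegral_itv_bndo_bndc ib) (Rintegral_itv_obnd_cbnd) //.
  by apply: integrableS ib'; [exact: measurable_itv|exact: measurable_itv|exact: subset_itv_oc_cc].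
rewrite /Rintegral (@continuous_FTC2 _ (tent x h) (step x h)) //=.
- by rewrite step_right ?step_left //; lra.
- by apply: continuous_subspaceT; exact: tent_continuous.
- split.
  + by move=> t _; have [] := step_is_derive x h t.
  + by apply: cvg_at_right_filter; exact: step_continuous.
  + by apply: cvg_at_left_filter; exact: step_continuous.
- by move=> t _; rewrite step_derive1.
Qed.

Lemma tent_abs x h t : 0 < h -> `|tent x h t| <= h^-1.
Proof. by move=> h0; have /andP[a b] := tent_bound x t h0; rewrite ger0_norm. Qed.

(** The triangle is at most 1/h on an interval contained in the ball of radius 3h
    around x, so its averages are controlled by averages over that ball, to which
    Lebesgue differentiation applies. *)
Lemma tent_average f x h : L1 f -> 0 < h -> 0 < x - 3 * h -> x + 3 * h < 1 ->
  `| \int[mu]_(t in Omega) (f t * tent x h t) - f x |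
    <= 6 * fine (davg (f \_ Omega) x (3 * h)).
Proof.
move=> fi h0 xl xr.
have cb : continuous (tent x h) by exact: tent_continuous.
have ib : L1 (tent x h) by exact: L1_cont.
have h30 : 0 < 3 * h by lra.
have ifb : L1 (fun t => f t * tent x h t).
  by apply: (@L1_mul_bounded _ _ h^-1) => //; [exact: cont_mfun|move=> t _; exact: tent_abs].
have icf : L1 (fun t => f t - f x).
  have ic : L1 (cst (f x)) by apply: L1_cont; exact: cst_continuous.
  rewrite /L1 (_ : _ \o _ = (EFin \o f) \- (EFin \o cst (f x)))%E //.
  by apply: integrableB => //; exact: measurable_itv.
have icb : L1 (fun t => (f t - f x) * tent x h t).
  by apply: (@L1_mul_bounded _ _ h^-1) => //; [exact: cont_mfun|move=> t _; exact: tent_abs].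
have -> : \int[mu]_(t in Omega) (f t * tent x h t) - f x =
   \int[mu]_(t in Omega) ((f t - f x) * tent x h t).
  transitivity (\int[mu]_(t in Omega) (f t * tent x h t) -
      \int[mu]_(t in Omega) (f x * tent x h t)).
    rewrite RintegralZl //.
    by rewrite tent_integral ?mulr1 //; lra.
  rewrite -RintegralB //; first by apply: eq_Rintegral => t _; rewrite mulrBl.
  by apply: integrable_scale ib; exact: measurable_itv.
have mB : measurable (ball x (3 * h) : set R) by exact: measurable_ball.
have Bsub : ball x (3 * h) `<=` Omega.
  by move=> t; rewrite ball_itv /= !in_itv /= => /andP[? ?]; apply/andP; split; lra.
have iB : mu.-integrable (ball x (3 * h)) (EFin \o (fun t => `|f t - f x|)).
  by apply: integrable_norm; apply: integrableS icf => //; exact: measurable_itv.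
apply: le_trans (L1_le_norm icb) _.
have E1 : \int[mu]_(t in Omega) `|(f t - f x) * tent x h t| =
    \int[mu]_(t in ball x (3 * h)) `|(f t - f x) * tent x h t|.
  rewrite -[in RHS](setIidr Bsub) Rintegral_mkcondr; apply: eq_Rintegral => t _.
  rewrite patchE; case: ifPn => //; rewrite notin_setE ball_itv /= in_itv /= => nb.
  rewrite tent_supp ?mulr0 ?normr0 //; apply/negP => /andP[? ?]; apply: nb.
  by apply/andP; split; lra.
rewrite E1.
apply: (@le_trans _ _ (\int[mu]_(t in ball x (3 * h)) (h^-1 * `|f t - f x|))).
  apply: le_Rintegral => //.
  - by apply: integrable_norm; apply: integrableS icb => //; exact: measurable_itv.
  - exact: integrable_scale.
  - move=> t _; rewrite normrM mulrC ler_wpM2r //; exact: tent_abs.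
rewrite RintegralZl // /davg /iavg.
have -> : (\int[mu]_(y in ball x (3 * h)) `|((center ((f \_ Omega) x) \o (f \_ Omega)) y)%:E|
   = \int[mu]_(y in ball x (3 * h)) (`|f y - f x|)%:E)%E.
  apply: eq_integral => y; rewrite inE => yB /=.
  have Ox : Omega x by rewrite /= in_itv /=; apply/andP; split; lra.
  by rewrite !patchE (mem_set (Bsub _ yB)) (mem_set Ox).
rewrite lebesgue_measure_ball ?(ltW h30) //.
rewrite fineM //; last exact: integrable_fin_num.
rewrite inver mulrn_eq0 /= gt_eqF //= -/(Rintegral _ _ _).
rewrite le_eqVlt; apply/orP; left; apply/eqP.
set I := Rintegral _ _ _; rewrite -mulr_natr; field.
by rewrite gt_eqF.
by rewrite inver mulrn_eq0 /= gt_eqF.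
Qed.

Lemma tent_integral_cvg f x : L1 f -> Omega x -> lebesgue_pt (f \_ Omega) x ->
  (fun n => \int[mu]_(t in Omega) (f t * tent x (hn n) t)) @ \oo --> f x.
Proof.
move=> fi; rewrite /= in_itv /= => /andP[x0 x1] /fine_cvgP[_ lp].
apply/cvgrPdist_le => /= e e0.
have e6 : 0 < e / 6 by lra.
have [d /= d0 Hd] := (proj1 (cvgrPdist_le _ _) lp) _ e6.
have p1 : 0 < x / 3 by lra.
have p2 : 0 < (1 - x) / 3 by lra.
have p3 : 0 < d / 3 by lra.
near=> n; rewrite distrC.
have h1 : hn n < x / 3 by near: n; exact: (near_infty_natSinv_lt (PosNum p1)).
have h2 : hn n < (1 - x) / 3 by near: n; exact: (near_infty_natSinv_lt (PosNum p2)).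
have h3 : hn n < d / 3 by near: n; exact: (near_infty_natSinv_lt (PosNum p3)).
have hp := hn_gt0 n.
apply: le_trans (tent_average fi hp _ _) _; [lra|lra|].
have := Hd (3 * hn n); rewrite /= !sub0r !normrN => /(_ _ _) H.
have {}H : `|fine (davg (f \_ Omega) x (3 * hn n))| <= e / 6.
  by apply: H; [rewrite gtr0_norm; lra|lra].
have := ler_norm (fine (davg (f \_ Omega) x (3 * hn n))); lra.
Unshelve. all: by end_near.
Qed.

Lemma test_function_step c x h : 0 < h -> 0 < c -> 0 < x -> c + 2 * h < 1 -> x + 2 * h < 1 ->
  test_function (fun t => step c h t - step x h t) /\
  derive1 (fun t => step c h t - step x h t) = (fun t => tent c h t - tent x h t).
Proof.
move=> h0 c0 x0 c1 x1.
have D t : is_derive t 1 (fun t => step c h t - step x h t) (tent c h t - tent x h t).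
  exact: (is_deriveB (step_is_derive c h t) (step_is_derive x h t)).
have E : derive1 (fun t => step c h t - step x h t) = (fun t => tent c h t - tent x h t).
  by apply/funext => t; rewrite derive1E; have [_ ->] := D t.
split => //; split.
- by move=> t; have [] := D t.
- by rewrite E => t; apply: cvgB; exact: tent_continuous.
- exists (Num.min c x), (Num.max (c + 2 * h) (x + 2 * h)); split.
  + by rewrite lt_min c0 x0.
  + by rewrite gt_max c1 x1.
  + move=> t; rewrite negb_and -!ltNge => /orP[].
      by rewrite lt_min => /andP[? ?]; rewrite !step_left ?subrr //; apply: ltW.
    by rewrite gt_max => /andP[? ?]; rewrite !step_right ?subrr //; apply: ltW.
Qed.

(** The fundamental theorem of calculus in weak form. Test with the difference of
    two steps, at points c and x, and let their width tend to 0: the left side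
    tends to f c - f x at Lebesgue points, and the right side to a difference of
    integrals of g. Fix one Lebesgue point c. *)
Lemma weak_deriv_primitive f g : L1 f -> L1 g -> weak_deriv f g ->
  exists C : R, {ae mu, forall x, Omega x ->
    f x = C + \int[mu]_(t in `]0, x]) g t}.
Proof.
move=> fi gi fg.
have tail x : Omega x -> \int[mu]_(t in Omega `&` `]x, +oo[) g t =
    \int[mu]_(t in Omega) g t - \int[mu]_(t in `]0, x]) g t.
  rewrite /= in_itv /= => /andP[x0 x1].
  rewrite Rintegral_itvB ?bnd_simp ?ltW //.
  congr Rintegral; apply/seteqP; split => t /=; rewrite !in_itv /= ?andbT.
    by move=> [/andP[_ ->] ->].
  by move=> /andP[a b]; split => //; rewrite b andbT (lt_trans x0).
have key c x : Omega c -> Omega x -> lebesgue_pt (f \_ Omega) c ->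
    lebesgue_pt (f \_ Omega) x ->
    f c - f x = \int[mu]_(t in `]0, c]) g t - \int[mu]_(t in `]0, x]) g t.
  move=> Oc Ox lc lx.
  have := cvgB (tent_integral_cvg fi Oc lc) (tent_integral_cvg fi Ox lx).
  have := cvgN (cvgB (step_integral_cvg (x := c) gi) (step_integral_cvg (x := x) gi)).
  have FF : Filter (nbhs (\oo : set_system nat)) by exact: eventually_filter.
  rewrite !tail // => /(_ FF FF) L1' /(_ FF) L2'.
  have -> : f c - f x = - ((\int[mu]_(t in Omega) g t - \int[mu]_(t in `]0, c]) g t) -
     (\int[mu]_(t in Omega) g t - \int[mu]_(t in `]0, x]) g t)); last by ring.
  apply: (cvg_unique _ L2'); first exact: Rhausdorff.
  apply: cvg_trans L1'; apply: near_eq_cvg.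
  move: Oc Ox; rewrite /= !in_itv /= => /andP[c0 c1] /andP[x0 x1].
  have p1 : 0 < (1 - c) / 2 by lra.
  have p2 : 0 < (1 - x) / 2 by lra.
  near=> n.
  have h1 : hn n < (1 - c) / 2 by near: n; exact: (near_infty_natSinv_lt (PosNum p1)).
  have h2 : hn n < (1 - x) / 2 by near: n; exact: (near_infty_natSinv_lt (PosNum p2)).
  have [||||tf df] := @test_function_step c x (hn n) (hn_gt0 n); [lra..|].
  have is' y : L1 (fun t => g t * step y (hn n) t).
    by apply: (@L1_mul_bounded _ _ 1) => //;
      [apply: cont_mfun; exact: step_continuous|move=> t _; exact: step_abs].
  have ib' y : L1 (fun t => f t * tent y (hn n) t).
    by apply: (@L1_mul_bounded _ _ (hn n)^-1) => //;
      [apply: cont_mfun; exact: tent_continuous|move=> t _; exact: tent_abs].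
  have := fg _ tf; rewrite df => E.
  have Eg := L1_integralB (is' c) (is' x).
  have Ef := L1_integralB (ib' c) (ib' x).
  refine (etrans (esym (congr1 -%R Eg)) (etrans _ Ef)).
  under eq_Rintegral do rewrite -mulrBr.
  rewrite -E; apply: eq_Rintegral => t _; by rewrite mulrBr.
have aeL : {ae mu, forall x, lebesgue_pt (f \_ Omega) x}.
  by apply: lebesgue_differentiation; apply: integrable_locally => //; exact: measurable_itv.
have [[c [Oc lc]]|nc] := pselect (exists c, Omega c /\ lebesgue_pt (f \_ Omega) c).
  exists (f c - \int[mu]_(t in `]0, c]) g t).
  apply: aeS aeL => x lx Ox.
  by have := key _ _ Oc Ox lc lx; lra.
exists 0; apply: aeS aeL => x lx Ox; exfalso; apply: nc; by exists x.
Unshelve. all: by end_near.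
Qed.
End WeakReal.

(** * Continuous representatives *)

Section Primitive.
Variable R : realType.
Notation mu := (@lebesgue_measure R).
Notation Omega := (`]0, 1[%classic : set R).
Implicit Types (f g F G : R -> R) (x t h : R).

Definition cont01 F := {within `[0, 1], continuous F}.
(** The restriction to (0,1) makes the integrand integrable on the whole line, so
    that the primitive makes sense, and is continuous, on all of [0,1]. *)
Definition primitive g x := \int[mu]_(t in `[0, x]) (g \_ Omega) t.

Lemma restrict_integrable g (D : set R) : measurable D -> L1 g ->
  mu.-integrable D (EFin \o (g \_ Omega)).
Proof.
move=> mD gi; apply: (@integrableS _ _ _ mu setT) => //.
rewrite -restrict_EFin; apply/(integrable_mkcond _ _).1 => //.
Qed.

Lemma primitiveE g x : L1 g -> Omega x ->
  \int[mu]_(t in `]0, x]) g t = primitive g x.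
Proof.
move=> gi; rewrite /= in_itv /= => /andP[x0 x1]; rewrite /primitive.
rewrite -Rintegral_itv_obnd_cbnd; last exact: restrict_integrable.
apply: eq_Rintegral => t; rewrite inE /= in_itv /= => /andP[t0 tx].
by rewrite patchE mem_set //= in_itv /= t0 (le_lt_trans tx).
Qed.

Lemma primitive_cont g : L1 g -> cont01 (primitive g).
Proof.
move=> gi; apply: (parameterized_integral_continuous ler01).
exact: restrict_integrable.
Qed.

Lemma ae_eq_primitive g G x : L1 g -> L1 G ->
  {ae mu, forall t, Omega t -> g t = G t} -> primitive g x = primitive G x.
Proof.
move=> gi hi gh; rewrite /primitive /Rintegral; congr fine.
apply: ae_eq_integral => //.
- exact: measurable_int (restrict_integrable _ gi).
- exact: measurable_int (restrict_integrable _ hi).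
- apply: aeS gh => t gh _; rewrite /= !patchE; case: ifPn => //.
  by rewrite inE => /gh ->.
Qed.

Lemma primitive_is_derive G x : L1 G -> Omega x -> {for x, continuous G} ->
  is_derive x 1 (primitive G) (G x).
Proof.
move=> Gi Ox cG.
have [x0 x1] : 0 < x /\ x < 1 by move: Ox; rewrite /= in_itv /= => /andP[].
have cr : {for x, continuous (G \_ Omega)}.
  have E : \forall t \near x, G t = (G \_ Omega) t.
    have : \forall t \near x, Omega t by apply: open_nbhs_nbhs; split => //; exact: interval_open.
    by apply: filterS => t Ot; rewrite patchE mem_set.
  rewrite /prop_for /continuous_at patchE mem_set //.
  by apply: cvg_trans cG; apply: near_eq_cvg.
have [|dP EP] := @continuous_FTC1_closed R (G \_ Omega) 0 x 1 x1 _ x0 cr.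
  exact: restrict_integrable.
apply: DeriveDef => //.
by rewrite -derive1E EP patchE mem_set.
Qed.

Lemma ae_open_subset (P : R -> Prop) (a b : R) : a < b ->
  {ae mu, forall x, P x} -> exists x, a < x < b /\ P x.
Proof.
move=> ab [A [mA A0 sub]]; apply: contrapT => H.
have : mu `]a, b[ = 0.
  apply: (subset_measure0 _ mA _ A0); first exact: measurable_itv.
  move=> x; rewrite /= in_itv /= => xab; apply: sub => /= Px; apply: H.
  by exists x.
rewrite lebesgue_measure_itv /= lte_fin ab -EFinD => /eqP.
by rewrite eqe subr_eq0 gt_eqF.
Qed.

(** Two continuous functions that differ at a point of [0,1] differ on an interval
    inside (0,1), which is not negligible. *)
Lemma cont01_ae_eq F G : cont01 F -> cont01 G ->
  {ae mu, forall x, Omega x -> F x = G x} ->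
  forall x, 0 <= x <= 1 -> F x = G x.
Proof.
move=> cF cG FG x x01; apply/eqP/negPn/negP => ne.
pose D t := F t - G t.
have cD : cont01 D by move=> t; apply: cvgB; [exact: cF|exact: cG].
have Dx : 0 < `|D x| by rewrite normr_gt0 subr_eq0.
have := (subspace_continuousP _ _).1 cD x _.
rewrite /= in_itv /= => /(_ x01) /cvgrPdist_lt /(_ _ Dx).
rewrite near_withinE => -[e /= e0 He].
pose a := Num.max 0 (x - e); pose b := Num.min 1 (x + e).
have ab : a < b.
  rewrite /a /b gt_max !lt_min; move/andP: x01 => [? ?].
  by apply/andP; split; apply/andP; split; lra.
have [t [/andP[]]] := ae_open_subset ab FG.
rewrite gt_max lt_min => /andP[t0 tl] /andP[t1 tr] /(_ _) H.
have Dt : D t = 0 by rewrite /D H ?subrr //= in_itv /= t0 t1.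
have bt : `|x - t| < e by rewrite ltr_norml; apply/andP; split; lra.
have ti : t \in `[0, 1]%R by rewrite in_itv /= !ltW.
by have := He t bt ti; rewrite /from_subspace Dt subr0 ltxx.
Qed.

(** The continuous representative of f. Its derivative is only claimed for
    weak derivatives that agree almost everywhere with a continuous function: the
    equations satisfied by eigenfunctions always provide one. *)
Lemma weak_deriv_rep f g : L1 f -> L1 g -> weak_deriv f g ->
  exists F, [/\ cont01 F, {ae mu, forall x, Omega x -> f x = F x} &
    forall G, cont01 G -> {ae mu, forall x, Omega x -> g x = G x} ->
      forall x, Omega x -> is_derive x 1 F (G x)].
Proof.
move=> fi gi /(weak_deriv_primitive fi gi)[C HC].
exists (fun x => C + primitive g x); split.
- move=> x; apply: cvgD; [exact: cvg_cst|exact: primitive_cont].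
- by apply: aeS HC => x H Ox; rewrite (H Ox) primitiveE.
- move=> G cG gG x Ox.
  have Gi : L1 G.
    apply: (@integrableS _ _ _ mu `[0, 1]) => //; first exact: subset_itv_oo_cc.
    by apply: continuous_compact_integrable => //; exact: segment_compact.
  have -> : (fun x => C + primitive g x) = (fun x => C + primitive G x).
    by apply/funext => t; rewrite (ae_eq_primitive t gi Gi gG).
  have [cG' _ _] := (continuous_within_itvP _ (@ltr01 R)).1 cG.
  have := is_deriveD (is_derive_cst C x 1) (primitive_is_derive Gi Ox (cG' x Ox)).
  by rewrite add0r.
Qed.

(** Both integrals represent f up to a constant, so the primitive of g1 - g2 is
    constant, almost everywhere and then everywhere by continuity. It also has
    g1 - g2 as its derivative almost everywhere. *)
Lemma weak_deriv_unique f g1 g2 : L1 f -> L1 g1 -> L1 g2 ->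
  weak_deriv f g1 -> weak_deriv f g2 ->
  {ae mu, forall x, Omega x -> g1 x = g2 x}.
Proof.
move=> fi g1i g2i /(weak_deriv_primitive fi g1i)[C1 H1] /(weak_deriv_primitive fi g2i)[C2 H2].
pose h t := g1 t - g2 t.
have hi : L1 h.
  rewrite /L1 (_ : _ \o _ = (EFin \o g1) \- (EFin \o g2))%E //.
  by apply: integrableB => //; exact: measurable_itv.
have Ph x : Omega x -> primitive h x = primitive g1 x - primitive g2 x.
  move=> Ox; rewrite /primitive -RintegralB //.
  - apply: eq_Rintegral => t _; rewrite !patchE; case: ifP => //; by rewrite subrr.
  - exact: restrict_integrable.
  - exact: restrict_integrable.
have hcst x : Omega x -> primitive h x = C2 - C1.
  move=> Ox; apply: (@cont01_ae_eq (primitive h) (fun=> C2 - C1)).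
  - exact: primitive_cont.
  - by move=> t; exact: cvg_cst.
  - apply: aeS2 H1 H2 => t H1 H2 Ot.
    rewrite Ph //; have := H1 Ot; rewrite (H2 Ot) !primitiveE //; lra.
  - by move: Ox; rewrite /= in_itv /= => /andP[? ?]; rewrite !ltW.
have := @FTC1 R (h \_ Omega) (BLeft 0) _ _.
have i1 (y : R) : mu.-integrable [set` Interval (BLeft 0) (BRight y)] (EFin \o (h \_ Omega)).
  by apply: restrict_integrable => //; exact: measurable_itv.
have i2 : locally_integrable setT (h \_ Omega) by exact: integrable_locally.
move=> /(_ i1 i2) /=; apply: aeS => x + Ox.
have [x0 x1] : 0 < x /\ x < 1 by move: Ox; rewrite /= in_itv /= => /andP[].
rewrite lte_fin => /(_ x0)[_].
rewrite derive1E patchE mem_set // => E; apply/eqP; rewrite -subr_eq0; apply/eqP.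
rewrite -/(h x) -E -/(primitive h) (_ : 'D_1 _ x = 'D_1 (cst (C2 - C1)) x).
  by rewrite derive_cst.
apply: near_eq_derive.
have : \forall t \near x, Omega t by apply: open_nbhs_nbhs; split => //; exact: interval_open.
by apply: filterS => t Ot; exact: hcst.
Qed.

(** Integration by parts on [0,1]; the boundary terms vanish with the test
    function. *)
Lemma C1_weak_deriv F G : (forall x, is_derive x 1 F (G x)) -> continuous G ->
  weak_deriv F G.
Proof.
move=> dF cG phi [dphi cphi [c [d [c0 d1 supp]]]].
have cF : continuous F.
  by move=> x; apply/differentiable_continuous/derivable1_diffP; have [] := dF x.
have cp : continuous phi.
  by move=> x; apply/differentiable_continuous/derivable1_diffP; exact: dphi.
have p0 : phi 0 = 0 by apply: supp; rewrite negb_and -!ltNge c0.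
have p1 : phi 1 = 0 by apply: supp; rewrite negb_and -!ltNge d1 orbT.
have toc (k : R -> R) : continuous k ->
    \int[mu]_(t in Omega) k t = \int[mu]_(t in `[0, 1]) k t.
  move=> ck; have k1 : L1 k by exact: L1_cont.
  rewrite (Rintegral_itv_bndo_bndc k1) (Rintegral_itv_obnd_cbnd) //.
  apply: (@integrableS _ _ _ mu `[0, 1]) => //; first exact: subset_itv_oc_cc.
  apply: continuous_compact_integrable; first exact: segment_compact.
  exact: continuous_subspaceT.
rewrite !toc.
- rewrite (@Rintegration_by_parts _ F phi G (derive1 phi) 0 1).
  + by rewrite p0 p1 !mulr0 subrr sub0r.
  + exact: ltr01.
  + exact: continuous_subspaceT.
  + split.
    * by move=> t _; have [] := dF t.
    * by apply: cvg_at_right_filter; exact: cF.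
    * by apply: cvg_at_left_filter; exact: cF.
  + by move=> t _; rewrite derive1E; have [_ ->] := dF t.
  + exact: continuous_subspaceT.
  + split.
    * by move=> t _; exact: dphi.
    * by apply: cvg_at_right_filter; exact: cp.
    * by apply: cvg_at_left_filter; exact: cp.
  + by move=> t _.
- by move=> t; apply: cvgM; [exact: cG|exact: cp].
- by move=> t; apply: cvgM; [exact: cF|exact: cphi].
Qed.
End Primitive.

(** * Complex-valued Sobolev functions *)

Section ComplexSobolev.
Variable R : realType.
Notation mu := (@lebesgue_measure R).
Notation Omega := (`]0, 1[%classic : set R).
Notation cRe := (@complex.Re R).
Notation cIm := (@complex.Im R).
Implicit Types (f g F G : R -> R[i]^o).

Definition cder F (x : R) (d : R[i]) :=
  is_derive x 1 (fun t => cRe (F t)) (cRe d) /\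
  is_derive x 1 (fun t => cIm (F t)) (cIm d).

Lemma complexP (z w : R[i]) : cRe z = cRe w -> cIm z = cIm w -> z = w.
Proof. by case: z w => [a b] [c d] /= -> ->. Qed.

Lemma L1_add (p q : R -> R) : L1 p -> L1 q -> L1 (fun x => p x + q x).
Proof.
move=> pi qi; rewrite /L1 (_ : _ \o _ = (EFin \o p) \+ (EFin \o q))%E //.
by apply: integrableD => //; exact: measurable_itv.
Qed.

(** |f| <= 1 + |f|^2 and (0,1) has finite measure. *)
Lemma L2_L1 f : L2 f -> L1 (fun x => cRe (f x)) /\ L1 (fun x => cIm (f x)).
Proof.
move=> [mr mi fin].
have i2 : L1 (fun x => cRe (f x) ^+ 2 + cIm (f x) ^+ 2).
  apply/integrableP; split.
    by apply/measurable_EFinP; apply: measurable_funD; apply: measurable_funX.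
  apply: le_lt_trans fin; rewrite le_eqVlt; apply/orP; left; apply/eqP.
  by apply: eq_integral => x _; rewrite /= ger0_norm // addr_ge0 ?sqr_ge0.
have i1 : L1 (fun x => 1 + (cRe (f x) ^+ 2 + cIm (f x) ^+ 2)).
  by apply: L1_add => //; apply: L1_cont; exact: cst_continuous.
split.
- apply: le_integrable i1 => //; first exact/measurable_EFinP.
  move=> x _ /=; rewrite lee_fin [leRHS]ger0_norm ?addr_ge0 ?sqr_ge0 //.
  by set a := cRe _; set c := cIm _; rewrite ler_norml; apply/andP; split; nra.
- apply: le_integrable i1 => //; first exact/measurable_EFinP.
  move=> x _ /=; rewrite lee_fin [leRHS]ger0_norm ?addr_ge0 ?sqr_ge0 //.
  by set a := cRe _; set c := cIm _; rewrite ler_norml; apply/andP; split; nra.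
Qed.

Lemma weak_derivP f g : is_weak_deriv f g <->
  weak_deriv (fun x => cRe (f x)) (fun x => cRe (g x)) /\
  weak_deriv (fun x => cIm (f x)) (fun x => cIm (g x)).
Proof.
have reE (u : R -> R[i]^o) (p : R -> R) :
    (fun x => cRe (u x * (p x)%:C)) = (fun x => cRe (u x) * p x).
  by apply/funext => x; case: (u x) => a c /=; rewrite mulr0 subr0.
have imE (u : R -> R[i]^o) (p : R -> R) :
    (fun x => cIm (u x * (p x)%:C)) = (fun x => cIm (u x) * p x).
  by apply/funext => x; case: (u x) => a c /=; rewrite mulr0 add0r.
split.
- move=> H; split=> phi /H; rewrite /cintegral !reE !imE => E.
  + exact: (congr1 cRe E).
  + exact: (congr1 cIm E).
- move=> [Hr Hi] phi tp; rewrite /cintegral !reE !imE Hr // Hi //.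
Qed.

Lemma eq01P f g : eq01 f g <->
  {ae mu, forall x, Omega x -> cRe (f x) = cRe (g x)} /\
  {ae mu, forall x, Omega x -> cIm (f x) = cIm (g x)}.
Proof.
split=> [H|[]].
- by split; apply: aeS H => x H Ox; rewrite H.
- by apply: aeS2 => x Hr Hi Ox; apply: complexP; [exact: Hr|exact: Hi].
Qed.

Lemma eq01_refl f : eq01 f f.
Proof. by apply: aeW. Qed.

Lemma eq01_sym f g : eq01 f g -> eq01 g f.
Proof. by apply: aeS => x H Ox; rewrite H. Qed.

Lemma eq01_trans f g k : eq01 f g -> eq01 g k -> eq01 f k.
Proof. by apply: aeS2 => x H1 H2 Ox; rewrite H1 // H2. Qed.

Lemma wderiv_spec f : H1 f -> L2 (wderiv f) /\ is_weak_deriv f (wderiv f).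
Proof.
by move=> [_ [g Hg]]; exact: (@xgetPex _ (fun=> 0) [set g | L2 g /\ is_weak_deriv f g] (ex_intro _ g Hg)).
Qed.

Lemma continuous01_eq F G : continuous01 F -> continuous01 G -> eq01 F G ->
  forall x, 0 <= x <= 1 -> F x = G x.
Proof.
move=> [Fr Fi] [Gr Gi] /eq01P[er ei] x x01; apply: complexP.
- exact: (cont01_ae_eq Fr Gr er).
- exact: (cont01_ae_eq Fi Gi ei).
Qed.

(** Traces are computed on any continuous representative, because two of them agree
    on all of [0,1], end points included. *)
Lemma trace_eq f F x : continuous01 F -> eq01 f F -> 0 <= x <= 1 -> trace f x = F x.
Proof.
move=> cF fF x01; rewrite /trace.
have [g [cg fg <-]] := @xgetPex _ (0 : R[i]) [set c | exists g, [/\ continuous01 g, eq01 f g & g x = c]]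
  (ex_intro _ (F x) (ex_intro _ F (And3 cF fF erefl))).
apply: continuous01_eq => //; apply: eq01_trans fF; exact: eq01_sym.
Qed.

Lemma H1_rep f : H1 f -> exists F, [/\ continuous01 F, eq01 f F &
  forall G, continuous01 G -> eq01 (wderiv f) G ->
    forall x, Omega x -> cder F x (G x)].
Proof.
move=> Hf; have [L2g /weak_derivP[wr wi]] := wderiv_spec Hf.
have [L2f _] := Hf.
have [fr fi] := L2_L1 L2f; have [gr gi] := L2_L1 L2g.
have [Fr [cFr eFr dFr]] := weak_deriv_rep fr gr wr.
have [Fi [cFi eFi dFi]] := weak_deriv_rep fi gi wi.
exists (fun x => Fr x +i* Fi x); split.
- by split.
- by apply/eq01P; split.
- move=> G [cGr cGi] /eq01P[eGr eGi] x Ox; split.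
  + exact: (dFr (fun t => cRe (G t))).
  + exact: (dFi (fun t => cIm (G t))).
Qed.

(** Continuity on the whole line; explicit solutions have it, which spares the
    bookkeeping at the end points of [0,1]. *)
Definition ccont F := continuous (fun x => cRe (F x)) /\ continuous (fun x => cIm (F x)).

Lemma ccont01 F : ccont F -> continuous01 F.
Proof. by move=> [cr ci]; split; exact: continuous_subspaceT. Qed.

Lemma cder_ccont F G : (forall x, cder F x (G x)) -> ccont F.
Proof.
move=> dF; split=> x; apply/differentiable_continuous/derivable1_diffP;
  by have [[? _] [? _]] := dF x.
Qed.

Lemma ccont_L2 F : ccont F -> L2 F.
Proof.
move=> [cr ci]; split; [exact: cont_mfun|exact: cont_mfun|].
have : L1 (fun x => cRe (F x) ^+ 2 + cIm (F x) ^+ 2).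
  apply: L1_cont => x; apply: cvgD; apply: cvgM; (try exact: cr); exact: ci.
move=> /integrableP[_]; apply: le_lt_trans.
rewrite le_eqVlt; apply/orP; left; apply/eqP.
by apply: eq_integral => x _; rewrite /= ger0_norm // addr_ge0 ?sqr_ge0.
Qed.

Lemma weak_deriv_ae (p q g : R -> R) : L1 p -> L1 q ->
  {ae mu, forall x, Omega x -> p x = q x} -> weak_deriv q g -> weak_deriv p g.
Proof.
move=> pi qi pq H phi tp; rewrite -H //.
have [_ cp _] := tp.
rewrite /Rintegral; congr fine; apply: ae_eq_integral => //.
- apply/measurable_EFinP; apply: measurable_funM; last exact: cont_mfun.
  by apply/measurable_EFinP; exact: measurable_int pi.
- apply/measurable_EFinP; apply: measurable_funM; last exact: cont_mfun.
  by apply/measurable_EFinP; exact: measurable_int qi.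
- by apply: aeS pq => x pq Ox /=; rewrite pq.
Qed.

Lemma C1_H1 f F G : L2 f -> eq01 f F -> (forall x, cder F x (G x)) -> ccont G ->
  H1 f /\ eq01 (wderiv f) G.
Proof.
move=> L2f /eq01P[er ei] dF cG.
have cF := cder_ccont dF.
have [Fr Fi] := L2_L1 (ccont_L2 cF).
have [fr fi] := L2_L1 L2f.
have [cGr cGi] := cG.
have wr : weak_deriv (fun x => cRe (f x)) (fun x => cRe (G x)).
  by apply: (weak_deriv_ae fr Fr er); apply: C1_weak_deriv => // x; have [] := dF x.
have wi : weak_deriv (fun x => cIm (f x)) (fun x => cIm (G x)).
  by apply: (weak_deriv_ae fi Fi ei); apply: C1_weak_deriv => // x; have [] := dF x.
have Hf : H1 f.
  split => //; exists G; split; first exact: ccont_L2.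
  by apply/weak_derivP.
split => //.
have [L2g /weak_derivP[wr' wi']] := wderiv_spec Hf.
have [gr gi] := L2_L1 L2g.
have [Gr Gi] := L2_L1 (ccont_L2 cG).
apply/eq01P; split.
- exact: (weak_deriv_unique fr gr Gr wr' wr).
- exact: (weak_deriv_unique fi gi Gi wi' wi).
Qed.

End ComplexSobolev.

(** * Modulus, exponential and derivatives in the complex plane *)

Section Modulus.
Variable R : realType.
Notation cRe := (@complex.Re R).
Notation cIm := (@complex.Im R).
Implicit Types z w h : R[i].

(** The modulus as a real number; the norm of [R[i]] is its image in [R[i]], where
    inequalities are less convenient. *)
Definition cabs z : R := ComplexField.Normc.normc z.

Lemma cabsE z : cabs z = Num.sqrt (cRe z ^+ 2 + cIm z ^+ 2).
Proof. by case: z. Qed.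

Lemma norm_cabs z : `|z| = (cabs z)%:C.
Proof. by rewrite normc_def cabsE. Qed.

Lemma cabs_ge0 z : 0 <= cabs z.
Proof. by rewrite cabsE sqrtr_ge0. Qed.

Lemma cabs0 : cabs 0 = 0.
Proof. exact: ComplexField.Normc.normc0. Qed.

Lemma cabs1 : cabs 1 = 1.
Proof. exact: ComplexField.Normc.normc1. Qed.

Lemma cabsM z w : cabs (z * w) = cabs z * cabs w.
Proof. exact: ComplexField.Normc.normcM. Qed.

Lemma cabsV z : cabs z^-1 = (cabs z)^-1.
Proof. exact: ComplexField.Normc.normcV. Qed.

Lemma cabsX z n : cabs (z ^+ n) = cabs z ^+ n.
Proof. by elim: n => [|n IH]; rewrite ?expr0 ?cabs1 // !exprS cabsM IH. Qed.

Lemma cabsN z : cabs (- z) = cabs z.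
Proof. by case: z => a b /=; rewrite /cabs /= !sqrrN. Qed.

Lemma cabs_eq0 z : (cabs z == 0) = (z == 0).
Proof.
apply/eqP/eqP => [|->]; last exact: cabs0.
exact: ComplexField.Normc.eq0_normc.
Qed.

Lemma cabs_gt0 z : (0 < cabs z) = (z != 0).
Proof. by rewrite lt_def cabs_ge0 andbT cabs_eq0. Qed.

Lemma cabsD z w : cabs (z + w) <= cabs z + cabs w.
Proof. by have := ler_normD z w; rewrite !norm_cabs -rmorphD lecR. Qed.

Lemma cabsB z w : cabs (z - w) <= cabs z + cabs w.
Proof. by rewrite -[cabs w]cabsN cabsD. Qed.

Lemma cabs_distC z w : cabs (z - w) = cabs (w - z).
Proof. by rewrite -cabsN opprB. Qed.

Lemma cabs_triangle w z v : cabs (z - v) <= cabs (z - w) + cabs (w - v).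
Proof. by apply: le_trans (cabsD _ _); rewrite addrA subrK. Qed.

Lemma cabs_lower z w : cabs z - cabs w <= cabs (z + w).
Proof. by have := cabsB (z + w) w; rewrite addrK; lra. Qed.

Lemma cabs_real (x : R) : cabs x%:C = `|x|.
Proof. by rewrite /cabs /= expr0n /= addr0 sqrtr_sqr. Qed.

Lemma Re_le_cabs z : `|cRe z| <= cabs z.
Proof. by rewrite cabsE -sqrtr_sqr ler_wsqrtr // lerDl sqr_ge0. Qed.

Lemma Im_le_cabs z : `|cIm z| <= cabs z.
Proof. by rewrite cabsE -sqrtr_sqr ler_wsqrtr // lerDr sqr_ge0. Qed.

Lemma cabs_le z : cabs z <= `|cRe z| + `|cIm z|.
Proof.
rewrite -[leRHS]ger0_norm ?addr_ge0 // -sqrtr_sqr cabsE ler_wsqrtr //.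
rewrite sqrrD -!normrX !(ger0_norm (sqr_ge0 _)).
have : 0 <= `|cRe z| * `|cIm z| by rewrite mulr_ge0.
rewrite -mulr_natr; lra.
Qed.

Definition cexp z : R[i] := (expR (cRe z))%:C * (cos (cIm z) +i* sin (cIm z)).

Lemma cexpD z w : cexp (z + w) = cexp z * cexp w.
Proof.
case: z w => [a b] [c d]; rewrite /cexp /= expRD cosD sinD.
by apply: complexP => /=; ring.
Qed.

Lemma cexp0 : cexp 0 = 1.
Proof. by rewrite /cexp /= expR0 cos0 sin0; apply: complexP => /=; ring. Qed.

Lemma cexpNK z : cexp z * cexp (- z) = 1.
Proof. by rewrite -cexpD subrr cexp0. Qed.

Lemma cexp_neq0 z : cexp z != 0.
Proof.
apply/eqP => H; have := cexpNK z; rewrite H mul0r => /esym/eqP.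
by rewrite oner_eq0.
Qed.

Lemma cexpN z : cexp (- z) = (cexp z)^-1.
Proof. by apply: (mulfI (cexp_neq0 z)); rewrite cexpNK divff ?cexp_neq0. Qed.

Lemma cabs_cexp z : cabs (cexp z) = expR (cRe z).
Proof.
rewrite /cexp cabsM cabs_real ger0_norm ?expR_ge0 // /cabs /=.
by rewrite cos2Dsin2 sqrtr1 mulr1.
Qed.

Lemma cabs_cexp_le z : cabs (cexp z) <= expR (cabs z).
Proof.
by rewrite cabs_cexp ler_expR; apply: le_trans (Re_le_cabs z); exact: ler_norm.
Qed.

Lemma cexp_eq1 z : cexp z = 1 -> exists k : int, z = 0 +i* (2 * k%:~R * pi).
Proof.
move=> H; have : expR (cRe z) = 1 by rewrite -cabs_cexp H cabs1.
move=> E0; have Rz : cRe z = 0 by apply: expR_inj; rewrite expR0.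
have Hc : cos (cIm z) = 1.
  have := congr1 cRe H; rewrite /cexp Rz expR0 /=; by rewrite mul1r mul0r subr0.
have pp : 0 < (2 * pi : R) by rewrite mulr_gt0 ?pi_gt0.
pose k := Num.floor (cIm z / (2 * pi)); exists k.
pose t := cIm z - 2 * k%:~R * pi.
have t0 : 0 <= t.
  rewrite subr_ge0 (_ : 2 * k%:~R * pi = k%:~R * (2 * pi)); last by ring.
  by rewrite -ler_pdivlMr // Num.Theory.floor_le.
have t1 : t < 2 * pi.
  have := Num.Theory.floorD1_gt (cIm z / (2 * pi)).
  rewrite -/k ltr_pdivrMr // intrD /t; lra.
have per (n : int) (x : R) : cos (x + 2 * n%:~R * pi) = cos x.
  have pn (m : nat) (y : R) : cos (y + 2 * m%:R * pi) = cos y.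
    have <- : (pi : R) *+ 2 *+ m = 2 * m%:R * pi by rewrite -mulrnA -[LHS]mulr_natl natrM.
    by apply: periodicn; exact: cosD2pi.
  case: n => m; first exact: pn.
  rewrite NegzE -(pn m.+1 (x + _)); congr cos.
  by rewrite mulrNz -pmulrn; ring.
have ct : cos t = 1 by rewrite -Hc -(per k t) /t subrK.
have tz : t = 0.
  have [tp|tp] := leP t pi.
    by apply: (@cos_inj R); rewrite ?in_itv /= ?cos0 ?lexx ?pi_ge0 ?t0 ?tp.
  exfalso; suff : (2 * pi - t : R) = 0 by lra.
  apply: (@cos_inj R); rewrite ?in_itv /= ?lexx ?pi_ge0 //.
  - by apply/andP; split; lra.
  - rewrite cos0 (_ : 2 * pi - t = - t + pi *+ 2); last by rewrite -[pi *+ 2]mulr_natl addrC.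
    by rewrite cosD2pi cosN.
by apply: complexP => //=; move: tz; rewrite /t; lra.
Qed.

Lemma cexp_period (k : int) : cexp (0 +i* (2 * k%:~R * pi)) = 1.
Proof.
have H1 : cexp (0 +i* (2 * pi)) = 1.
  rewrite /cexp /= expR0 mulr_natl.
  by rewrite cos2pi sin2pi; apply: complexP => /=; ring.
have Hn (n : nat) : cexp (0 +i* (2 * n%:R * pi)) = 1.
  elim: n => [|n IH]; first by rewrite mulr0 mul0r cexp0.
  have -> : 0 +i* (2 * n.+1%:R * pi) = 0 +i* (2 * pi) + 0 +i* (2 * n%:R * pi) :> R[i].
    by apply: complexP => /=; rewrite ?addr0 // mulrSr; ring.
  by rewrite cexpD H1 IH mulr1.
case: k => n; first by rewrite -pmulrn.
have -> : 0 +i* (2 * (Negz n)%:~R * pi) = - (0 +i* (2 * n.+1%:R * pi)) :> R[i].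
  by apply: complexP => /=; rewrite ?oppr0 // NegzE mulrNz -pmulrn; ring.
by rewrite cexpN Hn invr1.
Qed.
End Modulus.

Section ComplexDerivative.
Variable R : realType.
Notation cRe := (@complex.Re R).
Notation cIm := (@complex.Im R).
Notation cabs := (@cabs R).
Implicit Types (F G : R -> R[i]^o) (x : R) (a b d e z h : R[i]).

Lemma cder_cst a x : cder (fun=> a) x 0.
Proof. by split; exact: is_derive_cst. Qed.

Lemma cder_id x : cder (fun t => t%:C) x 1.
Proof. by split; [exact: is_derive_id|exact: is_derive_cst]. Qed.

Lemma cder_eq F x d e : cder F x d -> d = e -> cder F x e.
Proof. by move=> ? <-. Qed.

Lemma cderD F G x d e : cder F x d -> cder G x e ->
  cder (fun t => F t + G t) x (d + e).
Proof.
move=> [Fr Fi] [Gr Gi]; split.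
- rewrite (_ : (fun t => _) = (fun t => cRe (F t)) + (fun t => cRe (G t))).
    by rewrite raddfD; exact: is_deriveD.
  by apply/funext => t; rewrite raddfD.
- rewrite (_ : (fun t => _) = (fun t => cIm (F t)) + (fun t => cIm (G t))).
    by rewrite raddfD; exact: is_deriveD.
  by apply/funext => t; rewrite raddfD.
Qed.

Lemma cReM z w : cRe (z * w) = cRe z * cRe w - cIm z * cIm w.
Proof. by case: z w => [? ?] [? ?]. Qed.

Lemma cImM z w : cIm (z * w) = cRe z * cIm w + cIm z * cRe w.
Proof. by case: z w => [? ?] [? ?]. Qed.

Lemma cReD z w : cRe (z + w) = cRe z + cRe w.
Proof. by case: z w => [? ?] [? ?]. Qed.

Lemma cImD z w : cIm (z + w) = cIm z + cIm w.
Proof. by case: z w => [? ?] [? ?]. Qed.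

Lemma cderM F G x d e : cder F x d -> cder G x e ->
  cder (fun t => F t * G t) x (d * G x + F x * e).
Proof.
move=> [Fr Fi] [Gr Gi]; split.
- rewrite (_ : (fun t => _) = (fun t => cRe (F t)) * (fun t => cRe (G t))
     - (fun t => cIm (F t)) * (fun t => cIm (G t))); last first.
    by apply/funext => t; rewrite cReM.
  have := is_deriveB (is_deriveM Fr Gr) (is_deriveM Fi Gi).
  move=> /is_derive_eq; apply; rewrite cReD !cReM /GRing.scale /=; ring.
- rewrite (_ : (fun t => _) = (fun t => cRe (F t)) * (fun t => cIm (G t))
     + (fun t => cIm (F t)) * (fun t => cRe (G t))); last first.
    by apply/funext => t; rewrite cImM.
  have := is_deriveD (is_deriveM Fr Gi) (is_deriveM Fi Gr).
  move=> /is_derive_eq; apply; rewrite cImD !cImM /GRing.scale /=; ring.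
Qed.

Lemma cderZ F a x d : cder F x d -> cder (fun t => a * F t) x (a * d).
Proof. by move=> H; apply: cder_eq (cderM (cder_cst a x) H) _; rewrite mul0r add0r. Qed.

Lemma cderN F x d : cder F x d -> cder (fun t => - F t) x (- d).
Proof.
move=> H; rewrite (_ : (fun t => - F t) = (fun t => -1 * F t)).
  by apply: cder_eq (cderZ (-1) H) _; rewrite mulN1r.
by apply/funext => t; rewrite mulN1r.
Qed.

Lemma cderB F G x d e : cder F x d -> cder G x e ->
  cder (fun t => F t - G t) x (d - e).
Proof. by move=> H1 H2; exact: (cderD H1 (cderN H2)). Qed.

Lemma cder_cexp a x : cder (fun t => cexp (a * t%:C)) x (a * cexp (a * x%:C)).
Proof.
case: a => p q.
have E (t : R) : (p +i* q) * t%:C = (p * t) +i* (q * t) :> R[i].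
  by apply: complexP => /=; ring.
have Dp : is_derive x 1 (fun t : R => p * t) p.
  have := is_deriveZ p (is_derive_id x 1) => /is_derive_eq; apply.
  by rewrite /GRing.scale /= mulr1.
have Dq : is_derive x 1 (fun t : R => q * t) q.
  have := is_deriveZ q (is_derive_id x 1) => /is_derive_eq; apply.
  by rewrite /GRing.scale /= mulr1.
have De := is_derive1_comp (is_derive_expR (p * x)) Dp.
have Dc := is_derive1_comp (is_derive_cos (q * x)) Dq.
have Ds := is_derive1_comp (is_derive_sin (q * x)) Dq.
rewrite E; split.
- rewrite (_ : (fun t => _) = (expR \o (fun t : R => p * t)) * (cos \o (fun t : R => q * t))); last first.
    apply/funext => t; transitivity (expR (p * t) * cos (q * t)) => //.
    by rewrite E /cexp cReM /=; ring.
  have := is_deriveM De Dc => /is_derive_eq; apply.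
  by rewrite /cexp /GRing.scale /=; ring.
- rewrite (_ : (fun t => _) = (expR \o (fun t : R => p * t)) * (sin \o (fun t : R => q * t))); last first.
    apply/funext => t; transitivity (expR (p * t) * sin (q * t)) => //.
    by rewrite E /cexp cImM /=; ring.
  have := is_deriveM De Ds => /is_derive_eq; apply.
  by rewrite /cexp /GRing.scale /=; ring.
Qed.

(** The mean value inequality: the mean value theorem for the real and the imaginary
    part, which costs a factor 2. *)
Lemma cder_bound F G (M x : R) : continuous01 F -> 0 <= x <= 1 ->
  (forall t : R, 0 < t < 1 -> cder F t (G t)) ->
  (forall t : R, 0 < t < 1 -> cabs (G t) <= M) -> cabs (F x - F 0) <= 2 * M.
Proof.
move=> [cFr cFi] /andP[x0 x1] dF bG.
have M0 : 0 <= M by apply: le_trans (cabs_ge0 _) (bG 2^-1 _); apply/andP; split; lra.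
have sub : `[0, x] `<=` `[0, 1]%classic.
  by move=> t; rewrite /= !in_itv /= => /andP[-> ?]; exact: le_trans x1.
have mv (f g : R -> R) : {within `[0, 1], continuous f} ->
    (forall t : R, 0 < t < 1 -> is_derive t 1 f (g t)) ->
    (forall t : R, 0 < t < 1 -> `|g t| <= M) -> `|f x - f 0| <= M.
  move=> cf df bg; move: x0; rewrite le_eqVlt => /orP[/eqP <-|x0].
    by rewrite subrr normr0.
  have [|c] := @MVT R f g 0 x x0 _ (continuous_subspaceW sub cf).
    by move=> t; rewrite in_itv /= => /andP[t0 t1]; apply: df; rewrite t0 (lt_le_trans t1).
  rewrite in_itv /= => /andP[c0 c1] ->; rewrite subr0 normrM (ger0_norm (ltW x0)).
  have := bg c; rewrite c0 (lt_le_trans c1 x1) => /(_ isT) H.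
  by have := normr_ge0 (g c); nra.
apply: le_trans (cabs_le _) _; rewrite !raddfB /=.
have := mv _ _ cFr (fun t ht => proj1 (dF t ht)).
have := mv _ _ cFi (fun t ht => proj2 (dF t ht)).
move=> /(_ (fun t ht => le_trans (Im_le_cabs _) (bG t ht))) Hi.
move=> /(_ (fun t ht => le_trans (Re_le_cabs _) (bG t ht))) Hr.
lra.
Qed.

Lemma cder_bound1 F G (M : R) : (forall t : R, cder F t (G t)) ->
  (forall t : R, 0 < t < 1 -> cabs (G t) <= M) -> cabs (F 1 - F 0) <= 2 * M.
Proof.
move=> dF bG; apply: cder_bound (fun t _ => dF t) bG; last by rewrite ler01 lexx.
exact: ccont01 (cder_ccont dF).
Qed.

Let e1 : R := expR 1.
Let e1_ge1 : 1 <= e1. Proof. by rewrite /e1 -expR0 ler_expR. Qed.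

(** The Taylor estimates of the exponential of order 1, 2 and 3, each obtained from
    the previous one by the mean value inequality along the segment from 0 to h. *)
Lemma cexp_est1 h : cabs h <= 1 -> cabs (cexp h - 1) <= 2 * expR 1 * cabs h.
Proof.
move=> h1.
have -> : cexp h - 1 = cexp (h * 1%:C) - cexp (h * 0%:C).
  by rewrite mulr0 mulr1 cexp0.
rewrite -mulrA; apply: (cder_bound1 (F := fun t => cexp (h * t%:C)) (G := fun t => h * cexp (h * t%:C))).
  by move=> t; exact: cder_cexp.
move=> t /andP[t0 t1]; rewrite cabsM mulrC ler_wpM2r ?cabs_ge0 //.
apply: le_trans (cabs_cexp_le _) _; rewrite ler_expR cabsM cabs_real ger0_norm ?(ltW t0) //.
by rewrite (le_trans _ h1) // ler_piMr ?cabs_ge0 // ltW.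
Qed.

Lemma cexp_est2 h : cabs h <= 1 -> cabs (cexp h - 1 - h) <= 4 * expR 1 * cabs h ^+ 2.
Proof.
move=> h1; pose F (t : R) := cexp (h * t%:C) - h * t%:C.
have -> : cexp h - 1 - h = F 1 - F 0.
  by rewrite /F mulr0 mulr1 cexp0; ring.
rewrite (_ : 4 * _ * _ = 2 * (2 * expR 1 * cabs h ^+ 2)); last by ring.
apply: (cder_bound1 (F := F) (G := fun t => h * cexp (h * t%:C) - h * 1)).
  by move=> t; apply: cderB; [exact: cder_cexp|apply: cderZ; exact: cder_id].
move=> t /andP[t0 t1]; rewrite -mulrBr cabsM.
have ht : cabs (h * t%:C) <= cabs h.
  by rewrite cabsM cabs_real ger0_norm ?(ltW t0) // ler_piMr ?cabs_ge0 // ltW.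
have := cexp_est1 (le_trans ht h1) => H.
have := cabs_ge0 h; have := e1_ge1; rewrite /e1 => ? ?.
have : cabs (cexp (h * t%:C) - 1) <= 2 * expR 1 * cabs h by nra.
nra.
Qed.

Lemma cexp_est3 h : cabs h <= 1 ->
  cabs (cexp h - 1 - h - h ^+ 2 / 2) <= 8 * expR 1 * cabs h ^+ 3.
Proof.
move=> h1; pose F (t : R) := cexp (h * t%:C) - h * t%:C - h ^+ 2 / 2 * (t%:C * t%:C).
have -> : cexp h - 1 - h - h ^+ 2 / 2 = F 1 - F 0.
  by rewrite /F mulr0 mulr1 cexp0 ?mulr1 ?mulr0; ring.
rewrite (_ : 8 * _ * _ = 2 * (4 * expR 1 * cabs h ^+ 3)); last by ring.
apply: (cder_bound1 (F := F) (G := fun t => h * cexp (h * t%:C) - h * 1 - h ^+ 2 / 2 * (1 * t%:C + t%:C * 1))).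
  move=> t; apply: cderB; last by apply: cderZ; apply: cderM; exact: cder_id.
  by apply: cderB; [exact: cder_cexp|apply: cderZ; exact: cder_id].
move=> t /andP[t0 t1].
rewrite (_ : _ - _ = h * (cexp (h * t%:C) - 1 - h * t%:C)); last by field.
rewrite cabsM.
have ht : cabs (h * t%:C) <= cabs h.
  by rewrite cabsM cabs_real ger0_norm ?(ltW t0) // ler_piMr ?cabs_ge0 // ltW.
have := cexp_est2 (le_trans ht h1) => H.
have := cabs_ge0 h; have := e1_ge1; have := cabs_ge0 (h * t%:C); rewrite /e1 => ? ? ?.
have H2 : cabs (h * t%:C) ^+ 2 <= cabs h ^+ 2 by nra.
have H3 : cabs (cexp (h * t%:C) - 1 - h * t%:C) <= 4 * expR 1 * cabs h ^+ 2 by nra.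
rewrite (_ : 4 * _ * _ = cabs h * (4 * expR 1 * cabs h ^+ 2)); last by ring.
by rewrite ler_wpM2l.
Qed.
End ComplexDerivative.

(** * Strict differentiability *)

Section StrictDiff.
Variable R : realType.
Notation cRe := (@complex.Re R).
Notation cIm := (@complex.Im R).
Notation cabs := (@cabs R).
Notation C := R[i].
Implicit Types (x y z d e : C) (f g : C -> C) (p q : C -> C -> C).

Definition near2 (x0 : C) (P : C -> C -> Prop) :=
  exists2 r : R, 0 < r & forall x y, cabs (x - x0) <= r -> cabs (y - x0) <= r -> P x y.

Lemma near2I x0 P Q : near2 x0 P -> near2 x0 Q -> near2 x0 (fun x y => P x y /\ Q x y).
Proof.
move=> [r r0 HP] [s s0 HQ]; exists (Num.min r s); first by rewrite lt_min r0.
by move=> x y; rewrite !le_min => /andP[? ?] /andP[? ?]; split; [exact: HP|exact: HQ].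
Qed.

Lemma near2S x0 (P Q : C -> C -> Prop) : (forall x y, P x y -> Q x y) -> near2 x0 P -> near2 x0 Q.
Proof. by move=> PQ [r r0 HP]; exists r => // x y hx hy; apply/PQ/HP. Qed.

Definition gap (x0 x y : C) : R := cabs (x - x0) + cabs (y - x0).

Lemma gap_ge0 x0 x y : 0 <= gap x0 x y.
Proof. by rewrite addr_ge0 ?cabs_ge0. Qed.

Lemma near2_gap x0 (s : R) : 0 < s -> near2 x0 (fun x y => gap x0 x y <= s).
Proof. by move=> s0; exists (s / 2); [lra|move=> x y; rewrite /gap; lra]. Qed.

(** Convergence at a linear rate. The rate is what later yields remainders of the
    next order, for instance O(X^3) out of a first derivative. *)
Definition tends (x0 : C) q d := exists2 K : R, 0 <= K &
  near2 x0 (fun x y => cabs (q x y - d) <= K * gap x0 x y).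

(** Strict differentiability in the sense of Caratheodory: the difference quotient,
    as a function of two points, has a limit. Composition and inversion are then
    products and inverses of quotients, and Lipschitz bounds near x0 come for
    free; these suffice in place of holomorphy. *)
Definition sdiff f x0 d := exists2 q, tends x0 q d &
  near2 x0 (fun x y => f x - f y = q x y * (x - y)).

Lemma tends_cst x0 d : tends x0 (fun _ _ => d) d.
Proof.
exists 0 => //; exists 1 => // x y _ _; by rewrite subrr cabs0 mul0r.
Qed.

Lemma tendsD x0 p q d e : tends x0 p d -> tends x0 q e ->
  tends x0 (fun x y => p x y + q x y) (d + e).
Proof.
move=> [K K0 HK] [L L0 HL]; exists (K + L); first exact: addr_ge0.
move: (near2I HK HL); apply: near2S => x y [H1 H2].
rewrite opprD addrACA mulrDl; apply: le_trans (cabsD _ _) _; exact: lerD.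
Qed.

Lemma tendsM x0 p q d e : tends x0 p d -> tends x0 q e ->
  tends x0 (fun x y => p x y * q x y) (d * e).
Proof.
move=> [K K0 HK] [L L0 HL]; exists (K * (cabs e + L) + cabs d * L).
  by rewrite addr_ge0 ?mulr_ge0 ?addr_ge0 ?cabs_ge0.
move: (near2I (near2I HK HL) (near2_gap x0 ltr01)); apply: near2S => x y [[H1 H2] H3].
have -> : p x y * q x y - d * e = (p x y - d) * q x y + d * (q x y - e) by ring.
apply: le_trans (cabsD _ _) _; rewrite !cabsM mulrDl; apply: lerD; last first.
  by rewrite -mulrA ler_wpM2l ?cabs_ge0.
rewrite mulrAC; apply: ler_pM; rewrite ?cabs_ge0 //.
have := cabs_triangle e (q x y) 0; rewrite !subr0.
have := gap_ge0 x0 x y; nra.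
Qed.

Lemma tendsN x0 p d : tends x0 p d -> tends x0 (fun x y => - p x y) (- d).
Proof.
move=> [K K0 HK]; exists K => //; apply: near2S HK => x y H.
by rewrite -opprD cabsN.
Qed.

Lemma tends_bounded x0 p d : tends x0 p d -> near2 x0 (fun x y => cabs (p x y) <= cabs d + 1).
Proof.
move=> [K K0 HK].
have s0 : 0 < (K + 1)^-1 by rewrite invr_gt0; lra.
move: (near2I HK (near2_gap x0 s0)); apply: near2S => x y [H1 H2].
have := cabs_triangle d (p x y) 0; rewrite !subr0.
suff : K * gap x0 x y <= 1 by lra.
have : K * gap x0 x y <= K * (K + 1)^-1 by rewrite ler_wpM2l.
have : K * (K + 1)^-1 <= 1 by rewrite ler_pdivrMr; lra.
lra.
Qed.

Lemma tends_away x0 p d : d != 0 -> tends x0 p d -> near2 x0 (fun x y => cabs d / 2 <= cabs (p x y)).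
Proof.
rewrite -cabs_gt0 => d0 [K K0 HK].
have s0 : 0 < cabs d / 2 / (K + 1) by rewrite !divr_gt0 //; lra.
move: (near2I HK (near2_gap x0 s0)); apply: near2S => x y [H1 H2].
have := cabs_triangle (p x y) d 0; rewrite !subr0 cabs_distC.
suff : K * gap x0 x y <= cabs d / 2 by lra.
have := gap_ge0 x0 x y; move: H2; rewrite ler_pdivlMr; [nra|lra].
Qed.

Lemma tendsV x0 p d : d != 0 -> tends x0 p d -> tends x0 (fun x y => (p x y)^-1) d^-1.
Proof.
move=> d0 pd; have [K K0 HK] := pd; have dp := d0; rewrite -cabs_gt0 in dp.
exists (2 * K / cabs d ^+ 2); first by rewrite !mulr_ge0 ?invr_ge0 ?exprn_ge0 ?cabs_ge0.
move: (near2I HK (tends_away d0 pd)); apply: near2S => x y [H1 H2].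
have pp : 0 < cabs (p x y) by lra.
have p0 : p x y != 0 by rewrite -cabs_gt0.
have -> : (p x y)^-1 - d^-1 = - (p x y - d) / (p x y * d) by field; rewrite ?p0 ?d0.
rewrite cabsM cabsN cabsV cabsM ler_pdivrMr ?mulr_gt0 //.
apply: le_trans H1 _.
have -> : 2 * K / cabs d ^+ 2 * gap x0 x y * (cabs (p x y) * cabs d) =
   K * gap x0 x y * (2 * cabs (p x y) / cabs d) by field; rewrite gt_eqF.
rewrite ler_peMr ?mulr_ge0 ?gap_ge0 // ler_pdivlMr //; lra.
Qed.

(** Any constant larger than |d| would do; adding 1 is convenient when d = 0. *)
Lemma sdiff_lip f x0 d : sdiff f x0 d ->
  near2 x0 (fun x y => cabs (f x - f y) <= (cabs d + 1) * cabs (x - y)).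
Proof.
move=> [q qd E]; move: (near2I (tends_bounded qd) E); apply: near2S => x y [H ->].
by rewrite cabsM ler_wpM2r ?cabs_ge0.
Qed.

Lemma near2_diag x0 P : near2 x0 P ->
  exists2 r : R, 0 < r & forall x, cabs (x - x0) <= r -> P x x0.
Proof.
move=> [r r0 H]; exists r => // x hx; apply: H => //.
by rewrite subrr cabs0 ltW.
Qed.

Lemma sdiff_tends f x0 d : sdiff f x0 d ->
  tends x0 (fun x _ => f x) (f x0) /\ tends x0 (fun _ y => f y) (f x0).
Proof.
move=> /sdiff_lip /near2_diag[r r0 H].
have K0 : 0 <= cabs d + 1 by rewrite addr_ge0 ?cabs_ge0.
split; exists (cabs d + 1) => //; exists r => // x y hx hy.
- apply: le_trans (H _ hx) _; rewrite ler_wpM2l // lerDl cabs_ge0 //.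
- apply: le_trans (H _ hy) _; rewrite ler_wpM2l // lerDr cabs_ge0 //.
Qed.

Lemma sdiff_cst x0 d : sdiff (fun=> d) x0 0.
Proof.
exists (fun _ _ => 0); first exact: tends_cst.
by exists 1 => // x y _ _; rewrite subrr mul0r.
Qed.

Lemma sdiff_id x0 : sdiff (fun x => x) x0 1.
Proof.
exists (fun _ _ => 1); first exact: tends_cst.
by exists 1 => // x y _ _; rewrite mul1r.
Qed.

Lemma sdiff_eq f x0 d e : d = e -> sdiff f x0 d -> sdiff f x0 e.
Proof. by move=> <-. Qed.

Lemma sdiff_ext f g x0 d : (forall x, f x = g x) -> sdiff f x0 d -> sdiff g x0 d.
Proof. by move=> fg [q qd E]; exists q => //; apply: near2S E => x y; rewrite !fg. Qed.

Lemma sdiffD f g x0 d e : sdiff f x0 d -> sdiff g x0 e ->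
  sdiff (fun x => f x + g x) x0 (d + e).
Proof.
move=> [p pd Ef] [q qe Eg]; exists (fun x y => p x y + q x y); first exact: tendsD.
move: (near2I Ef Eg); apply: near2S => x y [H1 H2].
by rewrite opprD addrACA H1 H2 mulrDl.
Qed.

Lemma sdiffN f x0 d : sdiff f x0 d -> sdiff (fun x => - f x) x0 (- d).
Proof.
move=> [p pd Ef]; exists (fun x y => - p x y); first exact: tendsN.
by apply: near2S Ef => x y H; rewrite -opprD H mulNr.
Qed.

Lemma sdiffB f g x0 d e : sdiff f x0 d -> sdiff g x0 e ->
  sdiff (fun x => f x - g x) x0 (d - e).
Proof. by move=> H1 H2; exact: (sdiffD H1 (sdiffN H2)). Qed.

Lemma sdiffM f g x0 d e : sdiff f x0 d -> sdiff g x0 e ->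
  sdiff (fun x => f x * g x) x0 (d * g x0 + f x0 * e).
Proof.
move=> sf sg; have [_ tf] := sdiff_tends sf; have [tg _] := sdiff_tends sg.
move: sf sg => [p pd Ef] [q qe Eg].
exists (fun x y => p x y * g x + f y * q x y).
  by apply: tendsD; apply: tendsM.
move: (near2I Ef Eg); apply: near2S => x y [H1 H2].
have -> : f x * g x - f y * g y = (f x - f y) * g x + f y * (g x - g y) by ring.
by rewrite H1 H2; ring.
Qed.

Lemma sdiffV f x0 d : f x0 != 0 -> sdiff f x0 d ->
  sdiff (fun x => (f x)^-1) x0 (- d / f x0 ^+ 2).
Proof.
move=> f0 sf; have [tf1 tf2] := sdiff_tends sf.
have [p pd Ef] := sf.
exists (fun x y => - p x y * ((f x)^-1 * (f y)^-1)).
  rewrite expr2 invfM; apply: tendsM; first exact: tendsN.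
  by apply: tendsM; apply: tendsV.
have fp : 0 < cabs (f x0) / 2 by rewrite divr_gt0 // cabs_gt0.
move: (near2I Ef (near2I (tends_away f0 tf1) (tends_away f0 tf2))).
apply: near2S => x y [H1 [H2 H3]].
have fx : f x != 0 by rewrite -cabs_gt0; lra.
have fy : f y != 0 by rewrite -cabs_gt0; lra.
have -> : (f x)^-1 - (f y)^-1 = - (f x - f y) * ((f x)^-1 * (f y)^-1) by field; rewrite ?fx ?fy.
by rewrite H1; ring.
Qed.

Lemma near2_comp f x0 d P : sdiff f x0 d -> near2 (f x0) P ->
  near2 x0 (fun x y => P (f x) (f y)).
Proof.
move=> sf [s s0 HP]; have [r r0 Hf] := near2_diag (sdiff_lip sf).
have K0 : 0 < cabs d + 1 by have := cabs_ge0 d; lra.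
exists (Num.min r (s / (cabs d + 1))); first by rewrite lt_min r0 divr_gt0.
move=> x y; rewrite !le_min => /andP[x1 x2] /andP[y1 y2]; apply: HP.
- apply: le_trans (Hf _ x1) _; by rewrite mulrC -ler_pdivlMr.
- apply: le_trans (Hf _ y1) _; by rewrite mulrC -ler_pdivlMr.
Qed.

Lemma tends_comp f x0 d q e : sdiff f x0 d -> tends (f x0) q e ->
  tends x0 (fun x y => q (f x) (f y)) e.
Proof.
move=> sf [K K0 HK]; have [r r0 Hf] := near2_diag (sdiff_lip sf).
have L0 : 0 <= cabs d + 1 by have := cabs_ge0 d; lra.
exists (K * (cabs d + 1)); first by rewrite mulr_ge0.
have Hf2 : near2 x0 (fun x y => gap (f x0) (f x) (f y) <= (cabs d + 1) * gap x0 x y).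
  by exists r => // x y hx hy; rewrite /gap mulrDr lerD ?Hf.
move: (near2I (near2_comp sf HK) Hf2); apply: near2S => x y [H1 H2].
by apply: le_trans H1 _; rewrite -mulrA ler_wpM2l.
Qed.

Lemma sdiff_comp f g x0 d e : sdiff f x0 d -> sdiff g (f x0) e ->
  sdiff (fun x => g (f x)) x0 (e * d).
Proof.
move=> sf [q qe Eg]; have [p pd Ef] := sf.
exists (fun x y => q (f x) (f y) * p x y).
  by apply: tendsM => //; exact: tends_comp sf qe.
move: (near2I Ef (near2_comp sf Eg)); apply: near2S => x y [H1 ->].
by rewrite H1 mulrA.
Qed.

(** A right inverse that is continuous at x0 is strictly differentiable: its
    difference quotients are the inverses of those of g at the images. This covers
    square root and logarithm. *)
Lemma sdiff_right_inverse f g x0 e : e != 0 -> sdiff g (f x0) e ->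
  (forall s : R, 0 < s -> exists2 r : R, 0 < r &
     forall x, cabs (x - x0) <= r -> g (f x) = x /\ cabs (f x - f x0) <= s) ->
  sdiff f x0 e^-1.
Proof.
move=> e0 sg cont; have [q qe Eg] := sg.
have ep : 0 < cabs e by rewrite cabs_gt0.
have [s s0 Hs] := near2I Eg (tends_away e0 qe).
have [r r0 Hr] := cont s s0.
have key x y : cabs (x - x0) <= r -> cabs (y - x0) <= r ->
    [/\ x - y = q (f x) (f y) * (f x - f y), cabs e / 2 <= cabs (q (f x) (f y)) &
        cabs (f x - f y) <= 2 / cabs e * cabs (x - y)].
  move=> hx hy; have [gx fx] := Hr x hx; have [gy fy] := Hr y hy.
  have [E A] := Hs _ _ fx fy; rewrite gx gy in E; split => //.
  rewrite E cabsM mulrA ler_peMl ?cabs_ge0 //.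
  rewrite [leLHS](_ : 1 = 2 / cabs e * (cabs e / 2)); last by field; rewrite gt_eqF.
  by rewrite ler_wpM2l // divr_ge0 ?cabs_ge0.
have tq : tends x0 (fun x y => q (f x) (f y)) e.
  have [K K0 [s' s'0 HK]] := qe; have [r' r'0 Hr'] := cont s' s'0.
  exists (K * (2 / cabs e)); first by rewrite !mulr_ge0 ?invr_ge0 ?cabs_ge0.
  exists (Num.min r r'); first by rewrite lt_min r0.
  move=> x y; rewrite !le_min => /andP[x1 x2] /andP[y1 y2].
  have [_ fx] := Hr' _ x2; have [_ fy] := Hr' _ y2.
  apply: le_trans (HK _ _ fx fy) _; rewrite -mulrA ler_wpM2l //.
  have x00 : cabs (x0 - x0) <= r by rewrite subrr cabs0 ltW.
  have [_ _ ?] := key _ _ x1 x00; have [_ _ ?] := key _ _ y1 x00.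
  by rewrite /gap mulrDr lerD.
exists (fun x y => (q (f x) (f y))^-1); first exact: tendsV.
exists r => // x y hx hy; have [E A _] := key _ _ hx hy.
have q0 : q (f x) (f y) != 0 by rewrite -cabs_gt0; lra.
by rewrite {1}E mulrA mulVf // mul1r.
Qed.

Lemma sdiff_expansion f x0 d : sdiff f x0 d -> exists K r : R, [/\ 0 <= K, 0 < r &
  forall x, cabs (x - x0) <= r ->
    cabs (f x - f x0 - d * (x - x0)) <= K * cabs (x - x0) ^+ 2].
Proof.
move=> [q [K K0 HK] E]; have [r r0 H] := near2_diag (near2I HK E).
exists K, r; split => // x hx; have [H1 ->] := H _ hx.
rewrite -mulrBl cabsM expr2 mulrA ler_wpM2r ?cabs_ge0 //.
by apply: le_trans H1 _; rewrite /gap subrr cabs0 addr0.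
Qed.

Lemma sdiff_cexp x0 : sdiff (@cexp R) x0 (cexp x0).
Proof.
pose q x y := if x == y then cexp x0 else (cexp x - cexp y) / (x - y).
pose q1 (x y : C) := if x == y then 1 else (cexp (x - y) - 1) / (x - y).
have E x y : q1 x y * (x - y) = cexp (x - y) - 1.
  rewrite /q1; case: eqVneq => [->|ne]; first by rewrite !subrr cexp0 subrr mulr0.
  by rewrite divfK // subr_eq0.
have q1e : tends x0 q1 1.
  exists (4 * expR 1); first by rewrite mulr_ge0 ?expR_ge0.
  have := near2_gap x0 ltr01; apply: near2S => x y g1.
  have xy : cabs (x - y) <= gap x0 x y.
    by rewrite /gap [cabs (y - _)]cabs_distC cabs_triangle.
  rewrite /q1; case: eqVneq => [->|ne].
    by rewrite subrr cabs0 !mulr_ge0 ?expR_ge0 ?gap_ge0.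
  have ne0 : x - y != 0 by rewrite subr_eq0.
  have -> : (cexp (x - y) - 1) / (x - y) - 1 = (cexp (x - y) - 1 - (x - y)) / (x - y) by field.
  have dp : 0 < cabs (x - y) by rewrite cabs_gt0.
  rewrite cabsM cabsV ler_pdivrMr //.
  apply: le_trans (cexp_est2 (le_trans xy g1)) _.
  by rewrite expr2 mulrA ler_wpM2r ?cabs_ge0 // ler_wpM2l // mulr_ge0 ?expR_ge0.
have ce : tends x0 (fun _ y => cexp y) (cexp x0).
  have := cexp_est1 (R := R).
  exists (cabs (cexp x0) * (2 * expR 1)); first by rewrite !mulr_ge0 ?expR_ge0 ?cabs_ge0.
  have := near2_gap x0 ltr01; apply: near2S => x y g1.
  have yg : cabs (y - x0) <= gap x0 x y by rewrite /gap lerDr cabs_ge0.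
  have -> : cexp y - cexp x0 = cexp x0 * (cexp (y - x0) - 1).
    by rewrite mulrBr -cexpD mulr1 [x0 + _]addrC subrK.
  rewrite cabsM -mulrA ler_wpM2l ?cabs_ge0 //.
  apply: le_trans (cexp_est1 (le_trans yg g1)) _.
  by rewrite ler_wpM2l // mulr_ge0 ?expR_ge0.
exists (fun x y => cexp y * q1 x y).
  by rewrite -[X in tends _ _ X]mulr1; apply: tendsM.
exists 1 => // x y _ _; rewrite -mulrA E mulrBr mulr1 -cexpD.
by rewrite [y + _]addrC subrK.
Qed.

Lemma Re_sqrtc_ge0 z : 0 <= cRe (sqrtc z).
Proof. by case: z => a b /=; rewrite sqrtr_ge0. Qed.

(** The square root is continuous at a positive real, since the root with
    nonnegative real part stays away from the opposite root. *)
Lemma sdiff_sqrtc (a : R) : 0 < a -> sdiff (@sqrtc R) a%:C (2 * sqrtc a%:C)^-1.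
Proof.
move=> a0.
have sa : sqrtc a%:C = (Num.sqrt a)%:C by rewrite sqrtc_sqrtr //= ler0c ltW.
have sp : 0 < Num.sqrt a by rewrite sqrtr_gt0.
apply: (@sdiff_right_inverse (@sqrtc R) (fun z => z * z)).
- by rewrite sa mulf_neq0 // ?pnatr_eq0 // -cabs_gt0 cabs_real normr_gt0 gt_eqF.
- by apply: sdiff_eq (sdiffM (sdiff_id _) (sdiff_id _)); ring.
- move=> s s0; exists (s * Num.sqrt a); first by rewrite mulr_gt0.
  move=> x hx; split; first by rewrite -expr2 sqr_sqrtc.
  have E : (sqrtc x - sqrtc a%:C) * (sqrtc x + sqrtc a%:C) = x - a%:C.
    by rewrite -subr_sqr !sqr_sqrtc.
  have lb : Num.sqrt a <= cabs (sqrtc x + sqrtc a%:C).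
    apply: le_trans (le_trans (ler_norm _) (Re_le_cabs _)).
    by rewrite cReD sa /= lerDr Re_sqrtc_ge0.
  move: hx; rewrite -E cabsM => hx.
  rewrite -(ler_pM2r sp); apply: le_trans hx.
  by rewrite ler_wpM2l ?cabs_ge0.
Qed.

(** The principal logarithm on the half-plane of positive real part, where the
    argument is the arctangent of the slope. *)
Definition clog z : C := ln (cabs z) +i* atan (cIm z / cRe z).

Lemma clogK z : 0 < cRe z -> cexp (clog z) = z.
Proof.
case: z => a b /= a0; set w := a +i* b.
have w0 : 0 < cabs w by apply: lt_le_trans a0 (le_trans (ler_norm _) (Re_le_cabs w)).
have ct : cos (atan (b / a)) = a / cabs w.
  rewrite cos_atan; apply: (canLR (@invrK _)); rewrite invf_div.
  rewrite cabsE /= (_ : 1 + (b / a) ^+ 2 = (a ^+ 2 + b ^+ 2) / a ^+ 2); last by field; rewrite gt_eqF.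
  by rewrite sqrtrM ?addr_ge0 ?sqr_ge0 // sqrtrV ?sqr_ge0 // sqrtr_sqr ger0_norm // ltW.
have st : sin (atan (b / a)) = b / cabs w.
  have := atanK (b / a); rewrite /tan ct => /(canRL (divfK _)) ->.
    by field; rewrite !gt_eqF.
  by rewrite mulf_neq0 ?invr_eq0 ?gt_eqF.
rewrite /clog /cexp /= ct st lnK ?posrE //; apply: complexP => /=; field; by rewrite gt_eqF.
Qed.

Lemma clog1 : clog 1 = 0.
Proof. by rewrite /clog cabs1 ln1 /= mul0r atan0. Qed.

Lemma sdiff_clog : sdiff clog 1 1.
Proof.
rewrite -[X in sdiff _ _ X]invr1; apply: (@sdiff_right_inverse clog (@cexp R)).
- exact: oner_neq0.
- by rewrite clog1 -[X in sdiff _ _ X]cexp0; exact: sdiff_cexp.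
- move=> s s0; suff [r r0 Hr] : exists2 r : R, 0 < r &
      forall x, cabs (x - 1) <= r -> 0 < cRe x /\ cabs (clog x) <= s.
    by exists r => // x /Hr[Rp Hc]; rewrite clog1 subr0 clogK.
  have s2 : 0 < s / 2 by lra.
  have [d1 /= d10 H1] := (proj1 (cvgrPdist_le _ _) (@continuous_ln R 1 ltr01)) _ s2.
  have [d2 /= d20 H2] := (proj1 (cvgrPdist_le _ _) (@continuous_atan R 0)) _ s2.
  exists (Num.min (1 / 2) (Num.min (d1 / 2) (d2 / 4))).
    by rewrite !lt_min !divr_gt0.
  move=> x; rewrite !le_min => /andP[x1 /andP[x2 x3]].
  have Rx := le_trans (Re_le_cabs _) x1; have Ix := le_trans (Im_le_cabs _) x3.
  move: Rx Ix; rewrite !raddfB /= subr0 ler_norml => /andP[R1 R2] Ix.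
  have Rp : 0 < cRe x by lra.
  split => //; apply: (@le_trans _ _ (`|ln (cabs x)| + `|atan (cIm x / cRe x)|)); first exact: (cabs_le (clog x)).
  have L1 : `|ln (cabs x)| <= s / 2.
    have := H1 (cabs x); rewrite ln1 sub0r normrN; apply.
    have := cabs_triangle x 1 0; have := cabs_triangle 1 x 0.
    rewrite !subr0 cabs1 [cabs (1 - x)]cabs_distC => ? ?.
    by rewrite /= ltr_norml; apply/andP; split; lra.
  have L2 : `|atan (cIm x / cRe x)| <= s / 2.
    have := H2 (cIm x / cRe x); rewrite atan0 sub0r normrN; apply.
    rewrite /= sub0r normrN normrM normfV [`|cRe x|]gtr0_norm // ltr_pdivrMr //.
    nra.
  lra.
Qed.
End StrictDiff.

(** * Explicit and approximate solutions of the first order system *)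

Section Hyperbolic.
Variable R : realType.
Notation cabs := (@cabs R).
Notation C := R[i].
Implicit Types z w a : C.

Definition csh z : C := (cexp z - cexp (- z)) / 2.
Definition cch z : C := (cexp z + cexp (- z)) / 2.

Lemma csh0 : csh 0 = 0.
Proof. by rewrite /csh oppr0 subrr mul0r. Qed.

Lemma cch0 : cch 0 = 1.
Proof. by rewrite /cch oppr0 cexp0; field. Qed.

Lemma cshD z w : csh (z + w) = csh z * cch w + cch z * csh w.
Proof. by rewrite /csh /cch opprD !cexpD; field. Qed.

Lemma cchD z w : cch (z + w) = cch z * cch w + csh z * csh w.
Proof. by rewrite /csh /cch opprD !cexpD; field. Qed.

Lemma cshN z : csh (- z) = - csh z.
Proof. by rewrite /csh opprK; field. Qed.

Lemma cchN z : cch (- z) = cch z.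
Proof. by rewrite /cch opprK addrC. Qed.

Lemma cchsh z : cch z ^+ 2 - csh z ^+ 2 = 1.
Proof.
have := cexpNK z; rewrite /cch /csh => E.
by rewrite -[RHS]E; field.
Qed.

Lemma cexp_half_bound z : cabs ((cexp z - cexp (- z)) / 2) <= expR (cabs z) /\
  cabs ((cexp z + cexp (- z)) / 2) <= expR (cabs z).
Proof.
have h1 := cabs_cexp_le z; have := cabs_cexp_le (- z); rewrite cabsN => h2.
have c2 : cabs (2 : C) = 2.
  by rewrite (_ : 2 = (2 : R)%:C) ?cabs_real ?ger0_norm // rmorphD.
split; rewrite cabsM cabsV c2 ler_pdivrMr //.
- by apply: le_trans (cabsB _ _) _; lra.
- by apply: le_trans (cabsD _ _) _; lra.
Qed.

Lemma csh_bound z : cabs (csh z) <= expR (cabs z).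
Proof. by have [] := cexp_half_bound z. Qed.

Lemma cch_bound z : cabs (cch z) <= expR (cabs z).
Proof. by have [] := cexp_half_bound z. Qed.

Lemma cder_csh a (x : R) : cder (fun t => csh (a * t%:C)) x (a * cch (a * x%:C)).
Proof.
have := cderZ 2^-1 (cderB (cder_cexp a x) (cder_cexp (- a) x)).
rewrite (_ : (fun t => _) = (fun t : R => csh (a * t%:C))); last first.
  by apply/funext => t; rewrite /csh !mulNr; field.
by move=> /cder_eq; apply; rewrite /cch !mulNr; field.
Qed.

Lemma cder_cch a (x : R) : cder (fun t => cch (a * t%:C)) x (a * csh (a * x%:C)).
Proof.
have := cderZ 2^-1 (cderD (cder_cexp a x) (cder_cexp (- a) x)).
rewrite (_ : (fun t => _) = (fun t : R => cch (a * t%:C))); last first.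
  by apply/funext => t; rewrite /cch !mulNr; field.
by move=> /cder_eq; apply; rewrite /csh !mulNr; field.
Qed.
End Hyperbolic.

Section Solutions.
Variable R : realType.
Notation cabs := (@cabs R).
Notation C := R[i].
Variables (b kap l r1 r2 : C).
Hypothesis (hk : kap ^+ 2 = - b) (l0 : l != 0) (k0 : kap != 0)
  (r10 : r1 != 0) (r20 : r2 != 0)
  (e1 : r1 ^+ 2 = l ^+ 2 + kap * l) (e2 : r2 ^+ 2 = l ^+ 2 - kap * l).
Variables c1 c2 : C.


(** The solution of the first order system with u(0) = y(0) = 0, w(0) = l c1 and
    p(0) = - kap c2, where kap^2 = - b. It comes from diagonalizing the system:
    its exponents are r1, - r1, r2 and - r2. *)
Definition sol_u (x : R) : C :=
  (2 * l)^-1 * (c1 * (r1 * csh (r1 * x%:C) + r2 * csh (r2 * x%:C))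
   + c2 * (cch (r1 * x%:C) - cch (r2 * x%:C))).
Definition sol_w (x : R) : C :=
  l / 2 * (c1 * (cch (r1 * x%:C) + cch (r2 * x%:C))
   + c2 * (r1^-1 * csh (r1 * x%:C) - r2^-1 * csh (r2 * x%:C))).
Definition sol_y (x : R) : C :=
  - kap / 2 * (c1 * (cch (r1 * x%:C) - cch (r2 * x%:C))
   + c2 * (r1^-1 * csh (r1 * x%:C) + r2^-1 * csh (r2 * x%:C))).
Definition sol_p (x : R) : C :=
  - kap / 2 * (c1 * (r1 * csh (r1 * x%:C) - r2 * csh (r2 * x%:C))
   + c2 * (cch (r1 * x%:C) + cch (r2 * x%:C))).

Lemma sol_init : [/\ sol_u 0 = 0, sol_w 0 = l * c1, sol_y 0 = 0 & sol_p 0 = - kap * c2].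
Proof.
rewrite /sol_u /sol_w /sol_y /sol_p !mulr0 csh0 cch0.
split; field; by rewrite ?l0 ?r10 ?r20.
Qed.

Lemma sol_u_der (x : R) : cder sol_u x (sol_w x - sol_y x).
Proof.
have := cderZ (2 * l)^-1 (cderD (cderZ c1 (cderD (cderZ r1 (cder_csh r1 x)) (cderZ r2 (cder_csh r2 x))))
  (cderZ c2 (cderB (cder_cch r1 x) (cder_cch r2 x)))).
move=> /cder_eq; apply; rewrite /sol_w /sol_y.
move: (csh (r1 * _)) (csh (r2 * _)) (cch (r1 * _)) (cch (r2 * _)) => s1 s2 a1 a2.
apply/eqP; rewrite -subr_eq0; apply/eqP.
transitivity (c1 * a1 / (2 * l) * (r1 ^+ 2 - (l ^+ 2 + kap * l))
  + c1 * a2 / (2 * l) * (r2 ^+ 2 - (l ^+ 2 - kap * l))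
  + c2 * s1 / (2 * l * r1) * (r1 ^+ 2 - (l ^+ 2 + kap * l))
  - c2 * s2 / (2 * l * r2) * (r2 ^+ 2 - (l ^+ 2 - kap * l))).
  by field; rewrite ?l0 ?r10 ?r20.
by rewrite e1 e2 !subrr !mulr0 !addr0 subrr.
Qed.

Lemma sol_w_der (x : R) : cder sol_w x (l ^+ 2 * sol_u x).
Proof.
have := cderZ (l / 2) (cderD (cderZ c1 (cderD (cder_cch r1 x) (cder_cch r2 x)))
  (cderZ c2 (cderB (cderZ r1^-1 (cder_csh r1 x)) (cderZ r2^-1 (cder_csh r2 x))))).
move=> /cder_eq; apply; rewrite /sol_u.
move: (csh (r1 * _)) (csh (r2 * _)) (cch (r1 * _)) (cch (r2 * _)) => s1 s2 a1 a2.
by field; rewrite ?l0 ?r10 ?r20.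
Qed.

Lemma sol_y_der (x : R) : cder sol_y x (sol_p x).
Proof.
have := cderZ (- kap / 2) (cderD (cderZ c1 (cderB (cder_cch r1 x) (cder_cch r2 x)))
  (cderZ c2 (cderD (cderZ r1^-1 (cder_csh r1 x)) (cderZ r2^-1 (cder_csh r2 x))))).
move=> /cder_eq; apply; rewrite /sol_p.
move: (csh (r1 * _)) (csh (r2 * _)) (cch (r1 * _)) (cch (r2 * _)) => s1 s2 a1 a2.
by field; rewrite ?l0 ?r10 ?r20.
Qed.

Lemma sol_p_der (x : R) : cder sol_p x (l ^+ 2 * sol_y x + b * sol_w x).
Proof.
have := cderZ (- kap / 2) (cderD (cderZ c1 (cderB (cderZ r1 (cder_csh r1 x)) (cderZ r2 (cder_csh r2 x))))
  (cderZ c2 (cderD (cder_cch r1 x) (cder_cch r2 x)))).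
move=> /cder_eq; apply; rewrite /sol_w /sol_y (_ : b = - kap ^+ 2); last by rewrite hk opprK.
move: (csh (r1 * _)) (csh (r2 * _)) (cch (r1 * _)) (cch (r2 * _)) => s1 s2 a1 a2.
apply/eqP; rewrite -subr_eq0; apply/eqP.
transitivity (- kap / 2 * (c1 * a1 * (r1 ^+ 2 - (l ^+ 2 + kap * l))
  - c1 * a2 * (r2 ^+ 2 - (l ^+ 2 - kap * l))
  + c2 * s1 / r1 * (r1 ^+ 2 - (l ^+ 2 + kap * l))
  + c2 * s2 / r2 * (r2 ^+ 2 - (l ^+ 2 - kap * l)))).
  by field; rewrite ?l0 ?r10 ?r20.
by rewrite e1 e2 !subrr !mulr0 !addr0 subrr mulr0.
Qed.
End Solutions.

Section Characteristic.
Variable R : realType.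
Notation C := R[i].
Variables (k1 k2 k3 k4 l r1 r2 : C).

(** The matrix of the two conditions at 1, applied to the data (c1, c2) of an
    explicit solution; the second row is divided by - kap. *)
Definition m11 : C := (l + k2) * (r1 * csh r1 + r2 * csh r2) / 2 + k1 * l * (cch r1 + cch r2) / 2.
Definition m12 : C := (l + k2) * (cch r1 - cch r2) / 2 + k1 * l * (r1^-1 * csh r1 - r2^-1 * csh r2) / 2.
Definition m21 : C := l * (l + k4) * (cch r1 - cch r2) / 2 + k3 * (r1 * csh r1 - r2 * csh r2) / 2.
Definition m22 : C := l * (l + k4) * (r1^-1 * csh r1 + r2^-1 * csh r2) / 2 + k3 * (cch r1 + cch r2) / 2.
Definition chardet : C := m11 * m22 - m12 * m21.

Lemma sol_bc1 (c1 c2 : C) : l != 0 ->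
  l * (l + k2) * sol_u l r1 r2 c1 c2 1 + k1 * sol_w l r1 r2 c1 c2 1 = m11 * c1 + m12 * c2.
Proof.
move=> l0; rewrite /sol_u /sol_w /m11 /m12 !mulr1.
move: (csh r1) (csh r2) (cch r1) (cch r2) r1^-1 r2^-1 => s1 s2 a1 a2 q1 q2.
by field.
Qed.

Lemma sol_bc2 (kap c1 c2 : C) :
  l * (l + k4) * sol_y kap r1 r2 c1 c2 1 + k3 * sol_p kap r1 r2 c1 c2 1 =
    - kap * (m21 * c1 + m22 * c2).
Proof.
rewrite /sol_y /sol_p /m21 /m22 !mulr1.
move: (csh r1) (csh r2) (cch r1) (cch r2) r1^-1 r2^-1 => s1 s2 a1 a2 q1 q2.
by field.
Qed.
End Characteristic.

Section Approximate.
Variable R : realType.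
Notation cabs := (@cabs R).
Notation C := R[i].
Variables (b kap l r1 r2 : C).
Hypothesis (hk : kap ^+ 2 = - b) (l0 : l != 0) (k0 : kap != 0)
  (r10 : r1 != 0) (r20 : r2 != 0)
  (e1 : r1 ^+ 2 = l ^+ 2 + kap * l) (e2 : r2 ^+ 2 = l ^+ 2 - kap * l).

(** The first two equations of the system hold exactly, since they define w and p
    from u and y; only the other two have residuals, at most eps. *)
Definition approx_sol (eps : R) (u w y p : R -> C^o) :=
  [/\ continuous01 u /\ continuous01 w, continuous01 y /\ continuous01 p,
     forall x : R, 0 < x < 1 -> cder u x (w x - y x) /\ cder y x (p x) &
     exists f g : R -> C, forall x : R, 0 < x < 1 ->
       [/\ cder w x (l ^+ 2 * u x + f x), cder p x (l ^+ 2 * y x + b * w x + g x),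
           cabs (f x) <= eps & cabs (g x) <= eps]].

Lemma continuous01D (F G : R -> C^o) : continuous01 F -> continuous01 G ->
  continuous01 (fun x => F x + G x).
Proof.
move=> [Fr Fi] [Gr Gi]; split.
- rewrite (_ : (fun x => _) = (fun x => complex.Re (F x) + complex.Re (G x))).
    by move=> t; apply: cvgD; [exact: Fr|exact: Gr].
  by apply/funext => x; rewrite cReD.
- rewrite (_ : (fun x => _) = (fun x => complex.Im (F x) + complex.Im (G x))).
    by move=> t; apply: cvgD; [exact: Fi|exact: Gi].
  by apply/funext => x; rewrite cImD.
Qed.

Lemma continuous01M (F G : R -> C^o) : continuous01 F -> continuous01 G ->
  continuous01 (fun x => F x * G x).
Proof.
move=> [Fr Fi] [Gr Gi]; split.
- rewrite (_ : (fun x => _) = (fun x => complex.Re (F x) * complex.Re (G x) - complex.Im (F x) * complex.Im (G x))).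
    move=> t; apply: cvgB; apply: cvgM; [exact: Fr|exact: Gr|exact: Fi|exact: Gi].
  by apply/funext => x; rewrite cReM.
- rewrite (_ : (fun x => _) = (fun x => complex.Re (F x) * complex.Im (G x) + complex.Im (F x) * complex.Re (G x))).
    move=> t; apply: cvgD; apply: cvgM; [exact: Fr|exact: Gi|exact: Fi|exact: Gr].
  by apply/funext => x; rewrite cImM.
Qed.

Lemma continuous01Z (a : C) (F : R -> C^o) : continuous01 F ->
  continuous01 (fun x => a * F x).
Proof.
move=> cF; apply: (@continuous01M (fun=> a)) => //.
by split=> t; exact: cvg_cst.
Qed.

(** For r^2 = l^2 + mu and mu^2 = - b l^2, the combination
    W = - mu u - (r mu / l^2) w + r y + p satisfies W' = r W up to the residuals:
    it is a left eigenvector of the system. Integrating exp(- r x) W bounds W. *)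
Lemma diagonal_bound eps u w y p r mu (B : R) : approx_sol eps u w y p ->
  [/\ u 0 = 0, w 0 = 0, y 0 = 0 & p 0 = 0] ->
  r ^+ 2 = l ^+ 2 + mu -> mu ^+ 2 = - b * l ^+ 2 -> 0 <= eps ->
  cabs r <= B -> cabs (r * mu / l ^+ 2) <= B ->
  forall x : R, 0 <= x <= 1 ->
  cabs (- mu * u x - r * mu / l ^+ 2 * w x + r * y x + p x) <= 2 * expR B ^+ 2 * (1 + B) * eps.
Proof.
move=> [[cu cw] [cy cp] duy [f [g dwp]]] [u0 w0 y0 p0] er em eps0 rB sB x x01.
set s := r * mu / l ^+ 2 in sB *.
pose W t := - mu * u t + (- s * w t + (r * y t + p t)).
pose V t := cexp (- r * t%:C) * W t.
have cV : continuous01 V.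
  apply: (@continuous01M (fun t => cexp (- r * t%:C)) W).
    apply: ccont01; apply: (@cder_ccont _ _ (fun t => - r * cexp (- r * t%:C))) => t; exact: cder_cexp.
  do 3 (apply: continuous01D; first exact: continuous01Z); exact: cp.
have dV t : 0 < t < 1 -> cder V t (cexp (- r * t%:C) * (g t - s * f t)).
  move=> t01; have [du dy] := duy t t01; have [dw dp _ _] := dwp t t01.
  have := cderM (cder_cexp (- r) t) (cderD (cderZ (- mu) du) (cderD (cderZ (- s) dw) (cderD (cderZ r dy) dp))).
  move=> /cder_eq; apply.
  set E := cexp _; rewrite -/(W t) /W.
  apply/eqP; rewrite -subr_eq0; apply/eqP.
  transitivity (E * (mu * y t * (1 - 1) - w t * (mu + s * - r - b)
     - u t * (s * l ^+ 2 - r * mu) - y t * (r ^+ 2 - (l ^+ 2 + mu)))).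
    ring.
  rewrite er (_ : s * l ^+ 2 = r * mu); last by rewrite /s divfK // expf_neq0.
  rewrite (_ : mu + s * - r - b = 0); last first.
    have -> : s * - r = - (r ^+ 2 * mu) / l ^+ 2 by rewrite /s; field.
    rewrite er; apply: (mulIf (expf_neq0 2 l0)); rewrite mul0r.
    transitivity (- (mu ^+ 2) - b * l ^+ 2); first by field.
    by rewrite em; ring.
  by rewrite !subrr; ring.
have eB : forall t : R, 0 <= t <= 1 -> forall q : C, cabs q <= B -> cabs (cexp (q * t%:C)) <= expR B.
  move=> t /andP[t0 t1] q qB; apply: le_trans (cabs_cexp_le _) _; rewrite ler_expR.
  rewrite cabsM cabs_real ger0_norm // (le_trans _ qB) // ler_piMr ?cabs_ge0 //.
have B0 : 0 <= B by apply: le_trans (cabs_ge0 _) rB.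
have bV t : 0 < t < 1 -> cabs (cexp (- r * t%:C) * (g t - s * f t)) <= expR B * ((1 + B) * eps).
  move=> t01; have [_ _ bf bg] := dwp t t01; rewrite cabsM.
  apply: ler_pM; rewrite ?cabs_ge0 //.
    by apply: eB; rewrite ?cabsN //; case/andP: t01 => ? ?; rewrite !ltW.
  apply: le_trans (cabsB _ _) _; rewrite mulrDl mul1r lerD // cabsM.
  by apply: ler_pM; rewrite ?cabs_ge0.
have := cder_bound cV x01 dV bV.
have -> : V 0 = 0 by rewrite /V /W u0 w0 y0 p0; ring.
rewrite subr0 => HV.
have -> : - mu * u x - s * w x + r * y x + p x = cexp (r * x%:C) * V x.
  rewrite /V mulrA [- r * _]mulNr cexpNK mul1r /W; ring.
rewrite cabsM (_ : 2 * _ * _ * _ = expR B * (2 * (expR B * ((1 + B) * eps)))); last by ring.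
by apply: ler_pM; rewrite ?cabs_ge0 //; exact: eB.
Qed.

Variable B : R.
Hypothesis (B1 : 1 <= B) (Bl : cabs l <= B) (Bil : cabs l^-1 <= B)
  (Br1 : cabs r1 <= B) (Br2 : cabs r2 <= B) (Bir1 : cabs r1^-1 <= B)
  (Bir2 : cabs r2^-1 <= B) (Bk : cabs kap <= B) (Bik : cabs kap^-1 <= B).

Definition approx_cst : R := 2 * expR (B ^+ 3) ^+ 2 * (1 + B ^+ 3) * B ^+ 3.

(** The four combinations for r = r1, - r1, r2, - r2 determine u, w, y and p. The
    bound depends on l only through B, hence is uniform near a given l. *)
Lemma approx_zero eps u w y p : approx_sol eps u w y p ->
  [/\ u 0 = 0, w 0 = 0, y 0 = 0 & p 0 = 0] -> 0 <= eps ->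
  forall x : R, 0 <= x <= 1 ->
  [/\ cabs (u x) <= approx_cst * eps, cabs (w x) <= approx_cst * eps,
      cabs (y x) <= approx_cst * eps & cabs (p x) <= approx_cst * eps].
Proof.
move=> As ini eps0 x x01.
have B0 : 0 <= B by exact: le_trans ler01 B1.
have B3 : B <= B ^+ 3 by rewrite -[leLHS]expr1 ler_weXn2l.
have bd (r mu : C) (s : C) : s ^+ 2 = 1 -> cabs s = 1 -> mu = s * kap * l -> cabs r <= B ->
    r ^+ 2 = l ^+ 2 + mu ->
    cabs (- mu * u x - r * mu / l ^+ 2 * w x + r * y x + p x) <= 2 * expR (B ^+ 3) ^+ 2 * (1 + B ^+ 3) * eps.
  move=> s2 sn muE rB er; apply: (diagonal_bound As) => //.
  - by rewrite muE !exprMn s2 hk mul1r.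
  - exact: le_trans B3.
  - have -> : r * mu / l ^+ 2 = s * (r * (kap * l^-1)) by rewrite muE; field.
    rewrite cabsM sn mul1r !cabsM !exprS expr0 mulr1.
    by apply: ler_pM; rewrite ?mulr_ge0 ?cabs_ge0 //; apply: ler_pM; rewrite ?cabs_ge0.
set K := 2 * _ * _ * _ in bd.
have s1 : (1 : C) ^+ 2 = 1 by rewrite expr1n.
have s2 : (-1 : C) ^+ 2 = 1 by rewrite sqrrN expr1n.
have n1 := cabs1 R.
have n2 : cabs (-1) = 1 by rewrite cabsN cabs1.
have W1 := bd r1 (kap * l) 1 s1 n1 ltac:(by rewrite mul1r) Br1 e1.
have W2 := bd (- r1) (kap * l) 1 s1 n1 ltac:(by rewrite mul1r) ltac:(by rewrite cabsN) ltac:(by rewrite sqrrN).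
have W3 := bd r2 (- (kap * l)) (-1) s2 n2 ltac:(by rewrite !mulNr mul1r) Br2 e2.
have W4 := bd (- r2) (- (kap * l)) (-1) s2 n2 ltac:(by rewrite !mulNr mul1r) ltac:(by rewrite cabsN) ltac:(by rewrite sqrrN).
move: W1 W2 W3 W4; set W1 := (_ + p x); set W2 := (_ + p x); set W3 := (_ + p x); set W4 := (_ + p x).
move=> b1 b2 b3 b4.
have c2 : cabs (2 : C) = 2.
  by rewrite (_ : 2 = (2 : R)%:C) ?cabs_real ?ger0_norm // rmorphD.
have half z z' : cabs z <= K -> cabs z' <= K -> cabs ((z + z') / 2) <= K.
  move=> hz hz'; rewrite cabsM cabsV c2 ler_pdivrMr //; apply: le_trans (cabsD _ _) _; lra.
have hN z : cabs z <= K -> cabs (- z) <= K by rewrite cabsN.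
have K0 : 0 <= K by apply: le_trans b1; exact: cabs_ge0.
have A1 := half _ _ b1 b2; have A2 := half _ _ b3 b4.
have D1 := half _ _ b1 (hN _ b2); have D2 := half _ _ b3 (hN _ b4).
have KE : approx_cst * eps = K * B ^+ 3 by rewrite /approx_cst /K; ring.
have pow (z : C) n : cabs z <= K * B ^+ n -> (n <= 3)%N -> cabs z <= approx_cst * eps.
  move=> hz n3; apply: le_trans hz _; rewrite KE ler_wpM2l // ler_weXn2l //.
have h2 : (2 : C) != 0 by rewrite pnatr_eq0.
split.
- apply: (pow _ 2%N) => //.
  have -> : u x = ((W3 + W4) / 2 + - ((W1 + W2) / 2)) / 2 * (kap^-1 * l^-1).
    rewrite /W1 /W2 /W3 /W4; field; by rewrite ?k0 ?l0.
  rewrite cabsM; apply: ler_pM; rewrite ?cabs_ge0 //; first by apply: half => //; exact: hN.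
  by rewrite cabsM expr2; apply: ler_pM; rewrite ?cabs_ge0.
- apply: (pow _ 3%N) => //.
  have -> : w x = ((W3 - W4) / 2 * r2^-1 + - ((W1 - W2) / 2 * r1^-1)) / 2 * (l * kap^-1).
    rewrite /W1 /W2 /W3 /W4; field; by rewrite ?k0 ?l0 ?r10 ?r20.
  rewrite cabsM (_ : K * B ^+ 3 = (K * B) * (B * B)); last by ring.
  apply: ler_pM; rewrite ?cabs_ge0 //; last by rewrite cabsM; apply: ler_pM; rewrite ?cabs_ge0.
  rewrite cabsM cabsV c2 ler_pdivrMr //; apply: le_trans (cabsB _ _) _.
  rewrite mulr_natr mulr2n; apply: lerD; rewrite cabsM; by apply: ler_pM; rewrite ?cabs_ge0.
- apply: (pow _ 1%N) => //.
  have -> : y x = ((W3 - W4) / 2 * r2^-1 + ((W1 - W2) / 2 * r1^-1)) / 2.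
    rewrite /W1 /W2 /W3 /W4; field; by rewrite ?k0 ?l0 ?r10 ?r20.
  rewrite cabsM cabsV c2 ler_pdivrMr //; apply: le_trans (cabsD _ _) _.
  rewrite expr1 mulr_natr mulr2n; apply: lerD; rewrite cabsM; by apply: ler_pM; rewrite ?cabs_ge0.
- apply: (pow _ 0%N) => //.
  have -> : p x = ((W1 + W2) / 2 + (W3 + W4) / 2) / 2.
    rewrite /W1 /W2 /W3 /W4; field; by rewrite ?l0.
  by rewrite expr0 mulr1; exact: half.
Qed.

(** Subtract the explicit solution with the same data: the difference starts from
    zero, so it is small at 1 and the conditions at 1 are nearly those of the
    explicit solution. *)
Lemma approx_bc eps (u w y p : R -> C^o) (k1 k2 k3 k4 : C) (c1 := w 0 / l) (c2 := - p 0 / kap) :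
  approx_sol eps u w y p -> u 0 = 0 -> y 0 = 0 -> 0 <= eps ->
  cabs (l * (l + k2) * u 1 + k1 * w 1) <= eps ->
  cabs (l * (l + k4) * y 1 + k3 * p 1) <= eps ->
  cabs k1 <= B -> cabs k2 <= B -> cabs k3 <= B -> cabs k4 <= B ->
  let K := B * (1 + 3 * B ^+ 2 * approx_cst) in
  cabs (m11 k1 k2 l r1 r2 * c1 + m12 k1 k2 l r1 r2 * c2) <= K * eps /\
  cabs (m21 k3 k4 l r1 r2 * c1 + m22 k3 k4 l r1 r2 * c2) <= K * eps.
Proof.
move=> As u0 y0 eps0 bc1 bc2 Bk1 Bk2 Bk3 Bk4 K.
have B0 : 0 <= B by exact: le_trans ler01 B1.
have [cu cw] := let: And4 a _ _ _ := As in a.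
pose su := sol_u l r1 r2 c1 c2; pose sw := sol_w l r1 r2 c1 c2.
pose sy := sol_y kap r1 r2 c1 c2; pose sp := sol_p kap r1 r2 c1 c2.
have [su0 sw0 sy0 sp0] := sol_init kap l0 r10 r20 c1 c2.
have dsu := sol_u_der l0 r10 r20 e1 e2 c1 c2.
have dsw := sol_w_der l0 r10 r20 c1 c2.
have dsy := sol_y_der kap r10 r20 c1 c2.
have dsp := sol_p_der hk r10 r20 e1 e2 c1 c2.
have cN (F G : R -> C^o) : continuous01 F -> (exists H : R -> C, forall x : R, cder G x (H x)) -> continuous01 (fun x => F x - G x).
  move=> cF [H dG].
  rewrite (_ : (fun x => F x - G x) = (fun x => F x + -1 * G x)); last first.
    by apply/funext => x; rewrite mulN1r.
  by apply: continuous01D => //; apply: continuous01Z; exact: ccont01 (cder_ccont dG).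
have Az : approx_sol eps (fun x => u x - su x) (fun x => w x - sw x)
    (fun x => y x - sy x) (fun x => p x - sp x).
  move: As => [_ [cy cp] duy [f [g dwp]]]; split.
  - by split; apply: cN => //; eexists; [exact: dsu|exact: dsw].
  - by split; apply: cN => //; eexists; [exact: dsy|exact: dsp].
  - move=> x x01; have [du dy] := duy x x01; split.
      by apply: cder_eq (cderB du (dsu x)) _; rewrite /sw /sy; ring.
    exact: cderB dy (dsy x).
  - exists f, g => x x01; have [dw dp bf bg] := dwp x x01; split => //.
      by apply: cder_eq (cderB dw (dsw x)) _; rewrite /su; ring.
    by apply: cder_eq (cderB dp (dsp x)) _; rewrite /sw /sy; ring.
have iz : [/\ u 0 - su 0 = 0, w 0 - sw 0 = 0, y 0 - sy 0 = 0 & p 0 - sp 0 = 0].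
  rewrite u0 y0 /su /sw /sy /sp su0 sw0 sy0 sp0 /c1 /c2; split; rewrite ?subr0 //.
  - by field.
  - by field.
have one : (0 : R) <= (1 : R) <= (1 : R) by rewrite ler01 /=.
have [d1 d2 d3 d4] := approx_zero Az iz eps0 one.
have A0 : 0 <= approx_cst.
  rewrite /approx_cst; have B3 : 0 <= B ^+ 3 by rewrite exprn_ge0.
  by rewrite !mulr_ge0 ?exprn_ge0 ?expR_ge0 // addr_ge0.
have comb (k k' a a' s s' : C) : cabs k <= B -> cabs k' <= B ->
    cabs (a - s) <= approx_cst * eps -> cabs (a' - s') <= approx_cst * eps ->
    cabs (l * (l + k') * a + k * a') <= eps ->
    cabs (l * (l + k') * s + k * s') <= (1 + 3 * B ^+ 2 * approx_cst) * eps.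
  move=> hk1 hk2 ha ha' h.
  have -> : l * (l + k') * s + k * s' = (l * (l + k') * a + k * a')
     - (l * (l + k') * (a - s) + k * (a' - s')) by ring.
  apply: le_trans (cabsB _ _) _; rewrite mulrDl mul1r; apply: lerD => //.
  apply: le_trans (cabsD _ _) _; rewrite !cabsM.
  rewrite (_ : 3 * _ * _ * _ = B * (B + B) * (approx_cst * eps) + B * B * (approx_cst * eps)); last by ring.
  have X0 : 0 <= approx_cst * eps by rewrite mulr_ge0.
  apply: lerD; apply: ler_pM; rewrite ?mulr_ge0 ?cabs_ge0 //.
  - apply: ler_pM; rewrite ?cabs_ge0 //.
    by apply: le_trans (cabsD _ _) _; apply: lerD.
  - by apply: le_trans hk1 _; rewrite ler_peMl.
have H1 := comb k1 k2 _ _ _ _ Bk1 Bk2 d1 d2 bc1.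
have H2 := comb k3 k4 _ _ _ _ Bk3 Bk4 d3 d4 bc2.
move: H1 H2; rewrite sol_bc1 // sol_bc2 => H1 H2.
have KE : 0 <= (1 + 3 * B ^+ 2 * approx_cst) * eps.
  by apply: le_trans H1; exact: cabs_ge0.
split.
- apply: le_trans H1 _; rewrite /K -[leRHS]mulrA ler_peMl //.
- rewrite (_ : _ + _ = - (kap^-1 * (- kap * (m21 k3 k4 l r1 r2 * c1 + m22 k3 k4 l r1 r2 * c2)))).
    by rewrite cabsN cabsM /K -[leRHS]mulrA; apply: ler_pM; rewrite ?cabs_ge0.
  by field.
Qed.
End Approximate.

(** * The characteristic exponents *)

Section Roots.
Variable R : realType.
Notation cabs := (@cabs R).
Notation C := R[i].
Variable b : R.
Hypothesis hb : 0 < b.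
Implicit Types (X l : C).

Definition sqrtb : R := Num.sqrt b.
Definition kap : C := 0 +i* sqrtb.
(** In terms of X = 1/l: r1 r2 = l^2 Pi, and rho = (r1 + r2) / 2 = l th,
    de = (r1 - r2) / 2. All three functions are regular at X = 0, where they take
    the values 1, 1 and kap / 2. *)
Definition Pi X : C := sqrtc (1 + b%:C * X ^+ 2).
Definition th X : C := sqrtc ((1 + Pi X) / 2).
Definition de X : C := kap / (2 * th X).
Definition rho l : C := l * th l^-1.
Definition rootp l : C := rho l + de l^-1.
Definition rootm l : C := rho l - de l^-1.

Lemma sqrtb_gt0 : 0 < sqrtb. Proof. by rewrite sqrtr_gt0. Qed.

Lemma kap_sq : kap ^+ 2 = - b%:C.
Proof.
rewrite expr2 /kap; apply: complexP => /=; rewrite ?mul0r ?mulr0 ?addr0 ?oppr0 //.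
by rewrite sub0r -expr2 sqr_sqrtr ?(ltW hb).
Qed.

Lemma kap_neq0 : kap != 0.
Proof. by rewrite -cabs_gt0 /cabs /= expr0n /= add0r sqrtr_sqr normr_gt0 gt_eqF // sqrtb_gt0. Qed.

Lemma cabs_kap : cabs kap = sqrtb.
Proof. by rewrite /cabs /= expr0n /= add0r sqrtr_sqr ger0_norm // ltW // sqrtb_gt0. Qed.

Lemma Pi_sq X : Pi X ^+ 2 = 1 + b%:C * X ^+ 2.
Proof. exact: sqr_sqrtc. Qed.

Lemma th_sq X : th X ^+ 2 = (1 + Pi X) / 2.
Proof. exact: sqr_sqrtc. Qed.

Lemma cabs2 : cabs (2 : C) = 2.
Proof. by rewrite (_ : 2 = (2 : R)%:C) ?cabs_real ?ger0_norm // rmorphD. Qed.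

(** The square root has nonnegative real part, which keeps 1 + Pi away from 0
    whatever X; the same holds for 1 + th. *)
Lemma Pi1_ge1 X : 1 <= cabs (1 + Pi X).
Proof.
apply: le_trans (le_trans (ler_norm _) (Re_le_cabs _)).
by rewrite cReD /= lerDl Re_sqrtc_ge0.
Qed.

Lemma Pi1_neq0 X : 1 + Pi X != 0.
Proof. by rewrite -cabs_gt0 (lt_le_trans ltr01) // Pi1_ge1. Qed.

Lemma th_neq0 X : th X != 0.
Proof.
apply/eqP => t0; have := th_sq X; rewrite t0 expr2 mulr0 => /esym/eqP.
by rewrite mulf_eq0 (negPf (Pi1_neq0 X)) invr_eq0 pnatr_eq0.
Qed.

Lemma th1_neq0 X : th X + 1 != 0.
Proof.
rewrite -cabs_gt0 addrC; apply: lt_le_trans ltr01 _.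
apply: le_trans (le_trans (ler_norm _) (Re_le_cabs _)).
by rewrite cReD /= lerDl Re_sqrtc_ge0.
Qed.

Lemma de_sq X : de X ^+ 2 * X ^+ 2 = (1 - Pi X) / 2.
Proof.
rewrite /de expr_div_n exprMn th_sq kap_sq.
have -> : (1 - Pi X) / 2 = (1 - Pi X ^+ 2) / (2 * (1 + Pi X)).
  by field; rewrite Pi1_neq0.
by rewrite Pi_sq; field; rewrite Pi1_neq0.
Qed.

Lemma rho_de l : l != 0 -> 2 * rho l * de l^-1 = kap * l.
Proof. by move=> l0; rewrite /rho /de; field; rewrite th_neq0. Qed.

Lemma rho_sq l : rho l ^+ 2 = l ^+ 2 * ((1 + Pi l^-1) / 2).
Proof. by rewrite /rho exprMn th_sq. Qed.

Lemma de_sq' l : l != 0 -> de l^-1 ^+ 2 = l ^+ 2 * ((1 - Pi l^-1) / 2).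
Proof. by move=> l0; rewrite -de_sq; field. Qed.

Lemma rootp_sq l : l != 0 -> rootp l ^+ 2 = l ^+ 2 + kap * l.
Proof.
move=> l0; rewrite -rho_de // /rootp.
rewrite (_ : l ^+ 2 = rho l ^+ 2 + de l^-1 ^+ 2); first by ring.
by rewrite rho_sq de_sq' //; field.
Qed.

Lemma rootm_sq l : l != 0 -> rootm l ^+ 2 = l ^+ 2 - kap * l.
Proof.
move=> l0; rewrite -rho_de // /rootm.
rewrite (_ : l ^+ 2 = rho l ^+ 2 + de l^-1 ^+ 2); first by ring.
by rewrite rho_sq de_sq' //; field.
Qed.

Lemma rootpm l : l != 0 -> rootp l * rootm l = l ^+ 2 * Pi l^-1.
Proof.
move=> l0; rewrite /rootp /rootm.
rewrite (_ : _ * _ = rho l ^+ 2 - de l^-1 ^+ 2); last by ring.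
by rewrite rho_sq de_sq' //; field.
Qed.

Lemma Pi0 : Pi 0 = 1.
Proof. by rewrite /Pi expr2 !mulr0 addr0 sqrtc1. Qed.

Lemma th0 : th 0 = 1.
Proof. by rewrite /th Pi0 (_ : (1 + 1) / 2 = 1 :> C) ?sqrtc1 //; field. Qed.

Lemma de0 : de 0 = kap / 2.
Proof. by rewrite /de th0 mulr1. Qed.

Lemma sdiff_sqrtc1 (f : C -> C) (x0 d : C) : f x0 = 1 -> sdiff f x0 d ->
  sdiff (fun x => sqrtc (f x)) x0 (2^-1 * d).
Proof.
move=> f1 sf; apply: sdiff_eq (sdiff_comp sf (_ : sdiff (@sqrtc R) (f x0) _)); last first.
  rewrite f1 (_ : 1 = (1 : R)%:C) //; exact: sdiff_sqrtc.
by rewrite sqrtc1 mulr1.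
Qed.

(** Pi depends on X^2 only, hence so do th and de: their derivatives at 0 vanish. *)
Lemma sdiff_Pi : sdiff Pi 0 0.
Proof.
apply: sdiff_eq (sdiff_sqrtc1 (f := fun X => 1 + b%:C * (X * X)) _
  (sdiffD (sdiff_cst 0 1) (sdiffM (sdiff_cst 0 b%:C) (sdiffM (sdiff_id 0) (sdiff_id 0))))).
- by rewrite !(mulr0, mul0r, addr0).
- by rewrite !(mulr0, addr0).
Qed.

Lemma sdiff_th : sdiff th 0 0.
Proof.
apply: sdiff_eq (sdiff_sqrtc1 (f := fun X => (1 + Pi X) / 2) _
  (sdiffM (sdiffD (sdiff_cst 0 1) sdiff_Pi) (sdiff_cst 0 2^-1))).
- by rewrite !(mulr0, mul0r, addr0).
- by rewrite Pi0; field.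
Qed.

Lemma sdiff_de : sdiff de 0 0.
Proof.
have n0 : 2 * th 0 != 0 by rewrite mulf_neq0 ?th_neq0 // pnatr_eq0.
have H1 := sdiffV (f := fun X => 2 * th X) n0 (sdiffM (sdiff_cst 0 2) sdiff_th).
have H := sdiffM (sdiff_cst 0 kap) H1.
apply: sdiff_eq H.
by rewrite !(mulr0, mul0r, addr0, oppr0).
Qed.

Lemma sdiff_csh x0 : sdiff (@csh R) x0 (cch x0).
Proof.
apply: sdiff_eq (sdiffM (sdiffB (sdiff_cexp x0)
  (sdiff_comp (sdiffN (sdiff_id x0)) (sdiff_cexp (- x0)))) (sdiff_cst x0 2^-1)).
by rewrite /cch mulrN1 opprK mulr0 addr0.
Qed.

Lemma sdiff_cch x0 : sdiff (@cch R) x0 (csh x0).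
Proof.
apply: sdiff_eq (sdiffM (sdiffD (sdiff_cexp x0)
  (sdiff_comp (sdiffN (sdiff_id x0)) (sdiff_cexp (- x0)))) (sdiff_cst x0 2^-1)).
by rewrite /csh mulrN1 mulr0 addr0.
Qed.

Definition cd X := cch (de X).
Definition sd X := csh (de X).

Lemma sdiff_cd : sdiff cd 0 0.
Proof. by apply: sdiff_eq (sdiff_comp sdiff_de (sdiff_cch _)); rewrite mulr0. Qed.

Lemma sdiff_sd : sdiff sd 0 0.
Proof. by apply: sdiff_eq (sdiff_comp sdiff_de (sdiff_csh _)); rewrite mulr0. Qed.

Lemma cexp_im (x : R) : cexp (0 +i* x) = cos x +i* sin x.
Proof. by rewrite /cexp /= expR0 (_ : 1%:C = 1) // mul1r. Qed.

Lemma kap_half : kap / 2 = 0 +i* (sqrtb / 2).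
Proof.
have h : (2 : C)^-1 = (2^-1 : R)%:C by rewrite fmorphV rmorphD.
by rewrite h /kap; apply: complexP => /=; ring.
Qed.

Lemma opp_im (x : R) : - (0 +i* x) = 0 +i* (- x) :> C.
Proof. by apply: complexP => /=; rewrite ?oppr0. Qed.

Lemma cd0 : cd 0 = (cos (sqrtb / 2))%:C.
Proof.
rewrite /cd de0 kap_half /cch opp_im !cexp_im cosN sinN.
have -> : (cos (sqrtb / 2))%:C = (cos (sqrtb / 2))%:C * 2 / 2 :> C by field.
by congr (_ / 2); apply: complexP => /=; ring.
Qed.

Lemma sd0 : sd 0 = 0 +i* sin (sqrtb / 2).
Proof.
rewrite /sd de0 kap_half /csh opp_im !cexp_im cosN sinN.
have -> : 0 +i* sin (sqrtb / 2) = (0 +i* sin (sqrtb / 2)) * 2 / 2 :> C by field.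
by congr (_ / 2); apply: complexP => /=; ring.
Qed.

(** For |X| at most this radius, |b X^2| <= 1/2, so that Pi does not vanish and the
    exponents are nonzero. *)
Definition inv_radius : R := (2 * (b + 1))^-1.

Lemma Pi_bounds X : cabs X <= inv_radius -> 1 / 2 <= cabs (Pi X) ^+ 2 <= 3 / 2.
Proof.
move=> hX; rewrite -cabsX Pi_sq; have b0 := hb.
have X1 : cabs X <= 1 by apply: le_trans hX _; rewrite /inv_radius invf_le1 //; lra.
have H : cabs (b%:C * X ^+ 2) <= 1 / 2.
  rewrite cabsM cabs_real (ger0_norm (ltW hb)) cabsX expr2.
  have := cabs_ge0 X; move: hX; rewrite /inv_radius -[leRHS]mul1r ler_pdivlMr; last lra.
  nra.
have := cabsD 1 (b%:C * X ^+ 2); have := cabs_lower 1 (b%:C * X ^+ 2); rewrite cabs1.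
by move=> ? ?; apply/andP; split; lra.
Qed.

Lemma Pi_neq0 X : cabs X <= inv_radius -> Pi X != 0.
Proof.
move=> /Pi_bounds /andP[H _]; apply/eqP => P0; move: H.
by rewrite P0 cabs0 expr0n /=; lra.
Qed.

Lemma root_neq0 l : l != 0 -> cabs l^-1 <= inv_radius -> rootp l != 0 /\ rootm l != 0.
Proof.
move=> l0 hl; have : rootp l * rootm l != 0.
  by rewrite rootpm // mulf_neq0 ?expf_neq0 // Pi_neq0.
by rewrite mulf_eq0 negb_or => /andP.
Qed.

(** The estimates on approximate solutions have to be uniform for spectral
    parameters near a given one; an upper bound on |l| is enough for that. *)
Lemma root_bounds (N : R) : exists2 B : R, 1 <= B & forall l, l != 0 ->
  cabs l^-1 <= inv_radius -> cabs l <= N ->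
  [/\ cabs l <= B /\ cabs l^-1 <= B, cabs (rootp l) <= B /\ cabs (rootm l) <= B,
     cabs (rootp l)^-1 <= B /\ cabs (rootm l)^-1 <= B &
     cabs kap <= B /\ cabs kap^-1 <= B].
Proof.
pose A := 1 + `|N| + inv_radius + sqrtb + sqrtb^-1 + 2 * (`|N| + sqrtb + 1).
have s0 := sqrtb_gt0; have si : 0 < sqrtb^-1 by rewrite invr_gt0.
have b0 := hb; have N0 := normr_ge0 N; have X00 : 0 < inv_radius by rewrite /inv_radius invr_gt0; lra.
have A1 : 1 <= A by rewrite /A; lra.
have E : A <= 2 * A ^+ 3.
  rewrite (_ : 2 * A ^+ 3 = A * (2 * (A * A))); last by ring.
  by rewrite ler_peMr; [|lra|nra].
exists (2 * A ^+ 3); first by lra.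
move=> l l0 hX hN; have NN := ler_norm N.
have lp : 0 < cabs l by rewrite cabs_gt0.
have /andP[P1 P2] := Pi_bounds hX.
have Pg := cabs_ge0 (Pi l^-1).
have P3 : cabs (Pi l^-1) <= 3 / 2 by nra.
have t2 : cabs (th l^-1) ^+ 2 <= 5 / 4.
  rewrite -cabsX th_sq cabsM cabsV cabs2 ler_pdivrMr //.
  apply: le_trans (cabsD _ _) _; rewrite cabs1; lra.
have t1 : 1 / 2 <= cabs (th l^-1) ^+ 2.
  by rewrite -cabsX th_sq cabsM cabsV cabs2 ler_pdivlMr // divfK //; exact: Pi1_ge1.
have tg := cabs_ge0 (th l^-1).
have t3 : cabs (th l^-1) <= 5 / 4 by nra.
have t4 : 1 / 2 <= cabs (th l^-1) by nra.
have db : cabs (de l^-1) <= sqrtb.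
  rewrite /de cabsM cabsV cabsM cabs2 cabs_kap ler_pdivrMr; last lra.
  by rewrite ler_peMr; lra.
have rb : cabs (rho l) <= 2 * `|N|.
  rewrite /rho cabsM; nra.
have R1 : cabs (rootp l) <= A by apply: le_trans (cabsD _ _) _; rewrite /A; lra.
have R2 : cabs (rootm l) <= A by apply: le_trans (cabsB _ _) _; rewrite /A; lra.
have [n1 n2] := root_neq0 l0 hX.
have il : cabs l^-1 <= A by rewrite /A; lra.
have iP : cabs (l ^+ 2 * Pi l^-1)^-1 <= 2 * A ^+ 2.
  rewrite cabsV cabsM invfM mulrC; apply: ler_pM; rewrite ?invr_ge0 ?cabs_ge0 //.
    rewrite -[leRHS]invrK ler_pV2 ?inE ?unitfE; [nra| |]; last by rewrite gt_eqF ?invr_gt0 //= invr_gt0.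
    by rewrite gt_eqF /=; nra.
  by rewrite cabsX -exprVn -cabsV lerXn2r ?nnegrE ?cabs_ge0 //; lra.
split; split.
- by apply: le_trans E; rewrite /A; lra.
- exact: le_trans il E.
- exact: le_trans R1 E.
- exact: le_trans R2 E.
- have -> : (rootp l)^-1 = rootm l * (l ^+ 2 * Pi l^-1)^-1.
    by rewrite -rootpm //; field; rewrite n1 n2.
  rewrite cabsM (_ : 2 * A ^+ 3 = A * (2 * A ^+ 2)); last by ring.
  by apply: ler_pM; rewrite ?cabs_ge0.
- have -> : (rootm l)^-1 = rootp l * (l ^+ 2 * Pi l^-1)^-1.
    by rewrite -rootpm //; field; rewrite n1 n2.
  rewrite cabsM (_ : 2 * A ^+ 3 = A * (2 * A ^+ 2)); last by ring.
  by apply: ler_pM; rewrite ?cabs_ge0.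
- by rewrite cabs_kap; apply: le_trans E; rewrite /A; lra.
- by rewrite cabsV cabs_kap; apply: le_trans E; rewrite /A; lra.
Qed.
End Roots.

(** * The characteristic determinant as a quadratic polynomial *)

Section Quadratic.
Variable R : realType.
Notation cabs := (@cabs R).
Notation C := R[i].
Variables (b : R) (hb : 0 < b).
Variables (k1 k2 k3 k4 : C).
Implicit Types (X l : C).

Notation Pi := (Pi b).
Notation th := (th b).
Notation de := (de b).
Notation cd := (cd b).
Notation sd := (sd b).
Notation rho := (rho b).
Notation rootp := (rootp b).
Notation rootm := (rootm b).

(** The coefficients of the determinant as a quadratic polynomial in l tanh(rho),
    obtained by expanding sinh and cosh of rho +- de. They are written in X = 1/l;
    note that 1/Pi comes from 1/r1 and 1/r2. *)
Definition quad2 X : C :=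
  (1 + k2 * X) * (1 + k4 * X) * (th X ^+ 2 * cd X ^+ 2 * (Pi X)^-1 - sd X ^+ 2)
  + k1 * k3 * (X ^+ 2) ^+ 2 * (de X ^+ 2 * cd X ^+ 2 * (Pi X)^-1)
  - (1 + k2 * X) * X ^+ 2 * k3 * (de X * cd X * sd X)
  + k1 * X ^+ 2 * (1 + k4 * X) * (de X * cd X * sd X * (Pi X)^-1).
Definition quad1 X : C := th X * (k3 * (1 + k2 * X) + k1 * (1 + k4 * X) * (Pi X)^-1).
Definition quad0 X : C :=
  (1 + k2 * X) * (de X * sd X) * (- (1 + k4 * X) * (de X * sd X * (Pi X)^-1) + k3 * cd X)
  + k1 * cd X * (- (1 + k4 * X) * (de X * sd X * (Pi X)^-1) + k3 * cd X)
  - k1 * k3 * (th X ^+ 2 * sd X ^+ 2 * (Pi X)^-1).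

(** Homogeneous form of the quadratic polynomial, multiplied by cosh(rho)^2, which
    may vanish. *)
Lemma chardet_quadratic l : l != 0 -> Pi l^-1 != 0 -> rootp l != 0 -> rootm l != 0 ->
  chardet k1 k2 k3 k4 l (rootp l) (rootm l) =
  l * (quad2 l^-1 * (l * csh (rho l)) ^+ 2 + quad1 l^-1 * (l * csh (rho l)) * cch (rho l)
       + quad0 l^-1 * cch (rho l) ^+ 2).
Proof.
move=> l0 P0 r10 r20.
have i1 : (rootp l)^-1 = rootm l / (l ^+ 2 * Pi l^-1).
  by rewrite -(rootpm hb) //; field; rewrite r10 r20.
have i2 : (rootm l)^-1 = rootp l / (l ^+ 2 * Pi l^-1).
  by rewrite -(rootpm hb) //; field; rewrite r10 r20.
have s1 : csh (rootp l) = csh (rho l) * cd l^-1 + cch (rho l) * sd l^-1 by exact: cshD.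
have s2 : csh (rootm l) = csh (rho l) * cd l^-1 - cch (rho l) * sd l^-1.
  by rewrite /rootm cshD cshN cchN mulrN.
have a1 : cch (rootp l) = cch (rho l) * cd l^-1 + csh (rho l) * sd l^-1 by exact: cchD.
have a2 : cch (rootm l) = cch (rho l) * cd l^-1 - csh (rho l) * sd l^-1.
  by rewrite /rootm cchD cshN cchN mulrN.
have cs1 : cd l^-1 ^+ 2 - sd l^-1 ^+ 2 = 1 by exact: cchsh.
rewrite /chardet /m11 /m12 /m21 /m22 i1 i2 s1 s2 a1 a2.
have fbE : quad1 l^-1 = (cd l^-1 ^+ 2 - sd l^-1 ^+ 2) * quad1 l^-1 by rewrite cs1 mul1r.
rewrite {}fbE.
rewrite /quad2 /quad1 /quad0 /rootp /rootm {3 4 5 6 7 8 9 10}/rho.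
move: (csh (rho l)) (cch (rho l))  => S Co.
rewrite /rho; move: P0; clear i1 i2 s1 s2 a1 a2 cs1.
move: (Pi l^-1) (th l^-1) (de l^-1) (cd l^-1) (sd l^-1) => P t e c d P0.
by field; rewrite l0 P0.
Qed.

Lemma sdiffX2 (f : C -> C) (x0 d : C) : sdiff f x0 d -> sdiff (fun x => f x ^+ 2) x0 (2 * f x0 * d).
Proof.
move=> sf; apply: (sdiff_ext (f := fun x => f x * f x)); first by move=> x; rewrite expr2.
by apply: sdiff_eq (sdiffM sf sf); ring.
Qed.

Let P0n : Pi 0 != 0. Proof. by rewrite Pi0 oner_neq0. Qed.

(** Reads the derivative at 0 off the syntax of an expression in X, Pi, th, de and
    the hyperbolic functions of de. *)
Ltac sdiff_tac := lazymatch goal with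
  | |- sdiff (fun _ => ?c) _ _ => exact (sdiff_cst 0 c)
  | |- sdiff (fun x => x) _ _ => exact (sdiff_id 0)
  | |- sdiff (fun x => @GRing.add _ (@?f x) (@?g x)) _ _ => refine (sdiffD (f := f) (g := g) _ _); sdiff_tac
  | |- sdiff (fun x => @GRing.mul _ (@?f x) (@?g x)) _ _ => refine (sdiffM (f := f) (g := g) _ _); sdiff_tac
  | |- sdiff (fun x => @GRing.opp _ (@?f x)) _ _ => refine (sdiffN (f := f) _); sdiff_tac
  | |- sdiff (fun x => @GRing.exp _ (@?f x) 2%N) _ _ => refine (sdiffX2 (f := f) _); sdiff_tac
  | |- sdiff (fun x => @GRing.inv _ (Pi x)) _ _ => exact (sdiffV P0n (sdiff_Pi b))
  | |- sdiff (fun x => Pi x) _ _ => exact (sdiff_Pi b)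
  | |- sdiff (fun x => th x) _ _ => exact (sdiff_th b)
  | |- sdiff (fun x => de x) _ _ => exact (sdiff_de b)
  | |- sdiff (fun x => cd x) _ _ => exact (sdiff_cd b)
  | |- sdiff (fun x => sd x) _ _ => exact (sdiff_sd b)
  end.

Lemma quad2_0 : quad2 0 = cd 0 ^+ 2 - sd 0 ^+ 2.
Proof. by rewrite /quad2 Pi0 th0 invr1 ?(mulr0, addr0, expr1n, mulr1, mul1r); ring. Qed.

Lemma sdiff_quad2 : sdiff quad2 0 ((k2 + k4) * (cd 0 ^+ 2 - sd 0 ^+ 2)).
Proof.
apply: sdiff_eq; last by rewrite /quad2; sdiff_tac.
by rewrite /= Pi0 th0; field.
Qed.

Lemma quad1_0 : quad1 0 = k3 + k1.
Proof. by rewrite /quad1 Pi0 th0 invr1; ring. Qed.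

Lemma sdiff_quad1 : sdiff quad1 0 (k3 * k2 + k1 * k4).
Proof.
apply: sdiff_eq; last by rewrite /quad1; sdiff_tac.
by rewrite /= Pi0 th0; field.
Qed.

Lemma quad0_0 (pr := - (de 0 * sd 0)) : quad0 0 = - pr * (pr + k3 * cd 0) + k1 * cd 0 * (pr + k3 * cd 0)
   - k1 * k3 * sd 0 ^+ 2.
Proof. by rewrite /quad0 /pr Pi0 th0 invr1; ring. Qed.

Lemma sdiff_quad0 (pr := - (de 0 * sd 0)) : sdiff quad0 0
  (- k2 * pr * (pr + k3 * cd 0) - k4 * pr ^+ 2 + k1 * k4 * cd 0 * pr).
Proof.
apply: sdiff_eq; last by rewrite /quad0; sdiff_tac.
by rewrite /pr Pi0 th0 invr1; field.
Qed.
End Quadratic.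

(** * The two branches of characteristic roots *)

Section Artanh.
Variable R : realType.
Notation cabs := (@cabs R).
Notation C := R[i].
Implicit Types (T z : C).

Lemma csh_cubic z : cabs z <= 1 -> cabs (csh z - z) <= 8 * expR 1 * cabs z ^+ 3.
Proof.
move=> z1; have h1 := cexp_est3 z1.
have h2 : cabs (cexp (- z) - 1 - - z - (- z) ^+ 2 / 2) <= 8 * expR 1 * cabs z ^+ 3.
  by have := @cexp_est3 R (- z); rewrite cabsN; apply.
have -> : csh z - z = ((cexp z - 1 - z - z ^+ 2 / 2) - (cexp (- z) - 1 - - z - (- z) ^+ 2 / 2)) / 2.
  by rewrite /csh; field.
rewrite cabsM cabsV cabs2 ler_pdivrMr //; apply: le_trans (cabsB _ _) _; lra.
Qed.

Lemma cch_quadratic z : cabs z <= 1 -> cabs (cch z - 1) <= 4 * expR 1 * cabs z ^+ 2.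
Proof.
move=> z1; have h1 := cexp_est2 z1.
have h2 : cabs (cexp (- z) - 1 - - z) <= 4 * expR 1 * cabs z ^+ 2.
  by have := @cexp_est2 R (- z); rewrite cabsN; apply.
have -> : cch z - 1 = ((cexp z - 1 - z) + (cexp (- z) - 1 - - z)) / 2.
  by rewrite /cch; field.
rewrite cabsM cabsV cabs2 ler_pdivrMr //; apply: le_trans (cabsD _ _) _; lra.
Qed.

Definition artanh T : C := clog ((1 + T) * (1 - T)^-1) / 2.

Lemma artanh0 : artanh 0 = 0.
Proof. by rewrite /artanh addr0 subr0 invr1 mulr1 clog1 mul0r. Qed.

Lemma sdiff_artanh : sdiff artanh 0 1.
Proof.
have n1 : (1 : C) - 0 != 0 by rewrite subr0 oner_neq0.
have H1 := sdiffV (f := fun T => 1 - T) n1 (sdiffB (sdiff_cst 0 1) (sdiff_id 0)).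
have H2 := sdiffM (sdiffD (sdiff_cst 0 1) (sdiff_id 0)) H1.
have H3 : sdiff (@clog R) ((1 + 0) * (1 - 0)^-1) 1.
  by rewrite addr0 subr0 invr1 mulr1; exact: sdiff_clog.
have H := sdiffM (sdiff_comp H2 H3) (sdiff_cst 0 2^-1).
apply: sdiff_eq H; by rewrite /= subr0; field.
Qed.

(** The values of sinh and cosh at artanh T are related as they should, without
    dividing by cosh. *)
Lemma artanhK T : cabs T <= 1 / 8 ->
  cexp (2 * artanh T) = (1 + T) / (1 - T) /\ csh (artanh T) = T * cch (artanh T).
Proof.
move=> hT.
have d0 : 7 / 8 <= cabs (1 - T).
  by have := cabs_lower 1 (- T); rewrite cabsN cabs1; lra.
have n0 : 1 - T != 0 by rewrite -cabs_gt0; lra.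
have E : cexp (2 * artanh T) = (1 + T) / (1 - T).
  rewrite /artanh mulrC divfK ?pnatr_eq0 // clogK //.
  have -> : (1 + T) / (1 - T) = 1 + 2 * T / (1 - T) by field.
  have H : cabs (2 * T / (1 - T)) <= 1 / 2.
    rewrite cabsM cabsV cabsM cabs2 ler_pdivrMr; lra.
  have := le_trans (Re_le_cabs _) H; rewrite ler_norml => /andP[H1 _].
  by rewrite cReD [complex.Re 1]/=; lra.
split => //.
set z := artanh T in E *.
have e2 : cexp (2 * z) = cexp z * cexp z by rewrite -cexpD; congr cexp; ring.
have en := cexpNK z.
apply/eqP; rewrite -subr_eq0; apply/eqP.
rewrite /csh /cch.
transitivity (cexp (- z) / 2 * (cexp (2 * z) * (1 - T) - (1 + T)) - (1 - T) / 2 * cexp z * (cexp z * cexp (- z) - 1)).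
  by rewrite e2; field.
by rewrite en E divfK //; ring.
Qed.

(** With a = artanh T one has a - T = - (sinh a - a) + T (cosh a - 1), where
    |a| <= 2 |T|. *)
Lemma artanh_cubic : exists K r : R, [/\ 0 <= K, 0 < r &
  forall T, cabs T <= r -> cabs (artanh T - T) <= K * cabs T ^+ 3].
Proof.
have [r r0 Hr] := near2_diag (sdiff_lip sdiff_artanh).
have c1' : cabs (1 : C) + 1 = 2 by rewrite cabs1; ring.
have e1 : 1 <= expR 1 :> R by rewrite -[leLHS]expR0 ler_expR.
exists (80 * expR 1), (Num.min r (1 / 8)); split; [lra|by rewrite lt_min r0; lra|].
move=> T; rewrite le_min => /andP[T1 T2].
have [_ H] := artanhK T2.
have := Hr T; rewrite subr0 artanh0 subr0 c1' => /(_ T1) zT.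
set z := artanh T in H zT *.
have T0 := cabs_ge0 T; have z0 := cabs_ge0 z.
have z1 : cabs z <= 1 by lra.
have -> : z - T = - (csh z - z) + T * (cch z - 1) by rewrite H; ring.
apply: le_trans (cabsD _ _) _; rewrite cabsN cabsM.
have h1 := csh_cubic z1; have h2 := cch_quadratic z1.
have z3 : cabs z ^+ 3 <= 8 * cabs T ^+ 3.
  by rewrite (_ : 8 * _ = (2 * cabs T) ^+ 3); [rewrite lerXn2r ?nnegrE //; lra|ring].
have z2 : cabs z ^+ 2 <= 4 * cabs T ^+ 2.
  by rewrite (_ : 4 * _ = (2 * cabs T) ^+ 2); [rewrite lerXn2r ?nnegrE //; lra|ring].
have h3 : cabs T * cabs (cch z - 1) <= 16 * expR 1 * cabs T ^+ 3.
  rewrite (_ : 16 * _ * _ = cabs T * (4 * expR 1 * (4 * cabs T ^+ 2))); last by ring.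
  rewrite ler_wpM2l //; apply: le_trans h2 _; rewrite ler_wpM2l //; lra.
have h4 : cabs (csh z - z) <= 64 * expR 1 * cabs T ^+ 3.
  rewrite (_ : 64 * _ * _ = 8 * expR 1 * (8 * cabs T ^+ 3)); last by ring.
  apply: le_trans h1 _; rewrite ler_wpM2l //; lra.
lra.
Qed.
End Artanh.

Section Branches.
Variable R : realType.
Notation cabs := (@cabs R).
Notation C := R[i].
Variables (b k1 k2 k3 k4 : R).
Hypothesis (hb : 0 < b) (hk1 : 0 < k1) (hk3 : 0 < k3).
Hypothesis hyp : k1 <> k3 \/
  (forall k : nat, (0 < k)%N -> Num.sqrt b <> 2 * k%:R * pi).
Implicit Types (X l : C) (j : 'I_2).

Notation Pi := (Pi b).
Notation th := (th b).
Notation de := (de b).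
Notation cd := (cd b).
Notation sd := (sd b).
Notation rho := (rho b).
Notation rootp := (rootp b).
Notation rootm := (rootm b).
Notation quad2 := (quad2 b k1%:C k2%:C k3%:C k4%:C).
Notation quad1 := (quad1 b k1%:C k2%:C k3%:C k4%:C).
Notation quad0 := (quad0 b k1%:C k2%:C k3%:C k4%:C).

(** At X = 0 one has cosh(de) = qq and de sinh(de) = - pp. *)
Definition half_s : R := sqrtb b / 2.
Definition pp : R := half_s * sin half_s.
Definition qq : R := cos half_s.
(** The value at X = 0 of the constant coefficient; the other two coefficients are
    then 1 and k1 + k3, so that [dlt] is the discriminant and [tau0 j] are the
    roots. *)
Definition d00 : R := k1 * k3 + (k1 - k3) * pp * qq - pp ^+ 2.
Definition dlt : R := (k1 + k3) ^+ 2 - 4 * d00.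
Definition sgn j : R := if j == ord0 then 1 else -1.
Definition tau0 j : R := (- (k1 + k3) + sgn j * Num.sqrt dlt) / 2.
(** Derivative at X = 0 of the constant coefficient. *)
Definition d01 : R := - k2 * pp * (pp + k3 * qq) - k4 * pp ^+ 2 + k1 * k4 * qq * pp.
(** Derivative at X = 0 of the root [tau j], by implicit differentiation of the
    quadratic equation; sgn j sqrt(dlt) = 2 tau0 j + k1 + k3. *)
Definition kappa j : R :=
  - ((k2 + k4) * tau0 j ^+ 2 + (k3 * k2 + k1 * k4) * tau0 j + d01) / (sgn j * Num.sqrt dlt).

Lemma dltE : dlt = (k3 - k1 + 2 * pp * qq) ^+ 2 + 4 * pp ^+ 2 * sin half_s ^+ 2.
Proof.
have cs := cos2Dsin2 half_s.
have -> : sin half_s ^+ 2 = 1 - qq ^+ 2 by rewrite /qq -cs; ring.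
by rewrite /dlt /d00; ring.
Qed.

Lemma sin_eq0_pos (x : R) : 0 < x -> sin x = 0 -> exists2 k : nat, (0 < k)%N & x = k%:R * pi.
Proof.
move=> x0 sx; have pp0 := @pi_gt0 R.
have cx : cos x ^+ 2 = 1 by rewrite -[RHS](cos2Dsin2 x) sx expr0n /= addr0.
have E : cexp (0 +i* (x + x)) = 1 :> C.
  rewrite cexp_im cosD sinD sx !(mulr0, mul0r, addr0, subr0) -expr2 cx //.
have [[n|n] [H]] := cexp_eq1 E.
- exists n; last by move: H; rewrite -pmulrn; lra.
  by case: n H => // H; move: H; rewrite mulr0z mulr0 mul0r; lra.
- move: H; rewrite NegzE mulrNz -pmulrn => H.
  have : 0 < n.+1%:R * (pi : R) by rewrite mulr_gt0.
  lra.
Qed.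

Lemma half_s_gt0 : 0 < half_s.
Proof. by rewrite divr_gt0 // sqrtb_gt0. Qed.

(** As a sum of two squares ([dltE]) the discriminant vanishes only if
    pp sin(sqrt(b)/2) = 0, that is sin(sqrt(b)/2) = 0, and then pp = 0 and k1 = k3.
    Since b > 0, the zeros of the sine are the excluded values of sqrt(b). *)
Lemma dlt_gt0 : 0 < dlt.
Proof.
have s0 := half_s_gt0.
rewrite dltE lt_def; apply/andP; split; last first.
  apply: addr_ge0; first exact: sqr_ge0.
  by apply: mulr_ge0; [apply: mulr_ge0 => //|]; exact: sqr_ge0.
apply/eqP => H.
have H1 : 4 * pp ^+ 2 * sin half_s ^+ 2 = 0.
  have h1 : 0 <= (k3 - k1 + 2 * pp * qq) ^+ 2 by exact: sqr_ge0.
  have h2 : 0 <= 4 * pp ^+ 2 * sin half_s ^+ 2.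
    by apply: mulr_ge0; [apply: mulr_ge0 => //|]; exact: sqr_ge0.
  lra.
have sx : sin half_s = 0.
  apply/eqP/negPn/negP => sn; move/eqP: H1; apply/negP.
  have pn : pp != 0 by rewrite mulf_neq0 // gt_eqF.
  by rewrite mulf_neq0 ?expf_neq0 // mulf_neq0 ?expf_neq0 // pnatr_eq0.
have p0 : pp = 0 by rewrite /pp sx mulr0.
move: H; rewrite p0 sx mulr0 mul0r addr0 !expr0n /= mulr0 addr0 => /eqP.
rewrite expf_eq0 /= subr_eq0 => /eqP k13.
case: hyp => [H|H]; first by apply: H.
have [k k0 E] := sin_eq0_pos s0 sx.
by apply: (H k k0); move: E; rewrite /half_s /sqrtb; lra.
Qed.

Lemma sqrt_dlt_gt0 : 0 < Num.sqrt dlt.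
Proof. by rewrite sqrtr_gt0 dlt_gt0. Qed.

Lemma sgn_sq j : sgn j ^+ 2 = 1.
Proof. by rewrite /sgn; case: ifP => _; rewrite ?sqrrN expr1n. Qed.

Lemma de_sd0 : - (de 0 * sd 0) = pp%:C.
Proof.
rewrite de0 sd0 kap_half /pp /half_s; apply: complexP => /=; ring.
Qed.

Lemma cd0E : cd 0 = qq%:C.
Proof. exact: cd0. Qed.

Lemma cd_sd0 : cd 0 ^+ 2 - sd 0 ^+ 2 = 1.
Proof. exact: cchsh. Qed.

Lemma quad2_0E : quad2 0 = 1.
Proof. by rewrite quad2_0 cd_sd0. Qed.

Lemma quad1_0E : quad1 0 = (k1 + k3)%:C.
Proof. by rewrite quad1_0; ring. Qed.

Lemma quad0_0E : quad0 0 = d00%:C.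
Proof.
rewrite quad0_0 de_sd0 (_ : sd 0 ^+ 2 = cd 0 ^+ 2 - 1); last by rewrite -cd_sd0; ring.
by rewrite cd0E /d00; ring.
Qed.

Lemma sdiff_quad2E : sdiff quad2 0 (k2 + k4)%:C.
Proof. by apply: sdiff_eq (sdiff_quad2 _ _ _ _ _); rewrite cd_sd0; ring. Qed.

Lemma sdiff_quad1E : sdiff quad1 0 (k3 * k2 + k1 * k4)%:C.
Proof. by apply: sdiff_eq (sdiff_quad1 _ _ _ _ _); ring. Qed.

Lemma sdiff_quad0E : sdiff quad0 0 d01%:C.
Proof. by apply: sdiff_eq (sdiff_quad0 _ _ _ _ _); rewrite de_sd0 cd0E /d01; ring. Qed.

Definition disc X : C := quad1 X * quad1 X - 4 * (quad2 X * quad0 X).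
Definition tau j X : C := (- quad1 X + (sgn j)%:C * sqrtc (disc X)) * (2 * quad2 X)^-1.

Lemma disc0 : disc 0 = dlt%:C.
Proof. by rewrite /disc quad2_0E quad1_0E quad0_0E /dlt; ring. Qed.

Lemma sqrt_disc0 : sqrtc (disc 0) = (Num.sqrt dlt)%:C.
Proof. by rewrite disc0 sqrtc_sqrtr //= ler0c ltW // dlt_gt0. Qed.

Lemma tau0E j : tau j 0 = (tau0 j)%:C.
Proof. by rewrite /tau sqrt_disc0 quad2_0E quad1_0E /tau0; field. Qed.

Lemma sdiff_tau j : sdiff (tau j) 0 (kappa j)%:C.
Proof.
have Hd : sdiff disc 0 _ := sdiffB (sdiffM sdiff_quad1E sdiff_quad1E)
  (sdiffM (sdiff_cst 0 4) (sdiffM sdiff_quad2E sdiff_quad0E)).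
have Hs : sdiff (@sqrtc R) (disc 0) (2 * (Num.sqrt dlt)%:C)^-1.
  by rewrite -sqrt_disc0 disc0; apply: sdiff_sqrtc; exact: dlt_gt0.
have n0 : 2 * quad2 0 != 0 by rewrite quad2_0E mulr1 pnatr_eq0.
have H : sdiff (tau j) 0 _ := sdiffM (sdiffD (sdiffN sdiff_quad1E)
    (sdiffM (sdiff_cst 0 (sgn j)%:C) (sdiff_comp Hd Hs)))
  (sdiffV (f := fun X => 2 * quad2 X) n0 (sdiffM (sdiff_cst 0 2) sdiff_quad2E)).
apply: sdiff_eq H; cbv beta; rewrite sqrt_disc0.
rewrite quad2_0E quad1_0E quad0_0E.
rewrite /kappa /tau0; have r0 := sqrt_dlt_gt0.
have dE : d00 = ((k1 + k3) ^+ 2 - Num.sqrt dlt ^+ 2) / 4.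
  by rewrite sqr_sqrtr ?(ltW dlt_gt0) // /dlt; field.
rewrite dE; move: r0; move: (Num.sqrt dlt) => r r0.
have rn : r%:C != 0 by rewrite -cabs_gt0 cabs_real normr_gt0 gt_eqF.
have rn' : r != 0 by rewrite gt_eqF.
rewrite /sgn; case: ifP => _; by field; rewrite ?rn ?rn'.
Qed.

Lemma quad_factor j j' X t : quad2 X != 0 -> j != j' ->
  quad2 X * t ^+ 2 + quad1 X * t + quad0 X = quad2 X * (t - tau j X) * (t - tau j' X).
Proof.
move=> fn jj.
have S : sqrtc (disc X) ^+ 2 = quad1 X * quad1 X - 4 * (quad2 X * quad0 X) by exact: sqr_sqrtc.
have ss : (sgn j = 1 /\ sgn j' = -1) \/ (sgn j = -1 /\ sgn j' = 1).
  move: jj; rewrite /sgn -!val_eqE; case: j => [[|[|//]] ?]; case: j' => [[|[|//]] ?] //= _;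
    [by left|by right].
have E : quad0 X = (quad1 X ^+ 2 - sqrtc (disc X) ^+ 2) / (4 * quad2 X) by rewrite S; field.
rewrite E /tau; move: (sqrtc _) (quad1 X) (quad2 X) fn => r f a a0.
by case: ss => [[-> ->]|[-> ->]]; field.
Qed.

Lemma tau0_root j : tau0 j ^+ 2 + (k1 + k3) * tau0 j + d00 = 0.
Proof.
have dE : d00 = ((k1 + k3) ^+ 2 - (sgn j * Num.sqrt dlt) ^+ 2) / 4.
  by rewrite exprMn sgn_sq mul1r sqr_sqrtr ?(ltW dlt_gt0) // /dlt; field.
by rewrite dE /tau0; field.
Qed.

(** The numbers X = tau0 j + k3 + pp qq and Y = tau0 j + k1 - pp qq have sum
    sgn j sqrt(dlt) and, by the equation of tau0 j, product (pp sin(sqrt(b)/2))^2 >= 0.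
    Hence X and Y have the sign of their sum, and the weights X / (X + Y) and
    Y / (X + Y) lie in [0,1]. *)
Lemma kappa_mean j : exists2 x : R, 0 <= x <= 1 &
  kappa j = k1 * k2 * x + k3 * k4 * (1 - x).
Proof.
pose D := sgn j * Num.sqrt dlt.
have r0 := sqrt_dlt_gt0.
have Dn : D != 0.
  by rewrite -sqrf_eq0 exprMn sgn_sq mul1r expf_neq0 // gt_eqF.
have DE : D = 2 * tau0 j + k1 + k3 by rewrite /tau0 -/D; field.
have rt := tau0_root j.
pose X := tau0 j + k3 + pp * qq; pose Y := tau0 j + k1 - pp * qq.
have XY : X * Y = (pp * sin half_s) ^+ 2.
  have -> : (pp * sin half_s) ^+ 2 = pp ^+ 2 * (1 - qq ^+ 2).
    by rewrite /qq exprMn -(cos2Dsin2 half_s); ring.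
  have -> : X * Y = tau0 j ^+ 2 + (k1 + k3) * tau0 j + d00 + pp ^+ 2 * (1 - qq ^+ 2).
    by rewrite /X /Y /d00; ring.
  by rewrite rt add0r.
have yE : 1 - X / D = Y / D.
  have -> : 1 - X / D = (D - X) / D by field.
  by congr (_ / D); rewrite DE /X /Y; ring.
have xy : 0 <= (X / D) * (1 - X / D).
  by rewrite yE mulrACA XY -invfM -expr2 mulr_ge0 ?invr_ge0 ?sqr_ge0.
exists (X / D).
  by move: xy; set x := X / D; nra.
rewrite yE /kappa -/D.
have -> : - ((k2 + k4) * tau0 j ^+ 2 + (k3 * k2 + k1 * k4) * tau0 j + d01) =
    k1 * k2 * X + k3 * k4 * Y - (k2 + k4) * (tau0 j ^+ 2 + (k1 + k3) * tau0 j + d00).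
  by rewrite /X /Y /d00 /d01; ring.
by rewrite rt; field.
Qed.

Lemma kappa_gt0 j : 0 < k2 -> 0 < k4 -> 0 < kappa j.
Proof.
move=> h2 h4; have h1 := hk1; have h3 := hk3.
have [x /andP[x0 x1] ->] := kappa_mean j.
have a0 : 0 < k1 * k2 by rewrite mulr_gt0.
have c0 : 0 < k3 * k4 by rewrite mulr_gt0.
have [h|h] := ltP 0 x.
  by rewrite ltr_pwDl ?mulr_gt0 // mulr_ge0 ?(ltW c0) // subr_ge0.
have -> : x = 0 by lra.
by rewrite mulr0 add0r subr0 mulr1.
Qed.

(** rho(l) = l + gg(1/l) / l. *)
Definition gg X : C := b%:C * (2 * (th X + 1) * (Pi X + 1))^-1.
(** The difference l - i k pi along the branch j, as a function of X = 1/l: the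
    equation tanh(rho) = X tau_j(X) says that rho = i k pi + artanh(X tau_j(X)). *)
Definition offset j X : C := artanh (X * tau j X) - X * gg X.

Lemma gg0 : gg 0 = (b / 8)%:C.
Proof. by rewrite /gg Pi0 th0; field. Qed.

Lemma sdiff_gg : sdiff gg 0 0.
Proof.
have n0 : 2 * (th 0 + 1) * (Pi 0 + 1) != 0.
  by rewrite Pi0 th0 !mulf_neq0 // -natrD pnatr_eq0.
have H := sdiffM (sdiff_cst 0 b%:C) (sdiffV (f := fun X => 2 * (th X + 1) * (Pi X + 1)) n0
  (sdiffM (sdiffM (sdiff_cst 0 2) (sdiffD (sdiff_th b) (sdiff_cst 0 1)))
          (sdiffD (sdiff_Pi b) (sdiff_cst 0 1)))).
by apply: sdiff_eq H; cbv beta; rewrite !(mulr0, mul0r, addr0, oppr0).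
Qed.

Lemma offset0 j : offset j 0 = 0.
Proof. by rewrite /offset !mul0r artanh0 subr0. Qed.

Lemma sdiff_offset j : sdiff (offset j) 0 (tau0 j - b / 8)%:C.
Proof.
have Ha : sdiff (@artanh R) (0 * tau j 0) 1 by rewrite mul0r; exact: sdiff_artanh.
have H : sdiff (offset j) 0 _ := sdiffB (sdiff_comp (sdiffM (sdiff_id 0) (sdiff_tau j)) Ha)
  (sdiffM (sdiff_id 0) sdiff_gg).
by apply: sdiff_eq H; cbv beta; rewrite tau0E gg0 /=; ring.
Qed.

(** The derivative of gg vanishes at 0 and artanh is odd, so that the only
    contribution of order two is the derivative of tau j. *)
Lemma offset_expansion j : exists K r : R, [/\ 0 <= K, 0 < r & forall X, cabs X <= r ->
  cabs (offset j X - (tau0 j - b / 8)%:C * X - (kappa j)%:C * X ^+ 2) <= K * cabs X ^+ 3].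
Proof.
have [K1 [r1 [K10 r10 H1]]] := artanh_cubic R.
have [K2 [r2 [K20 r20 H2]]] := sdiff_expansion (sdiff_tau j).
have [K3 [r3 [K30 r30 H3]]] := sdiff_expansion sdiff_gg.
have [L [L0 [r4 r40 H4]]] : exists L : R, 0 <= L /\ exists2 r : R, 0 < r &
    forall X, cabs X <= r -> cabs (tau j X) <= L.
  have [tt _] := sdiff_tends (sdiff_tau j).
  have [r r0 H] := near2_diag (tends_bounded tt).
  exists (cabs (tau j 0) + 1); split; first by rewrite addr_ge0 ?cabs_ge0.
  by exists r => // X hX; apply: H; rewrite subr0.
pose r := Num.min (Num.min r2 r3) (Num.min r4 (r1 / (L + 1))).
have Lp : 0 < L + 1 by lra.
exists (K1 * L ^+ 3 + K2 + K3), r; split.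
- by rewrite !addr_ge0 // mulr_ge0 // exprn_ge0.
- by rewrite !lt_min r20 r30 r40 divr_gt0.
move=> X; rewrite !le_min => /andP[/andP[X2 X3] /andP[X4 X1]].
have inv_radius := cabs_ge0 X.
have tL := H4 _ X4.
have xt : cabs (X * tau j X) <= cabs X * L by rewrite cabsM ler_wpM2l.
have xr : cabs (X * tau j X) <= r1.
  apply: le_trans xt _; move: X1; rewrite ler_pdivlMr // => X1; nra.
have h1 := H1 _ xr.
have := H2 X; have := H3 X; rewrite !subr0 tau0E gg0 mul0r subr0 => /(_ X3) h3 /(_ X2) h2.
have -> : offset j X - (tau0 j - b / 8)%:C * X - (kappa j)%:C * X ^+ 2 =
   (artanh (X * tau j X) - X * tau j X)
   + (X * (tau j X - (tau0 j)%:C - (kappa j)%:C * X) - X * (gg X - (b / 8)%:C)).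
  by rewrite /offset; ring.
apply: le_trans (cabsD _ _) _; rewrite -(addrA _ K2 K3) mulrDl; apply: lerD.
  apply: le_trans h1 _; rewrite -mulrA ler_wpM2l // -exprMn.
  by rewrite [L * _]mulrC; apply: lerXn2r; rewrite ?nnegrE ?cabs_ge0 ?mulr_ge0.
apply: le_trans (cabsB _ _) _; rewrite !cabsM mulrDl exprS.
by apply: lerD; rewrite mulrCA; apply: ler_wpM2l.
Qed.

Lemma rho_gg l : l != 0 -> rho l = l + l^-1 * gg l^-1.
Proof.
move=> l0; rewrite /rho /gg.
have t1 := th1_neq0 b l^-1; have P1 := Pi1_neq0 b l^-1.
have P1' : Pi l^-1 + 1 != 0 by rewrite addrC.
have Ts := th_sq b l^-1; have Ps := Pi_sq b l^-1.
have E1 : th l^-1 - 1 = (Pi l^-1 - 1) / (2 * (th l^-1 + 1)).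
  have : (th l^-1 - 1) * (th l^-1 + 1) = (Pi l^-1 - 1) / 2.
    by rewrite -subr_sqr expr1n Ts; field.
  move=> E; apply: (mulIf t1); rewrite E; field; by rewrite ?t1.
have E2 : Pi l^-1 - 1 = b%:C * l^-1 ^+ 2 / (Pi l^-1 + 1).
  have : (Pi l^-1 - 1) * (Pi l^-1 + 1) = b%:C * l^-1 ^+ 2.
    by rewrite -subr_sqr expr1n Ps; ring.
  move=> E; apply: (mulIf P1'); rewrite E; field; by rewrite ?l0 ?P1'.
have E3 : th l^-1 = 1 + b%:C * l^-1 ^+ 2 / (Pi l^-1 + 1) / (2 * (th l^-1 + 1)).
  by rewrite -E2 -E1; ring.
rewrite {1}E3; move: (Pi l^-1) (th l^-1) t1 P1' => P t t1 P1'.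
by field; rewrite l0 t1 P1'.
Qed.
End Branches.

(** * Contraction and factorization of the determinant *)

Section FixedPoint.
Variable R : realType.
Notation cabs := (@cabs R).
Notation C := R[i].

Lemma geometric_cauchy (x : nat -> R) :
  (forall n, `|x n.+1 - x n| <= 2^-1 ^+ n) ->
  exists l : R, forall n, `|x n - l| <= 2 * 2^-1 ^+ n.
Proof.
move=> H; pose q n : R := 2^-1 ^+ n.
have qS n : q n.+1 = q n / 2 by rewrite /q exprS mulrC.
have q0 n : 0 < q n by rewrite exprn_gt0.
have ad n m : x n - 2 * q n <= x (n + m)%N - 2 * q (n + m)%N.
  elim: m => [|m IH]; first by rewrite addn0.
  apply: le_trans IH _; rewrite addnS qS.
  by have := H (n + m)%N; rewrite ler_norml -/(q _) => /andP[? ?]; lra.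
have bd n m : x (n + m)%N + 2 * q (n + m)%N <= x n + 2 * q n.
  elim: m => [|m IH]; first by rewrite addn0.
  apply: le_trans _ IH; rewrite addnS qS.
  by have := H (n + m)%N; rewrite ler_norml -/(q _) => /andP[? ?]; lra.
have ab n m : x n - 2 * q n <= x m + 2 * q m.
  have := ad n m; have := bd m n; rewrite addnC; have := q0 (n + m)%N; lra.
pose A := [set y | exists n, y = x n - 2 * q n].
have hs : has_sup A.
  split; first by exists (x 0%N - 2 * q 0%N); exists 0%N.
  by exists (x 0%N + 2 * q 0%N) => y [n ->].
exists (sup A) => n; rewrite ler_norml; apply/andP; split.
- have : sup A <= x n + 2 * q n by apply: ge_sup; [case: hs|move=> y [m ->]].
  by rewrite -/(q n); lra.
- have : x n - 2 * q n <= sup A by apply: ub_le_sup; [case: hs|exists n].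
  by rewrite -/(q n); lra.
Qed.

(** Banach's theorem on a closed disk of radius 1. Completeness is used through
    the coordinates of the iterates, for which a supremum of explicit lower bounds
    is the limit. *)
Lemma contraction_fixed_point (c : C) (G : C -> C) :
  (forall z, cabs (z - c) <= 1 -> cabs (G z - c) <= 1) ->
  (forall z w, cabs (z - c) <= 1 -> cabs (w - c) <= 1 ->
     cabs (G z - G w) <= 2^-1 * cabs (z - w)) ->
  exists2 z, cabs (z - c) <= 1 & G z = z.
Proof.
move=> Gb Gc; pose u n := iter n G c.
have ub n : cabs (u n - c) <= 1.
  by elim: n => [|n IH]; [rewrite subrr cabs0|exact: Gb].
have ud n : cabs (u n.+1 - u n) <= 2^-1 ^+ n.
  elim: n => [|n IH]; first by rewrite expr0; exact: Gb (ub 0%N).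
  by apply: le_trans (Gc _ _ (ub n.+1) (ub n)) _; rewrite exprS ler_wpM2l.
have [a Ha] := @geometric_cauchy (fun n => complex.Re (u n)) (fun n =>
  le_trans (eq_ind _ (fun t => `|t| <= _) (Re_le_cabs _) _ (raddfB _ _ _)) (ud n)).
have [e He] := @geometric_cauchy (fun n => complex.Im (u n)) (fun n =>
  le_trans (eq_ind _ (fun t => `|t| <= _) (Im_le_cabs _) _ (raddfB _ _ _)) (ud n)).
pose z := a +i* e.
have uz n : cabs (u n - z) <= 4 * 2^-1 ^+ n.
  apply: le_trans (cabs_le _) _; rewrite !raddfB /=.
  by have := Ha n; have := He n; lra.
have small (s : R) : (forall n, s <= 12 * 2^-1 ^+ n) -> s <= 0.
  move=> H; rewrite leNgt; apply/negP => s0.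
  have s12 : 0 < s / 12 by lra.
  have [n Hn] : exists n, 2^-1 ^+ n < s / 12.
    have /cvgrPdist_lt /(_ _ s12) [N _ HN] := @cvg_expr R 2^-1 ltac:(rewrite ger0_norm; lra).
    exists N; have := HN N (leqnn N); rewrite /= sub0r normrN.
    by apply: le_lt_trans; exact: ler_norm.
  by have := H n; lra.
exists z.
- rewrite -subr_le0; apply: small => n.
  have := cabs_triangle (u n) z c; have := ub n; have := uz n.
  rewrite [cabs (u n - z)]cabs_distC.
  have : 0 <= 2^-1 ^+ n :> R by rewrite exprn_ge0.
  lra.
- have zc : cabs (z - c) <= 1.
    rewrite -subr_le0; apply: small => n.
    have := cabs_triangle (u n) z c; have := ub n; have := uz n.
    rewrite [cabs (u n - z)]cabs_distC.
    have : 0 <= 2^-1 ^+ n :> R by rewrite exprn_ge0.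
    lra.
  apply/eqP; rewrite -subr_eq0 -cabs_eq0 eq_le cabs_ge0 andbT; apply: small => n.
  have := cabs_triangle (u n.+1) (G z) z.
  have := Gc _ _ zc (ub n); have := uz n; have := uz n.+1.
  rewrite -/(u n.+1) [cabs (z - _)]cabs_distC exprS.
  have : 0 <= 2^-1 ^+ n :> R by rewrite exprn_ge0.
  rewrite [cabs (G z - u n.+1)]/(cabs (G z - G (u n))).
  lra.
Qed.

Lemma csh_shift (z : C) (k : int) : exists e : C, [/\ cabs e = 1, e * e = 1 &
  csh (z + 0 +i* (k%:~R * pi)) = e * csh z].
Proof.
set w := 0 +i* _; exists (cexp w); have ee : cexp w * cexp w = 1.
  rewrite -cexpD (_ : w + w = 0 +i* (2 * k%:~R * pi)) ?cexp_period //.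
  by apply: complexP => /=; ring.
split => //; first by rewrite cabs_cexp /= expR0.
have -> : csh (z + w) = (cexp z * cexp w - cexp (- z) * cexp (- w)) / 2.
  by rewrite /csh opprD !cexpD.
have -> : cexp (- w) = cexp w.
  by rewrite -[LHS]mul1r -ee -mulrA cexpNK mulr1.
by rewrite /csh; field.
Qed.

Lemma csh_eq0 (z : C) : csh z = 0 <-> exists k : int, z = 0 +i* (k%:~R * pi).
Proof.
split=> [H|[k ->]].
- have E : cexp (2 * z) - 1 = 2 * cexp z * csh z.
    rewrite (_ : 2 * z = z + z); last by ring.
    rewrite cexpD -[X in _ - X](cexpNK z) /csh; by field.
  have : cexp (2 * z) = 1 by apply/eqP; rewrite -subr_eq0 E H mulr0.
  move=> /cexp_eq1[k Hk]; exists k.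
  have -> : z = 2 * z / 2 by field.
  rewrite Hk; have -> : (2 : C)^-1 = (2^-1 : R)%:C by rewrite fmorphV rmorphD.
  by apply: complexP => /=; field.
- have [e [_ _]] := csh_shift 0 k.
  by rewrite add0r csh0 mulr0.
Qed.
End FixedPoint.

Section Near2.
Variable R : realType.
Notation cabs := (@cabs R).
Notation C := R[i].

Lemma near2_all (x0 : C) (P : 'I_2 -> C -> C -> Prop) :
  (forall j, near2 x0 (P j)) -> near2 x0 (fun x y => forall j, P j x y).
Proof.
move=> H; move: (near2I (H ord0) (H ord_max)); apply: near2S => x y [H0 H1] j.
case: j => [[|[|//]] hj].
- by rewrite (_ : Ordinal hj = ord0) //; exact/val_inj.
- by rewrite (_ : Ordinal hj = ord_max) //; exact/val_inj.
Qed.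

Lemma I2_pair (D : R) (f : 'I_2 -> C) : D <= cabs (f ord0 - f ord_max) ->
  forall j j', j != j' -> D <= cabs (f j - f j').
Proof.
move=> H j j'.
have I2 (i : 'I_2) : i = ord0 \/ i = ord_max.
  by case: i => [[|[|//]] h]; [left|right]; exact/val_inj.
case: (I2 j) => ->; case: (I2 j') => ->; rewrite ?eqxx // => _.
by rewrite cabs_distC.
Qed.

Lemma tends_small (x0 : C) p d (s : R) : 0 < s -> tends x0 p d ->
  near2 x0 (fun x y => cabs (p x y - d) <= s).
Proof.
move=> s0 [K K0 HK]; have t0 : 0 < s / (K + 1) by rewrite divr_gt0 //; lra.
move: (near2I HK (near2_gap x0 t0)); apply: near2S => x y [H1 H2].
apply: le_trans H1 _; have := gap_ge0 x0 x y.
by move: H2; rewrite ler_pdivlMr; [nra|lra].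
Qed.
End Near2.

Section Roots.
Variable R : realType.
Notation cabs := (@cabs R).
Notation C := R[i].
Variables (b k1 k2 k3 k4 : R).
Hypothesis hb : 0 < b.
Hypothesis hyp : k1 <> k3 \/
  (forall k : nat, (0 < k)%N -> Num.sqrt b <> 2 * k%:R * pi).
Implicit Types (X l : C) (j : 'I_2).

Notation quad2 := (quad2 b k1%:C k2%:C k3%:C k4%:C).
Notation quad1 := (quad1 b k1%:C k2%:C k3%:C k4%:C).
Notation quad0 := (quad0 b k1%:C k2%:C k3%:C k4%:C).
Notation tau := (tau b k1 k2 k3 k4).
Notation EE := (offset b k1 k2 k3 k4).
Notation kappa := (kappa b k1 k2 k3 k4).
Notation tau0 := (tau0 b k1 k3).
Definition charfun l : C := chardet k1%:C k2%:C k3%:C k4%:C l (rootp b l) (rootm b l).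

(** One disk around X = 0 on which all these estimates hold: the roots stay
    separated because they are at X = 0, the others follow from the values at 0. *)
Lemma branch_props : exists m r L : R, [/\ 0 < m, 0 < r, 0 <= L &
  forall X Y, cabs X <= r -> cabs Y <= r ->
  [/\ cabs X <= inv_radius b, 1 / 2 <= cabs (quad2 X),
      forall j, cabs (X * tau j X) <= 1 / 8 /\ cabs (artanh (X * tau j X)) <= 1,
      forall j j', j != j' -> m <= cabs (tau j X - tau j' X) &
      forall j, cabs (EE j X - EE j Y) <= L * cabs (X - Y)]].
Proof.
have b0 := hb.
have X00 : 0 < inv_radius b by rewrite /inv_radius invr_gt0; lra.
have r0 := sqrt_dlt_gt0 hb hyp.
have N1 : near2 (0 : C) (fun x _ => cabs x <= inv_radius b).
  by exists (inv_radius b) => // x y; rewrite subr0.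
have N2 : near2 (0 : C) (fun x _ => 1 / 2 <= cabs (quad2 x)).
  have [tf _] := sdiff_tends (sdiff_quad2E b k1 k2 k3 k4).
  have f0 : quad2 0 != 0 by rewrite quad2_0E oner_neq0.
  by move: (tends_away f0 tf); rewrite quad2_0E cabs1; apply: near2S.
have sxt j := sdiffM (sdiff_id (0 : C)) (sdiff_tau k2 k4 hb hyp j).
have N3 : near2 (0 : C) (fun x _ => forall j, cabs (x * tau j x) <= 1 / 8).
  apply: near2_all => j; have [tt _] := sdiff_tends (sxt j).
  have s8 : 0 < 1 / 8 :> R by lra.
  by move: (tends_small s8 tt); apply: near2S => x y; rewrite mul0r subr0.
have N4 : near2 (0 : C) (fun x _ => forall j, cabs (artanh (x * tau j x)) <= 1).
  apply: near2_all => j.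
  have sa : sdiff (@artanh R) (0 * tau j 0) 1 by rewrite mul0r; exact: sdiff_artanh.
  have [tt _] := sdiff_tends (sdiff_comp (sxt j) sa).
  by move: (tends_small ltr01 tt); apply: near2S => x y; rewrite mul0r artanh0 subr0.
have N5 : near2 (0 : C) (fun x _ => forall j j', j != j' -> Num.sqrt (dlt b k1 k3) / 2 <= cabs (tau j x - tau j' x)).
  have [t1 _] := sdiff_tends (sdiff_tau k2 k4 hb hyp ord0).
  have [t2 _] := sdiff_tends (sdiff_tau k2 k4 hb hyp ord_max).
  have E : tau ord0 0 - tau ord_max 0 = (Num.sqrt (dlt b k1 k3))%:C.
    by rewrite !(tau0E _ _ hb hyp) -rmorphB /tau0 /sgn /=; congr (_%:C); field.
  have n0 : tau ord0 0 - tau ord_max 0 != 0.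
    by rewrite E -cabs_gt0 cabs_real normr_gt0 gt_eqF.
  move: (tends_away n0 (tendsD t1 (tendsN t2))); apply: near2S => x y.
  rewrite E cabs_real (ger0_norm (sqrtr_ge0 _)) => H.
  exact: (I2_pair (f := fun j => tau j x) H).
have c_ge0 i : 0 <= cabs (tau0 i - b / 8)%:C + 1.
  by apply: addr_ge0; [exact: cabs_ge0|exact: ler01].
pose L := \sum_j (cabs (tau0 j - b / 8)%:C + 1).
have Lj j : cabs (tau0 j - b / 8)%:C + 1 <= L.
  by rewrite /L (bigD1 j) //= lerDl sumr_ge0.
have N6 : near2 (0 : C) (fun x y => forall j, cabs (EE j x - EE j y) <= L * cabs (x - y)).
  apply: near2_all => j; move: (sdiff_lip (sdiff_offset k2 k4 hb hyp j)).
  by apply: near2S => x y H; apply: le_trans H _; rewrite ler_wpM2r ?cabs_ge0.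
have [r rp H] := near2I (near2I (near2I N1 N2) (near2I N3 N4)) (near2I N5 N6).
exists (Num.sqrt (dlt b k1 k3) / 2), r, L; split => //.
- exact: divr_gt0.
- by apply: sumr_ge0 => i _; exact: c_ge0.
move=> X Y hX hY; have := H X Y; rewrite !subr0 => /(_ hX hY) [[[h1 h2] [h3 h4]] [h5 h6]].
by split.
Qed.

Lemma cch_neq0 (T a : C) : csh a = T * cch a -> cch a != 0.
Proof.
move=> E; apply/eqP => c0; have := cchsh a; rewrite E c0 mulr0 expr0n /= subrr.
by move/esym/eqP; rewrite oner_eq0.
Qed.

(** Each factor l sinh(rho) - tau_j cosh(rho) of the quadratic polynomial is, with
    a = artanh(tau_j / l), equal to l sinh(rho - a) / cosh(a), and rho - a is
    l minus the offset. *)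
Lemma charfun_factor l j j' : l != 0 -> cabs l^-1 <= inv_radius b -> quad2 l^-1 != 0 -> j != j' ->
  (forall i, cabs (l^-1 * tau i l^-1) <= 1 / 8) ->
  charfun l = l ^+ 3 * quad2 l^-1 * csh (l - EE j l^-1) * csh (l - EE j' l^-1)
    / (cch (artanh (l^-1 * tau j l^-1)) * cch (artanh (l^-1 * tau j' l^-1))).
Proof.
move=> l0 hX fn jj hT.
have [r10 r20] := root_neq0 hb l0 hX.
rewrite /charfun (chardet_quadratic hb) //; last exact: Pi_neq0.
have key i : l * csh (rho b l) - tau i l^-1 * cch (rho b l) =
    l * csh (l - EE i l^-1) / cch (artanh (l^-1 * tau i l^-1)).
  have [_ ca] := artanhK (hT i).
  set T := l^-1 * tau i l^-1 in ca *; set a := artanh T in ca *.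
  have cn := cch_neq0 ca.
  have -> : l - EE i l^-1 = rho b l - a by rewrite (rho_gg _ l0) /offset -/T -/a; ring.
  rewrite cshD cshN cchN ca.
  have -> : tau i l^-1 = l * T by rewrite /T mulVKf.
  by field.
set S := csh (rho b l) in key *; set Co := cch (rho b l) in key *.
have -> : quad2 l^-1 * (l * S) ^+ 2 + quad1 l^-1 * (l * S) * Co + quad0 l^-1 * Co ^+ 2 =
    quad2 l^-1 * (l * S - tau j l^-1 * Co) * (l * S - tau j' l^-1 * Co).
  have F t : quad2 l^-1 * t ^+ 2 + quad1 l^-1 * t + quad0 l^-1 =
     quad2 l^-1 * (t - tau j l^-1) * (t - tau j' l^-1) := quad_factor t fn jj.
  have F0 := F 0; have F1 := F 1; have F2 := F (-1).
  have E0 : quad0 l^-1 = quad2 l^-1 * (tau j l^-1 * tau j' l^-1).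
    by move: F0; rewrite expr0n /= !mulr0 !add0r => ->; ring.
  have E1 : quad1 l^-1 = - quad2 l^-1 * (tau j l^-1 + tau j' l^-1).
    have -> : quad1 l^-1 = (quad2 l^-1 * 1 ^+ 2 + quad1 l^-1 * 1 + quad0 l^-1) - quad2 l^-1 - quad0 l^-1 by ring.
    by rewrite F1 E0; ring.
  by rewrite E0 E1; ring.
rewrite !key.
have [_ c1] := artanhK (hT j); have [_ c2'] := artanhK (hT j').
have n1 := cch_neq0 c1; have n2 := cch_neq0 c2'.
by field; rewrite n1 n2.
Qed.
End Roots.

(** * Location and asymptotics of the large characteristic roots *)

Section LargeRoots.
Variable R : realType.
Notation cabs := (@cabs R).
Notation C := R[i].
Variables (b k1 k2 k3 k4 : R).
Hypothesis hb : 0 < b.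
Hypothesis hyp : k1 <> k3 \/
  (forall k : nat, (0 < k)%N -> Num.sqrt b <> 2 * k%:R * pi).
Implicit Types (X l z w : C) (j : 'I_2) (k : int).

Notation quad2 := (quad2 b k1%:C k2%:C k3%:C k4%:C).
Notation tau := (tau b k1 k2 k3 k4).
Notation EE := (offset b k1 k2 k3 k4).
Notation kappa := (kappa b k1 k2 k3 k4).
Notation tau0 := (tau0 b k1 k3).
Notation chi := (charfun b k1 k2 k3 k4).

Definition ikpi k : C := 0 +i* (k%:~R * pi).

Lemma cabs_ikpi k : cabs (ikpi k) = `|k|%N%:R * pi.
Proof.
rewrite cabsE /= expr0n /= add0r sqrtr_sqr normrM (ger0_norm (pi_ge0 R)).
by rewrite -intr_norm -abszE -pmulrn.
Qed.

Lemma ikpiB k k' : ikpi k - ikpi k' = ikpi (k - k').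
Proof. by rewrite /ikpi rmorphB; apply: complexP => /=; ring. Qed.

(** The statement of [branch_props] in terms of l rather than 1/l: M is a lower
    bound on the moduli, L the Lipschitz constant of the offsets, m the separation
    of the branches. *)
Definition large (M L m : R) := forall z w, M <= cabs z -> M <= cabs w ->
  [/\ z != 0 /\ cabs z^-1 <= inv_radius b, 1 / 2 <= cabs (quad2 z^-1),
      forall j, cabs (z^-1 * tau j z^-1) <= 1 / 8 /\
                cabs (artanh (z^-1 * tau j z^-1)) <= 1,
      forall j j', j != j' -> m <= cabs (tau j z^-1 - tau j' z^-1) &
      forall j, [/\ cabs (EE j z^-1 - EE j w^-1) <= 2^-1 * cabs (z - w),
                    cabs (EE j z^-1) <= L * cabs z^-1 & cabs (EE j z^-1) <= 1 / 2]].

Lemma large_exists : exists M L m : R, [/\ 1 <= M, 0 <= L, 0 < m & large M L m].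
Proof.
have [m [r [L [m0 r0 L0 H]]]] := branch_props k2 k4 hb hyp.
(* 1/r makes 1/z small enough; 2L makes the offset, of Lipschitz constant L in
   1/z, 1/2-Lipschitz in z and at most 1/2. *)
pose M := r^-1 + 2 * L + 1.
have ri : 0 < r^-1 by rewrite invr_gt0.
have M1 : 1 <= M by rewrite /M; lra.
have ML : L <= M / 2 by rewrite /M; lra.
exists M, L, m; split => // z w hz hw.
have inv u : M <= cabs u -> [/\ u != 0, cabs u^-1 <= r & cabs u^-1 * M <= 1].
  move=> hu; have u0 : 0 < cabs u by lra.
  have un : u != 0 by rewrite -cabs_gt0.
  split => //; rewrite cabsV.
  - rewrite -[leRHS]invrK lef_pV2 ?posrE //; apply: le_trans hu; rewrite /M; lra.
  - by rewrite mulrC ler_pdivrMr // mul1r.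
have [z0 zr zM] := inv z hz; have [w0 wr wM] := inv w hw.
have [h1 h2 h3 h4 h5] := H _ _ zr wr.
have zp := cabs_ge0 z^-1; have wp := cabs_ge0 w^-1; have zwp := cabs_ge0 (z - w).
have E0 j : cabs (EE j z^-1) <= L * cabs z^-1.
  have c0 : cabs (0 : C) <= r by rewrite cabs0 ltW.
  have [_ _ _ _ /(_ j)] := H _ _ zr c0; by rewrite offset0 !subr0.
split => // j; split => //.
- apply: le_trans (h5 j) _.
  have -> : z^-1 - w^-1 = - (z - w) * (z^-1 * w^-1) by field; rewrite z0 w0.
  rewrite cabsM cabsN cabsM.
  have : L * (cabs z^-1 * cabs w^-1) <= 2^-1.
    have : L * (cabs z^-1 * cabs w^-1) <= M / 2 * (cabs z^-1 * cabs w^-1).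
      by rewrite ler_wpM2r // mulr_ge0.
    have : M * cabs z^-1 * cabs w^-1 <= 1 * cabs w^-1 by rewrite ler_wpM2r // mulrC.
    have : cabs w^-1 * 1 <= cabs w^-1 * M by rewrite ler_wpM2l.
    lra.
  nra.
- apply: le_trans (E0 j) _.
  have : L * cabs z^-1 <= M / 2 * cabs z^-1 by rewrite ler_wpM2r.
  lra.
Qed.

Lemma other_branch j : exists j', j != j'.
Proof.
by case: (eqVneq j ord0) => [->|h]; [exists ord_max|exists ord0].
Qed.

Section Fixed.
Variables (M L m : R).
Hypothesis (M1 : 1 <= M) (L0 : 0 <= L) (m0 : 0 < m) (H : large M L m).

Lemma csh_center z k : cabs (csh (z + ikpi k)) = cabs (csh z).
Proof. by have [e [e1 _ ->]] := csh_shift z k; rewrite cabsM e1 mul1r. Qed.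

(** The zeros of sinh are the multiples of i pi. *)
Lemma chi_eq0 l : M <= cabs l ->
  chi l = 0 <-> exists j k, l = ikpi k + EE j l^-1.
Proof.
move=> hl; have [[l0 hX] hfa h3 h4 h5] := H hl hl.
have fn : quad2 l^-1 != 0 by rewrite -cabs_gt0; lra.
have h8 i := (h3 i).1.
have S j : csh (l - EE j l^-1) = 0 <-> exists k, l = ikpi k + EE j l^-1.
  rewrite csh_eq0; split => -[k E]; exists k.
    by rewrite /ikpi -E subrK.
  by rewrite {1}E addrK.
split=> [|[j [k E]]].
- rewrite (charfun_factor hb l0 hX fn (isT : ord0 != ord_max :> 'I_2) h8).
  have [_ c1] := artanhK (h8 ord0); have [_ c2'] := artanhK (h8 ord_max).
  have n1 := cch_neq0 c1; have n2 := cch_neq0 c2'.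
  have n : (cch (artanh (l^-1 * tau ord0 l^-1)) * cch (artanh (l^-1 * tau ord_max l^-1)))^-1 != 0.
    by rewrite invr_neq0 // mulf_neq0.
  move/eqP; rewrite mulf_eq0 (negbTE n) orbF mulf_eq0 mulf_eq0 mulf_eq0.
  rewrite expf_eq0 (negbTE l0) (negbTE fn) andbF /= => /orP[/eqP|/eqP] /S [k E].
    by exists ord0, k.
  by exists ord_max, k.
- have [j' jj] := other_branch j.
  have Z : csh (l - EE j l^-1) = 0 by apply/S; exists k.
  by rewrite (charfun_factor hb l0 hX fn jj h8) Z mulr0 !mul0r.
Qed.

Lemma near_center k (s : R) : s < 2 -> cabs (ikpi k) <= s -> k = 0.
Proof.
rewrite cabs_ikpi => s2 h; apply/eqP; rewrite -absz_eq0 -leqn0 leqNgt.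
apply/negP => k0; have : 1 <= `|k|%N%:R :> R by rewrite ler1n.
have := pi_ge2 R; nra.
Qed.

(** Offsets are at most 1/2 in modulus, so l determines k. The two offsets being
    equal, so are tau_j and tau_j', which are separated for distinct branches. *)
Lemma location_inj l j k j' k' : M <= cabs l ->
  l = ikpi k + EE j l^-1 -> l = ikpi k' + EE j' l^-1 -> j = j' /\ k = k'.
Proof.
move=> hl E E'; have [[l0 hX] hfa h3 h4 h5] := H hl hl.
have [_ _ e1] := h5 j; have [_ _ e2] := h5 j'.
have D : ikpi (k - k') = EE j' l^-1 - EE j l^-1.
  have E2 : ikpi k + EE j l^-1 = ikpi k' + EE j' l^-1 by rewrite -E -E'.
  rewrite -ikpiB -[ikpi k](addrK (EE j l^-1)) E2; ring.
have kk : k - k' = 0.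
  apply: (@near_center _ 1); first by lra.
  rewrite D; have := cabsB (EE j' l^-1) (EE j l^-1); lra.
split; last by apply/eqP; rewrite -subr_eq0 kk.
have {D kk} eE : EE j l^-1 = EE j' l^-1.
  apply/eqP; rewrite eq_sym -subr_eq0 -D kk /ikpi mul0r; exact/eqP.
apply/eqP; apply/negPn/negP => jj.
have m0' := m0; have := h4 _ _ jj; suff -> : tau j l^-1 = tau j' l^-1 by rewrite subrr cabs0; lra.
have [_ c1] := artanhK (h3 j).1; have [_ c2'] := artanhK (h3 j').1.
have aa : artanh (l^-1 * tau j l^-1) = artanh (l^-1 * tau j' l^-1).
  by move: eE; rewrite /offset => /(congr1 (fun t => t + l^-1 * gg b l^-1)); rewrite !subrK.
have n1 := cch_neq0 c1.
move: c1 n1; rewrite aa c2' => /esym c1 n1.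
have := mulIf n1 c1; exact: (mulfI (invr_neq0 l0)).
Qed.

Lemma root_unique l l' j k : M <= cabs l -> M <= cabs l' ->
  l = ikpi k + EE j l^-1 -> l' = ikpi k + EE j l'^-1 -> l = l'.
Proof.
move=> hl hl' E E'; have [_ _ _ _ /(_ j) [h _ _]] := H hl hl'.
apply/eqP; rewrite -subr_eq0 -cabs_eq0; have := cabs_ge0 (l - l').
suff : cabs (l - l') <= 2^-1 * cabs (l - l') by move=> a c; apply/eqP; lra.
apply: le_trans _ h; rewrite {1}E {1}E' (_ : _ - _ = EE j l^-1 - EE j l'^-1) //; ring.
Qed.

(** For large k the map z -> i k pi + E_j(1/z) is a contraction of the unit disk
    around i k pi. *)
Lemma root_exists j k : M + 1 <= `|k|%N%:R ->
  exists l, [/\ l = ikpi k + EE j l^-1, 2 * M + 1 <= cabs l &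
                cabs (ikpi k) / 2 <= cabs l].
Proof.
move=> hk; have p2 := pi_ge2 R; have M1' := M1.
have ck : 2 * M + 2 <= cabs (ikpi k) by rewrite cabs_ikpi; nra.
have ball z : cabs (z - ikpi k) <= 1 -> M <= cabs z.
  move=> hz; have := cabs_triangle z (ikpi k) 0; rewrite !subr0.
  by rewrite [cabs (ikpi k - z)]cabs_distC; lra.
have self z : cabs (z - ikpi k) <= 1 -> cabs (ikpi k + EE j z^-1 - ikpi k) <= 1.
  move=> hz; have [_ _ _ _ /(_ j) [_ _ h]] := H (ball _ hz) (ball _ hz).
  by rewrite addrAC subrr add0r; lra.
have half z w : cabs (z - ikpi k) <= 1 -> cabs (w - ikpi k) <= 1 ->
    cabs (ikpi k + EE j z^-1 - (ikpi k + EE j w^-1)) <= 2^-1 * cabs (z - w).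
  move=> hz hw; have [_ _ _ _ /(_ j) [h _ _]] := H (ball _ hz) (ball _ hw).
  by rewrite opprD addrACA subrr add0r.
have [l hl El] := contraction_fixed_point self half.
exists l; split; first by rewrite El.
- have [_ _ _ _ /(_ j) [_ _ h]] := H (ball _ hl) (ball _ hl).
  have := cabs_lower (ikpi k) (EE j l^-1); rewrite El; lra.
- have := cabs_lower (ikpi k) (l - ikpi k); rewrite (addrC _ (_ - _)) subrK.
  lra.
Qed.

(** A lower bound of the determinant at nearby admissible parameters, linear in the
    distance: the zero is simple. *)
Definition isolated_zero l := exists c h0 : R, [/\ 0 < c, 0 < h0 & forall h,
  cabs h <= h0 -> [/\ l + h != 0, cabs (l + h)^-1 <= inv_radius b & c * cabs h <= cabs (chi (l + h))]].

Lemma csh_lower z : 64 * expR 1 * cabs z <= 1 -> cabs z / 2 <= cabs (csh z).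
Proof.
move=> hz; have K1 : 1 <= expR 1 :> R by rewrite -expR0 ler_expR.
have z0 := cabs_ge0 z; have z1 : cabs z <= 1 by nra.
have z3 : 8 * expR 1 * cabs z ^+ 3 <= cabs z / 2.
  have : cabs z ^+ 2 <= cabs z by nra.
  have -> : 8 * expR 1 * cabs z ^+ 3 = cabs z * (8 * expR 1 * cabs z ^+ 2) by ring.
  nra.
have := csh_cubic z1; have := cabs_lower z (csh z - z); rewrite (addrC _ (_ - _)) subrK; lra.
Qed.

Lemma product_lower (K q x l f s1 s2 d1 d2 : R) : 1 <= K -> 0 <= q -> 0 <= x ->
  1 <= l -> 1 / 2 <= f -> x / 4 <= s1 -> q / 2 <= s2 -> 0 < d1 <= K -> 0 < d2 <= K ->
  q / 2 / (8 * K ^+ 2) * x <= l ^+ 3 * f * s1 * s2 * (d1 * d2)^-1.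
Proof.
move=> K1 q0 x0 l1 hf F1 F2 /andP[d10 d1K] /andP[d20 d2K].
have l3 : 1 <= l ^+ 3 by rewrite exprn_ege1.
have K2 : 0 < K ^+ 2 by rewrite exprn_gt0 //; lra.
have dd : (K ^+ 2)^-1 <= (d1 * d2)^-1.
  rewrite lef_pV2 ?posrE //; last exact: mulr_gt0.
  by rewrite expr2; apply: ler_pM => //; exact: ltW.
have -> : q / 2 / (8 * K ^+ 2) * x = 1 * (1 / 2) * (x / 4) * (q / 2) * (K ^+ 2)^-1.
  by field; lra.
have p2 : 0 <= (1 * (1 / 2) : R) by lra.
have p3 : 0 <= x / 4 by lra.
have p4 : 0 <= q / 2 by lra.
have p5 : 0 <= (K ^+ 2)^-1 by rewrite invr_ge0 ltW.
apply: (ler_pM (mulr_ge0 (mulr_ge0 p2 p3) p4) p5 _ dd).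
apply: (ler_pM (mulr_ge0 p2 p3) p4 _ F2); apply: (ler_pM p2 p3 _ F1).
by apply: ler_pM => //; lra.
Qed.

Lemma csh_quarter z h : 128 * expR 1 * cabs h <= 1 -> cabs h / 2 <= cabs z ->
  cabs z <= 2 * cabs h -> cabs h / 4 <= cabs (csh z).
Proof.
move=> hh z1 z2; have K0 : 0 < expR 1 :> R by exact: expR_gt0.
have e3 : 64 * expR 1 * cabs z <= 1 by nra.
have := csh_lower e3; lra.
Qed.

Lemma perturb_bounds (h d : C) : cabs d <= cabs h / 2 ->
  cabs h / 2 <= cabs (h - d) <= 2 * cabs h.
Proof.
move=> hd; have := cabs_lower h (- d); have := cabsB h d; have := cabs_ge0 h.
by rewrite cabsN => ? ? ?; apply/andP; split; lra.
Qed.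

(** In the factorization, sinh(l - E_j(1/l)) vanishes at the root and is at least
    |h|/4 at distance h, because the offset is 1/2-Lipschitz. The factor of the
    other branch does not vanish at the root, by [location_inj], and the remaining
    ones are bounded below. *)
Lemma simple_zero l j k : 2 * M + 1 <= cabs l -> l = ikpi k + EE j l^-1 ->
  isolated_zero l.
Proof.
move=> hl El; have M1' := M1; have hl' : M <= cabs l by lra.
have [j' jj] := other_branch j.
have [[l0 hX] hfa h3 h4 h5] := H hl' hl'.
set A := l - EE j' l^-1.
have A0 : csh A != 0.
  apply/eqP => /csh_eq0[k' E].
  have E' : l = ikpi k' + EE j' l^-1 by rewrite /ikpi -E subrK.
  by have [e _] := location_inj hl' El E'; rewrite e eqxx in jj.
have g0 : 0 < cabs (csh A) by rewrite cabs_gt0.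
have [tA _] := sdiff_tends (sdiff_csh A).
have [rA rA0 HA] := tends_away A0 tA.
have K1 : 1 <= expR 1 :> R by rewrite -expR0 ler_expR.
pose K : R := expR 1.
have K1' : 1 <= K by [].
(* The first bound makes sinh comparable to its argument, the second one keeps
   the other factor away from 0. *)
pose h0 : R := Num.min (128 * K)^-1 (rA / 2).
have Ki : 0 < (128 * K)^-1 by rewrite invr_gt0; lra.
have h00 : 0 < h0 by rewrite lt_min Ki; lra.
pose c : R := (cabs (csh A) / 2) / (8 * K ^+ 2).
have K2 : 0 < 8 * K ^+ 2 by nra.
have c0 : 0 < c by apply: divr_gt0; lra.
exists c, h0; split => // h hh.
have hh1 : 128 * K * cabs h <= 1.
  have : cabs h <= (128 * K)^-1 by apply: le_trans hh _; rewrite ge_min lexx.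
  by rewrite -[leRHS]mul1r ler_pdivlMr ?(mulrC _ (128 * K)) //; lra.
have hhA : cabs h <= rA / 2 by apply: le_trans hh _; rewrite ge_min lexx orbT.
have hp := cabs_ge0 h; have hle1 : cabs h <= 1 by nra.
set l' := l + h.
have hM : M <= cabs l' by have := cabs_lower l h; rewrite -/l'; lra.
have [[l0' hX'] hfa' h3' h4' h5'] := H hM hl'.
have dl : l' - l = h by rewrite /l' addrAC subrr add0r.
have D i : cabs (EE i l'^-1 - EE i l^-1) <= cabs h / 2.
  by have [d _ _] := h5' i; rewrite dl in d; lra.
split => //.
have fn : quad2 l'^-1 != 0 by rewrite -cabs_gt0; lra.
rewrite (charfun_factor hb l0' hX' fn jj (fun i => (h3' i).1)).
have den i : 0 < cabs (cch (artanh (l'^-1 * tau i l'^-1))) <= K.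
  have [h8 ha] := h3' i; have [_ c1] := artanhK h8; have n1 := cch_neq0 c1.
  move: n1 ha; set a := artanh _ => n1 ha.
  apply/andP; split; first by rewrite cabs_gt0.
  by apply: le_trans (cch_bound a) _; rewrite ler_expR.
have F1 : cabs h / 4 <= cabs (csh (l' - EE j l'^-1)).
  set e := h - (EE j l'^-1 - EE j l^-1).
  have -> : l' - EE j l'^-1 = e + ikpi k.
    have -> : ikpi k = l - EE j l^-1 by rewrite {1}El addrK.
    rewrite /e -dl; ring.
  rewrite csh_center.
  have /andP[e1 e2] := perturb_bounds (D j); rewrite -/e in e1 e2.
  exact: csh_quarter hh1 e1 e2.
have F2 : cabs (csh A) / 2 <= cabs (csh (l' - EE j' l'^-1)).
  apply: (HA (l' - EE j' l'^-1) A); last by rewrite subrr cabs0 ltW.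
  have -> : l' - EE j' l'^-1 - A = h - (EE j' l'^-1 - EE j' l^-1).
    rewrite /A -dl; ring.
  have /andP[_ le2] := perturb_bounds (D j').
  by apply: le_trans le2 _; rewrite mulrC -ler_pdivlMr.
move: (den j) (den j') F1 F2 hfa'.
set D1 := cch _; set D2 := cch _; set S1 := csh _; set S2 := csh (l' - _); set f := quad2 _.
have -> : cabs (l' ^+ 3 * f * S1 * S2 / (D1 * D2)) =
    cabs l' ^+ 3 * cabs f * cabs S1 * cabs S2 * (cabs D1 * cabs D2)^-1.
  by rewrite cabsM cabsV [cabs (D1 * D2)]cabsM 3!cabsM cabsX.
move: (cabs f) (cabs S1) (cabs S2) (cabs D1) (cabs D2) => f' s1 s2 d1 d2.
move=> den1 den2 F1 F2 hf.
exact: product_lower K1' (cabs_ge0 _) hp (le_trans M1' hM) hf F1 F2 den1 den2.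
Qed.


(** Replacing 1/l by 1/(i k pi) in the expansion of the offset changes it by
    O(k^-3), since l - i k pi = O(1/k). *)
Lemma root_asymptotics j : exists K r : R, [/\ 0 <= K, 0 < r & forall l k,
  M <= cabs l -> l = ikpi k + EE j l^-1 -> cabs (ikpi k) / 2 <= cabs l ->
  r^-1 <= cabs (ikpi k) ->
  cabs (l - (ikpi k + (tau0 j - b / 8)%:C * (ikpi k)^-1 + (kappa j)%:C * (ikpi k)^-1 ^+ 2))
    <= K * (cabs (ikpi k))^-1 ^+ 3].
Proof.
have [K [r [K0 r0 HK]]] := offset_expansion k2 k4 hb hyp j.
have L0' := L0; have M1' := M1.
set A := (tau0 j - b / 8)%:C in HK *; set B := (kappa j)%:C in HK *.
have A0 := cabs_ge0 A; have B0 := cabs_ge0 B.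
exists (8 * K + 4 * L * cabs A + 12 * L * cabs B), (Num.min 1 (r / 2)); split.
- by rewrite !addr_ge0 // ?mulr_ge0 //; lra.
- by rewrite lt_min ltr01; lra.
move=> l k hl El hlk hr; set c := ikpi k in El hlk hr *.
have ri : 0 < Num.min 1 (r / 2) by rewrite lt_min ltr01; lra.
have cp : 0 < cabs c by apply: lt_le_trans hr; rewrite invr_gt0.
have cn : c != 0 by rewrite -cabs_gt0.
have Zr : cabs c^-1 <= Num.min 1 (r / 2).
  by rewrite cabsV -[leRHS]invrK lef_pV2 ?posrE // invr_gt0.
have Z1 : cabs c^-1 <= 1 by apply: le_trans Zr _; rewrite ge_min lexx.
have Z2 : cabs c^-1 <= r / 2 by apply: le_trans Zr _; rewrite ge_min lexx orbT.
have [[l0 _] _ _ _ /(_ j) [_ EL _]] := H hl hl.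
have XZ : cabs l^-1 <= 2 * cabs c^-1.
  have -> : 2 * cabs c^-1 = (cabs c / 2)^-1 by rewrite cabsV; field; rewrite gt_eqF.
  rewrite cabsV lef_pV2 ?posrE //; first by rewrite cabs_gt0.
  by rewrite divr_gt0.
have hX : cabs l^-1 <= r by lra.
have Xp := cabs_ge0 l^-1; have Zp := cabs_ge0 c^-1.
have dXZ : cabs (l^-1 - c^-1) <= 4 * L * cabs c^-1 ^+ 3.
  have -> : l^-1 - c^-1 = - EE j l^-1 * (l^-1 * c^-1).
    have -> : EE j l^-1 = l - c by rewrite {2}El; ring.
    by field; rewrite l0 cn.
  rewrite !cabsM cabsN.
  apply: (@le_trans _ _ (L * cabs l^-1 * (cabs l^-1 * cabs c^-1))).
    by rewrite ler_wpM2r // mulr_ge0.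
  have -> : 4 * L * cabs c^-1 ^+ 3 = L * (2 * cabs c^-1) * ((2 * cabs c^-1) * cabs c^-1) by ring.
  have LX : L * cabs l^-1 <= L * (2 * cabs c^-1) by rewrite ler_wpM2l.
  have XZZ : cabs l^-1 * cabs c^-1 <= 2 * cabs c^-1 * cabs c^-1 by rewrite ler_wpM2r.
  by apply: ler_pM => //; rewrite mulr_ge0.
have dXZ2 : cabs (l^-1 ^+ 2 - c^-1 ^+ 2) <= 12 * L * cabs c^-1 ^+ 3.
  rewrite subr_sqr cabsM.
  have s3 : cabs (l^-1 + c^-1) <= 3 by have := cabsD l^-1 c^-1; lra.
  have -> : 12 * L * cabs c^-1 ^+ 3 = 4 * L * cabs c^-1 ^+ 3 * 3 by ring.
  by apply: ler_pM => //; exact: cabs_ge0.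
have E3 : K * cabs l^-1 ^+ 3 <= 8 * K * cabs c^-1 ^+ 3.
  have -> : 8 * K * cabs c^-1 ^+ 3 = K * (2 * cabs c^-1) ^+ 3 by ring.
  rewrite ler_wpM2l // lerXn2r // nnegrE; lra.
have -> : l - (c + A * c^-1 + B * c^-1 ^+ 2) =
   (EE j l^-1 - A * l^-1 - B * l^-1 ^+ 2) + (A * (l^-1 - c^-1) + B * (l^-1 ^+ 2 - c^-1 ^+ 2)).
  rewrite {1}El; ring.
rewrite -cabsV; have := cabsD (EE j l^-1 - A * l^-1 - B * l^-1 ^+ 2)
   (A * (l^-1 - c^-1) + B * (l^-1 ^+ 2 - c^-1 ^+ 2)).
have := cabsD (A * (l^-1 - c^-1)) (B * (l^-1 ^+ 2 - c^-1 ^+ 2)).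
have := HK _ hX; rewrite !cabsM.
have tA : cabs A * cabs (l^-1 - c^-1) <= cabs A * (4 * L * cabs c^-1 ^+ 3) by rewrite ler_wpM2l.
have tB : cabs B * cabs (l^-1 ^+ 2 - c^-1 ^+ 2) <= cabs B * (12 * L * cabs c^-1 ^+ 3) by rewrite ler_wpM2l.
lra.
Qed.
End Fixed.

Lemma ikpi_expansion (x A B : R) (c := 0 +i* (x * pi) : C) : x != 0 ->
  c + A%:C * c^-1 + B%:C * c^-1 ^+ 2 =
  (- (B / pi ^+ 2 / x ^+ 2)) +i* (x * pi + - A / pi / x).
Proof.
have pin : pi != 0 :> R by rewrite gt_eqF // pi_gt0.
rewrite /c; move: (pi : R) pin => q qn xn.
have n0 : 0 +i* (x * q) != 0 :> C by rewrite eq_complex /= eqxx /= mulf_neq0.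
have -> : (0 +i* (x * q) : C)^-1 = 0 +i* (- (x * q)^-1).
  apply: (mulfI n0); rewrite mulfV //; apply: complexP => /=; last by ring.
  by field; rewrite qn xn.
by rewrite expr2; apply: complexP => /=; field; rewrite qn xn.
Qed.

Lemma cubic_le_quadratic (K eps n : R) : 0 <= K -> 0 < eps -> 1 <= n -> K / eps <= n ->
  K * (n * pi)^-1 ^+ 3 <= eps / n ^+ 2.
Proof.
move=> K0 e0 n1 Kn; have pi2 := pi_ge2 R.
have hK : K <= eps * n by rewrite -ler_pdivrMl // mulrC.
apply: (@le_trans _ _ (K * n^-1 ^+ 3)).
  apply: ler_wpM2l => //; apply: lerXn2r; rewrite ?nnegrE ?invr_ge0; [nra|lra|].
  rewrite lef_pV2 ?posrE; nra.
have -> : eps / n ^+ 2 = eps * n * n^-1 ^+ 3 by field; lra.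
apply: ler_wpM2r => //; apply: exprn_ge0; rewrite invr_ge0; lra.
Qed.

(** A root of large modulus satisfies one of the fixed point equations with a large
    k, hence is the unique solution found by contraction. *)
Theorem large_roots : exists (k0 : nat) (lam : 'I_2 -> int -> C), [/\
  forall j k, (k0 <= `|k|)%N -> chi (lam j k) = 0 /\ isolated_zero (lam j k),
  forall j k j' k', (k0 <= `|k|)%N -> (k0 <= `|k'|)%N ->
    lam j k = lam j' k' -> j = j' /\ k = k',
  exists M : R, forall l, M <= cabs l -> [/\ l != 0, cabs l^-1 <= inv_radius b &
    chi l = 0 -> exists j k, (k0 <= `|k|)%N /\ l = lam j k] &
  forall j, o_inv_sq (fun k => lam j k -
    ((- (kappa j / pi ^+ 2 / k%:~R ^+ 2))
       +i* (k%:~R * pi + (b / 8 - tau0 j) / pi / k%:~R)))].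
Proof.
have [M [L [m [M1 L0 m0 H]]]] := large_exists.
have pi2 := pi_ge2 R; have pin : pi != 0 :> R by rewrite gt_eqF //; lra.
pose k0 := (Num.truncn (M + 1)).+1.
have hk0 : M + 1 <= k0%:R by apply/ltW; rewrite truncnS_gt.
have big k : (k0 <= `|k|)%N -> M + 1 <= `|k|%N%:R :> R.
  by move=> h; apply: le_trans hk0 _; rewrite ler_nat.
have ex (q : 'I_2 * int) : exists l, (k0 <= `|q.2|)%N -> [/\ l = ikpi q.2 + EE q.1 l^-1,
     2 * M + 1 <= cabs l & cabs (ikpi q.2) / 2 <= cabs l].
  case: (boolP (k0 <= `|q.2|)%N) => [h|_]; last by exists 0.
  have [l hl] := root_exists M1 H q.1 (big _ h); by exists l.
have [f Hf] := choice ex; pose lam j k := f (j, k).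
have Hlam j k : (k0 <= `|k|)%N -> [/\ lam j k = ikpi k + EE j (lam j k)^-1,
     2 * M + 1 <= cabs (lam j k) & cabs (ikpi k) / 2 <= cabs (lam j k)] := Hf (j, k).
exists k0, lam; split.
- move=> j k hk; have [E hl _] := Hlam j k hk; split.
  + by apply/(chi_eq0 H); [lra|exists j, k].
  + exact: (simple_zero M1 m0 H hl E).
- move=> j k j' k' hk hk' e; have [E hl _] := Hlam j k hk.
  have [E' _ _] := Hlam j' k' hk'; rewrite -e in E'.
  by apply: (location_inj m0 H _ E E'); lra.
(* |l| <= |k| pi + 1/2 and pi < 4, so this modulus forces |k| >= k0. *)
- exists (M + 4 * k0%:R) => l hl; have hM : M <= cabs l by have : 0 <= k0%:R :> R by []; lra.
  have [[l0 hX] _ _ _ h5] := H _ _ hM hM; split => //.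
  move=> /(chi_eq0 H hM) [j [k E]]; exists j, k.
  have hk : (k0 <= `|k|)%N.
    have [_ _ e1] := h5 j.
    have := cabsD (ikpi k) (EE j l^-1); rewrite -E cabs_ikpi => hk.
    have p4 : pi < 4 :> R by have := pihalf_lt2 R; lra.
    rewrite leqNgt; apply/negP => hlt.
    have : `|k|%N%:R <= k0%:R :> R by rewrite ler_nat ltnW.
    have : 0 <= `|k|%N%:R :> R by [].
    nra.
  split => //; have [E' hl' _] := Hlam j k hk.
  by apply: (root_unique H hM _ E E'); lra.
- move=> j; have [K [r [K0 r0 HK]]] := root_asymptotics M1 L0 H j.
  move=> eps e0.
  pose N := (Num.truncn (r^-1 + K / eps)).+1.
  have hN : r^-1 + K / eps <= N%:R by apply/ltW; rewrite truncnS_gt.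
  have ri : 0 < r^-1 by rewrite invr_gt0.
  have Ke : 0 <= K / eps by rewrite divr_ge0 // ltW.
  exists (maxn k0 N) => k kp; rewrite geq_max => /andP[hk hkN].
  have hkN' : r^-1 + K / eps <= `|k|%N%:R by apply: le_trans hN _; rewrite ler_nat.
  have [E hl hlk] := Hlam j k hk.
  have kR0 : 1 <= `|k|%N%:R :> R by rewrite ler1n.
  have kn : k%:~R != 0 :> R by rewrite intr_eq0 -absz_eq0 -lt0n.
  have hM : M <= cabs (lam j k) by lra.
  have hr : r^-1 <= cabs (ikpi k) by rewrite cabs_ikpi; nra.
  have := HK _ _ hM E hlk hr.
  have -> : ikpi k + (tau0 j - b / 8)%:C * (ikpi k)^-1 + (kappa j)%:C * (ikpi k)^-1 ^+ 2 =
    (- (kappa j / pi ^+ 2 / k%:~R ^+ 2)) +i* (k%:~R * pi + (b / 8 - tau0 j) / pi / k%:~R).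
    rewrite (ikpi_expansion (tau0 j - b / 8) (kappa j) kn); congr (_ +i* (_ + _ / _)).
    by rewrite opprB.
  set D := lam j k - _ => hD; rewrite norm_cabs lecR; apply: le_trans hD _.
  rewrite cabs_ikpi.
  have -> : k%:~R ^+ 2 = `|k|%N%:R ^+ 2 :> R.
    by rewrite -(real_normK (num_real k%:~R)) -intr_norm -abszE -pmulrn.
  by apply: cubic_le_quadratic => //; lra.
Qed.
End LargeRoots.

(** * From the energy space to the first order system *)

Section Bridge.
Variable R : realType.
Notation mu := (@lebesgue_measure R).
Notation Omega := (`]0, 1[%classic : set R).
Notation cabs := (@cabs R).
Notation C := R[i].
Notation cRe := (@complex.Re R).
Notation cIm := (@complex.Im R).
Implicit Types (f g u w y p : R -> C^o).

(** |f + g|^2 <= 2 |f|^2 + 2 |g|^2. *)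
Lemma L2_add f g : L2 f -> L2 g -> L2 (f + g).
Proof.
move=> Lf Lg; have [fr fi ff] := Lf; have [gr gi gf] := Lg.
have E : (fun x => cRe ((f + g) x)) = (fun x => cRe (f x) + cRe (g x)).
  by apply/funext => x; rewrite cReD.
have E' : (fun x => cIm ((f + g) x)) = (fun x => cIm (f x) + cIm (g x)).
  by apply/funext => x; rewrite cImD.
have sq h : L2 h -> L1 (fun x => cRe (h x) ^+ 2 + cIm (h x) ^+ 2).
  move=> [mr mi fin]; apply/integrableP; split.
    by apply/measurable_EFinP; apply: measurable_funD; apply: measurable_funX.
  apply: le_lt_trans fin; rewrite le_eqVlt; apply/orP; left; apply/eqP.
  by apply: eq_integral => x _; rewrite /= ger0_norm // addr_ge0 ?sqr_ge0.
split.
- by rewrite E; exact: measurable_funD.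
- by rewrite E'; exact: measurable_funD.
have S : L1 (fun x => cRe ((f + g) x) ^+ 2 + cIm ((f + g) x) ^+ 2).
  apply: (le_integrable _ _ _ (L1_add (L1_add (sq f Lf) (sq f Lf)) (L1_add (sq g Lg) (sq g Lg)))) => //.
    apply/measurable_EFinP; apply: measurable_funD; apply: measurable_funX.
      by rewrite E; exact: measurable_funD.
    by rewrite E'; exact: measurable_funD.
  move=> x _; rewrite /= lee_fin cReD cImD; set a := cRe _; set a' := cRe _.
  set c := cIm _; set c' := cIm _; rewrite !ger0_norm ?addr_ge0 ?sqr_ge0 //.
  by have := sqr_ge0 (a - a'); have := sqr_ge0 (c - c'); lra.
move/integrableP: S => [_]; apply: le_lt_trans; rewrite le_eqVlt; apply/orP; left.
by apply/eqP; apply: eq_integral => x _; rewrite /= ger0_norm // addr_ge0 ?sqr_ge0.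
Qed.

Lemma L1_integralD (p q : R -> R) : L1 p -> L1 q ->
  \int[mu]_(t in Omega) (p t + q t) =
  \int[mu]_(t in Omega) p t + \int[mu]_(t in Omega) q t.
Proof. by move=> ip iq; rewrite RintegralD //; exact: measurable_itv. Qed.

Lemma weak_deriv_add (p q p' q' : R -> R) : L1 p -> L1 q -> L1 p' -> L1 q' ->
  weak_deriv p p' -> weak_deriv q q' ->
  weak_deriv (fun x => p x + q x) (fun x => p' x + q' x).
Proof.
move=> ip iq ip' iq' dp dq phi tp.
have [dphi cphi [c [d [c0 d1 supp]]]] := tp.
have cp : continuous phi.
  by move=> x; apply/differentiable_continuous/derivable1_diffP; exact: dphi.
have bnd (h : R -> R) : continuous h -> exists M : R, forall t, Omega t -> `|h t| <= M.
  move=> ch; have c01 : {within `[0, 1], continuous (fun t => `|h t|)}.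
    by apply: continuous_subspaceT => x; apply: cvg_norm; exact: ch.
  have [z _ Hz] := EVT_max ler01 c01; exists `|h z| => t; rewrite /= in_itv /= => /andP[t0 t1].
  by apply: Hz; rewrite in_itv /= !ltW.
have add (r s h : R -> R) : L1 r -> L1 s -> continuous h ->
    \int[mu]_(x in Omega) ((r x + s x) * h x) =
    \int[mu]_(x in Omega) (r x * h x) + \int[mu]_(x in Omega) (s x * h x).
  move=> ir is_ ch; have [M HM] := bnd h ch.
  have i1 := L1_mul_bounded ir (cont_mfun ch) HM.
  have i2 := L1_mul_bounded is_ (cont_mfun ch) HM.
  rewrite -L1_integralD //.
  by congr Rintegral; apply/funext => x; rewrite mulrDl.
rewrite !add // dp // dq // opprD //.
Qed.

Lemma H1_add f g : H1 f -> H1 g -> H1 (f + g).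
Proof.
move=> [Lf [f' [Lf' Wf]]] [Lg [g' [Lg' Wg]]]; split; first exact: L2_add.
exists (f' + g'); split; first exact: L2_add.
move/weak_derivP: Wf => [Wfr Wfi]; move/weak_derivP: Wg => [Wgr Wgi].
have [fr fi] := L2_L1 Lf; have [gr gi] := L2_L1 Lg.
have [fr' fi'] := L2_L1 Lf'; have [gr' gi'] := L2_L1 Lg'.
apply/weak_derivP; split.
- rewrite (_ : (fun x => cRe ((f + g) x)) = (fun x => cRe (f x) + cRe (g x))).
    rewrite (_ : (fun x => cRe ((f' + g') x)) = (fun x => cRe (f' x) + cRe (g' x))).
      exact: weak_deriv_add.
    by apply/funext => x; rewrite cReD.
  by apply/funext => x; rewrite cReD.
- rewrite (_ : (fun x => cIm ((f + g) x)) = (fun x => cIm (f x) + cIm (g x))).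
    rewrite (_ : (fun x => cIm ((f' + g') x)) = (fun x => cIm (f' x) + cIm (g' x))).
      exact: weak_deriv_add.
    by apply/funext => x; rewrite cImD.
  by apply/funext => x; rewrite cImD.
Qed.

Lemma continuous01_bound (F : R -> C^o) : continuous01 F ->
  exists2 Q : R, 0 <= Q & forall x : R, 0 <= x <= 1 -> cabs (F x) <= Q.
Proof.
move=> [cr ci].
have nc (h : R -> R) : {within `[0, 1], continuous h} ->
    exists2 M : R, 0 <= M & forall x : R, 0 <= x <= 1 -> `|h x| <= M.
  move=> ch; have c01 : {within `[0, 1], continuous (fun t => `|h t|)}.
    by move=> x; apply: cvg_norm; exact: ch.
  by have [z _ Hz] := EVT_max ler01 c01; exists `|h z|.
have [M1 M10 H1] := nc _ cr; have [M2 M20 H2] := nc _ ci.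
exists (M1 + M2); first exact: addr_ge0.
by move=> x x01; apply: le_trans (cabs_le _) _; apply: lerD; [exact: H1|exact: H2].
Qed.

(** The sources f and g receive what generalized eigenfunctions add to the
    equation. *)
Definition beam_system (b l : C) f g u w y p :=
  [/\ continuous01 u /\ continuous01 w, continuous01 y /\ continuous01 p,
    u 0 = 0 /\ y 0 = 0 &
    forall x : R, 0 < x < 1 -> [/\ cder u x (w x - y x), cder y x (p x),
      cder w x (l ^+ 2 * u x + f x) & cder p x (l ^+ 2 * y x + b * w x + g x)]].

(** The component equations identify wderiv (wderiv u + y) and
    wderiv (wderiv y), almost everywhere, with continuous functions, which makes
    the representatives of u, w = u_x + y, y and p = y_x differentiable. The
    equation contains the derivative of the sum u_x + y, whence the unknown w. *)
Lemma resolvent_regularity (b k1 k2 k3 k4 : R) (l : C) (U : state R)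
    (f1 f2 f3 f4 : R -> C^o) (e5 e6 : C) :
  continuous01 f1 -> continuous01 f2 -> continuous01 f3 -> continuous01 f4 ->
  timo_dom U -> eqH (timo_op 1 b k1 k2 k3 k4 U - l *: U) (f1, f2, f3, f4, e5 : C^o, e6 : C^o) ->
  exists u w y p, [/\ beam_system b%:C l (fun x => l * f1 x + f2 x) (fun x => l * f3 x + f4 x) u w y p,
    eqH U (u, (fun x => l * u x + f1 x), y, (fun x => l * y x + f3 x),
           (l * u 1 + f1 1) : C^o, (l * y 1 + f3 1) : C^o),
    k1%:C * w 1 + (l + k2%:C) * (l * u 1 + f1 1) + e5 = 0 &
    k3%:C * p 1 + (l + k4%:C) * (l * y 1 + f3 1) + e6 = 0].
Proof.
case: U => [[[[[u0 v0] y0] z0] eta] gam] cf1 cf2 cf3 cf4.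
move=> [[Hu Lv Hy Lz] [[Hu2 Hy2] [Hv Hz] etaE gamE]] [Eu Ev Ey Ez [Eeta Egam]].
have {}Eu : eq01 (fun x => v0 x - l * u0 x) f1 := Eu.
have {}Ev : eq01 (fun x => wderiv (wderiv u0 + y0) x - l * v0 x) f2 := Ev.
have {}Ey : eq01 (fun x => z0 x - l * y0 x) f3 := Ey.
have {}Ez : eq01 (fun x => 1%:C * wderiv (wderiv y0) x - b%:C * (wderiv u0 + y0) x
  - l * z0 x) f4 := Ez.
have {}Eeta : - k1%:C * (trace (wderiv u0) 1 + trace y0 1) - k2%:C * eta - l * eta = e5 := Eeta.
have {}Egam : - k3%:C * trace (wderiv y0) 1 - k4%:C * gam - l * gam = e6 := Egam.
have [Hu1 tu] := Hu; have [Hy1 ty] := Hy.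
have [_ Hux] := Hu2; have [_ Hyx] := Hy2.
have [u [cu eu du]] := H1_rep Hu1; have [y [cy ey dy]] := H1_rep Hy1.
have [ux [cux eux _]] := H1_rep Hux; have [p [cp ep dp]] := H1_rep Hyx.
(* w represents u_x + y; it agrees with the sum of the two representatives. *)
have [w [cw ew dw]] := H1_rep (H1_add Hux Hy1).
have one : (0 : R) <= (1 : R) <= (1 : R) by rewrite ler01 /=.
have zero : (0 : R) <= (0 : R) <= (1 : R) by rewrite ler01 lexx.
have wE : forall x : R, 0 <= x <= 1 -> w x = ux x + y x.
  apply: continuous01_eq => //; first exact: continuous01D.
  apply: (eq01_trans (eq01_sym ew)); apply: aeS2 eux ey => x E1 E2 Ox.
  by rewrite [LHS]/= !fctE E1 // E2.
have uE : u 0 = 0 by rewrite -tu; symmetry; apply: trace_eq.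
have yE : y 0 = 0 by rewrite -ty; symmetry; apply: trace_eq.
have vE : eq01 v0 (fun x => l * u x + f1 x).
  apply: aeS2 eu Eu => x E1 E2 Ox; rewrite -E1 // -E2 //.
  by rewrite addrCA subrr addr0.
have zE : eq01 z0 (fun x => l * y x + f3 x).
  apply: aeS2 ey Ey => x E1 E2 Ox; rewrite -E1 // -E2 //.
  by rewrite addrCA subrr addr0.
have cZD (a : C) (F G : R -> C^o) : continuous01 F -> continuous01 G ->
    continuous01 (fun x => a * F x + G x).
  by move=> cF cG; apply: continuous01D => //; exact: continuous01Z.
have wdE : eq01 (wderiv (wderiv u0 + y0)) (fun x => l * (l * u x + f1 x) + f2 x).
  apply: aeS2 vE Ev => x E1 E2 Ox; rewrite -E1 // -E2 //.
  by rewrite addrCA subrr addr0.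
have pdE : eq01 (wderiv (wderiv y0)) (fun x => l * (l * y x + f3 x) + f4 x + b%:C * w x).
  move: zE; apply: aeS2 (aeS2 (fun x P Q => conj P Q) ew Ez) => x [E1 E2] E3 Ox.
  rewrite -E3 // -E2 // -E1 //; ring.
have etaE' : eta = l * u 1 + f1 1.
  by rewrite etaE; apply: (trace_eq (F := fun x => l * u x + f1 x)) => //; exact: cZD.
have gamE' : gam = l * y 1 + f3 1.
  by rewrite gamE; apply: (trace_eq (F := fun x => l * y x + f3 x)) => //; exact: cZD.
exists u, w, y, p; split.
- split => // x x01; have Ox : Omega x by rewrite /= in_itv.
  have x01' : 0 <= x <= 1 by case/andP: x01 => ? ?; rewrite !ltW.
  split.
  + by apply: cder_eq (du ux cux eux x Ox) _; rewrite wE // addrK.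
  + exact: dy p cp ep x Ox.
  + apply: cder_eq (dw _ _ wdE x Ox) _; last by ring.
    by apply: (cZD _ _ _ (cZD _ _ _ _ _) _).
  + apply: cder_eq (dp _ _ pdE x Ox) _; last by ring.
    apply: continuous01D; last exact: continuous01Z.
    by apply: (cZD _ _ _ (cZD _ _ _ _ _) _).
- by split.
- rewrite -etaE' -Eeta (trace_eq cux eux one) (trace_eq cy ey one) wE //.
  by ring.
- rewrite -gamE' -Egam (trace_eq cp ep one); by ring.
Qed.
End Bridge.

(** * Eigenfunctions and Jordan chains near a simple zero *)

Section Pencil.
Variable R : realType.
Notation cabs := (@cabs R).
Notation C := R[i].
Variables (b k1 k2 k3 k4 : R).
Hypothesis hb : 0 < b.
Implicit Types (u w y p : R -> C^o) (l c d : C).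
Notation chi := (charfun b k1 k2 k3 k4).
Notation kap := (kap b).
Notation bc1 l u w := (l * (l + k2%:C) * u 1 + k1%:C * w 1).
Notation bc2 l y p := (l * (l + k4%:C) * y 1 + k3%:C * p 1).
(** The rows of the linear system satisfied by the data of an eigenfunction. *)
Definition bcrow1 l c d := m11 k1%:C k2%:C l (rootp b l) (rootm b l) * c
  + m12 k1%:C k2%:C l (rootp b l) (rootm b l) * d.
Definition bcrow2 l c d := m21 k3%:C k4%:C l (rootp b l) (rootm b l) * c
  + m22 k3%:C k4%:C l (rootp b l) (rootm b l) * d.
Definition admissible l := l != 0 /\ cabs l^-1 <= inv_radius b.

Lemma chi_cramer l c d c' d' :
  chi l * (c * d' - d * c') = bcrow1 l c d * bcrow2 l c' d' - bcrow2 l c d * bcrow1 l c' d'.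
Proof.
by rewrite /charfun /chardet /bcrow1 /bcrow2; move: m11 m12 m21 m22 => f g h k; ring.
Qed.

Lemma entries_bound (B : R) (f g l r1 r2 : C) (E := expR B) : 1 <= B ->
  cabs f <= B -> cabs g <= B -> cabs l <= B -> cabs r1 <= B -> cabs r2 <= B ->
  cabs r1^-1 <= B -> cabs r2^-1 <= B ->
  [/\ cabs (m11 f g l r1 r2) <= 3 * B ^+ 3 * E, cabs (m12 f g l r1 r2) <= 3 * B ^+ 3 * E,
      cabs (m21 f g l r1 r2) <= 3 * B ^+ 3 * E & cabs (m22 f g l r1 r2) <= 3 * B ^+ 3 * E].
Proof.
move=> B1 hf hg hl h1 h2 i1 i2.
have E0 : 0 < E := expR_gt0 _.
have hs r : cabs r <= B -> cabs (csh r) <= E /\ cabs (cch r) <= E.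
  move=> hr; split; [apply: le_trans (csh_bound _) _|apply: le_trans (cch_bound _) _];
    by rewrite ler_expR.
have [s1 a1] := hs _ h1; have [s2 a2] := hs _ h2.
rewrite /m11 /m12 /m21 /m22.
move: (csh r1) (csh r2) (cch r1) (cch r2) r1^-1 r2^-1 i1 i2 s1 a1 s2 a2
  => S1 S2 D1 D2 q1 q2 i1 i2 s1 a1 s2 a2.
have B0 : 0 <= B by lra.
have mul (z z' : C) (x x' : R) : cabs z <= x -> cabs z' <= x' -> cabs (z * z') <= x * x'.
  by move=> h h'; rewrite cabsM; apply: ler_pM => //; exact: cabs_ge0.
have add (z z' : C) (x x' : R) : cabs z <= x -> cabs z' <= x' -> cabs (z + z') <= x + x'.
  by move=> h h'; apply: le_trans (cabsD _ _) _; exact: lerD.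
have sub (z z' : C) (x x' : R) : cabs z <= x -> cabs z' <= x' -> cabs (z - z') <= x + x'.
  by move=> h h'; apply: le_trans (cabsB _ _) _; exact: lerD.
have half (z : C) (x : R) : cabs z <= x -> cabs (z / 2) <= x / 2.
  by move=> h; rewrite cabsM cabsV cabs2 ler_wpM2r // invr_ge0.
have BB : B <= B ^+ 3 by rewrite -[leLHS]expr1 ler_weXn2l.
have BB2 : B ^+ 2 <= B ^+ 3 by rewrite ler_weXn2l.
have BE : B * E <= B ^+ 3 * E by rewrite ler_wpM2r // ltW.
have BE2 : B ^+ 2 * E <= B ^+ 3 * E by rewrite ler_wpM2r // ltW.
split.
- apply: le_trans (add _ _ _ _ (half _ _ (mul _ _ _ _ (add _ _ _ _ hl hg)
    (add _ _ _ _ (mul _ _ _ _ h1 s1) (mul _ _ _ _ h2 s2))))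
    (half _ _ (mul _ _ _ _ (mul _ _ _ _ hf hl) (add _ _ _ _ a1 a2)))) _.
  by rewrite (_ : _ + _ = 3 * (B ^+ 2 * E)); [lra|field].
- apply: le_trans (add _ _ _ _ (half _ _ (mul _ _ _ _ (add _ _ _ _ hl hg)
    (sub _ _ _ _ a1 a2)))
    (half _ _ (mul _ _ _ _ (mul _ _ _ _ hf hl) (sub _ _ _ _ (mul _ _ _ _ i1 s1) (mul _ _ _ _ i2 s2))))) _.
  by rewrite (_ : _ + _ = 2 * (B * E) + B ^+ 3 * E); [lra|field].
- apply: le_trans (add _ _ _ _ (half _ _ (mul _ _ _ _ (mul _ _ _ _ hl (add _ _ _ _ hl hg))
    (sub _ _ _ _ a1 a2)))
    (half _ _ (mul _ _ _ _ hf (sub _ _ _ _ (mul _ _ _ _ h1 s1) (mul _ _ _ _ h2 s2))))) _.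
  by rewrite (_ : _ + _ = 3 * (B ^+ 2 * E)); [lra|field].
- apply: le_trans (add _ _ _ _ (half _ _ (mul _ _ _ _ (mul _ _ _ _ hl (add _ _ _ _ hl hg))
    (add _ _ _ _ (mul _ _ _ _ i1 s1) (mul _ _ _ _ i2 s2))))
    (half _ _ (mul _ _ _ _ hf (add _ _ _ _ a1 a2)))) _.
  by rewrite (_ : _ + _ = 2 * (B ^+ 3 * E) + B * E); [lra|field].
Qed.

(** Stability, uniformly for |l| <= N: the data of a solution with residuals at most
    eps almost satisfy the linear system, and Cramer's rule bounds the determinant
    times the data. Without residuals, zero data give the zero solution. *)
Lemma shooting (N : R) : exists2 K : R, 0 <= K & forall l, admissible l -> cabs l <= N ->
  (forall eps u w y p (c := w 0 / l) (d := - p 0 / kap),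
     approx_sol b%:C l eps u w y p -> u 0 = 0 -> y 0 = 0 -> 0 <= eps ->
     cabs (bc1 l u w) <= eps -> cabs (bc2 l y p) <= eps ->
     [/\ cabs (bcrow1 l c d) <= K * eps, cabs (bcrow2 l c d) <= K * eps,
         cabs (chi l * c) <= K * eps & cabs (chi l * d) <= K * eps]) /\
  (forall u w y p, approx_sol b%:C l 0 u w y p ->
     [/\ u 0 = 0, w 0 = 0, y 0 = 0 & p 0 = 0] ->
     forall x : R, 0 <= x <= 1 -> [/\ u x = 0, w x = 0, y x = 0 & p x = 0]).
Proof.
have [B B1 HB] := root_bounds hb N.
(* One constant bounding the exponents and the parameters. *)
pose D := B + cabs k1%:C + cabs k2%:C + cabs k3%:C + cabs k4%:C.
have g1 := cabs_ge0 k1%:C; have g2 := cabs_ge0 k2%:C.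
have g3 := cabs_ge0 k3%:C; have g4 := cabs_ge0 k4%:C.
have D1 : 1 <= D by rewrite /D; lra.
have BD z : cabs z <= B -> cabs z <= D by rewrite /D; lra.
have e1 : cabs k1%:C <= D by rewrite /D; lra.
have e2 : cabs k2%:C <= D by rewrite /D; lra.
have e3 : cabs k3%:C <= D by rewrite /D; lra.
have e4 : cabs k4%:C <= D by rewrite /D; lra.
pose K := D * (1 + 3 * D ^+ 2 * approx_cst D).
pose M := 3 * D ^+ 3 * expR D.
have A0 : 0 <= approx_cst D.
  rewrite /approx_cst; have D3 : 0 <= D ^+ 3 by rewrite exprn_ge0 //; lra.
  have D4 : 0 <= 1 + D ^+ 3 by rewrite addr_ge0.
  exact: mulr_ge0 (mulr_ge0 (mulr_ge0 (ler0n _ 2) (sqr_ge0 _)) D4) D3.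
have D2 : 0 <= D ^+ 2 by rewrite exprn_ge0 //; lra.
have K0 : 0 <= K by apply: mulr_ge0; [lra|exact: addr_ge0 ler01 (mulr_ge0 (mulr_ge0 (ler0n _ 3) D2) A0)].
have D3 : 0 <= D ^+ 3 by rewrite exprn_ge0 //; lra.
have M0 : 0 <= M := mulr_ge0 (mulr_ge0 (ler0n _ 3) D3) (expR_ge0 _).
exists (K + 2 * M * K); first by apply: addr_ge0 K0 (mulr_ge0 (mulr_ge0 (ler0n _ 2) M0) K0).
move=> l [l0 hX] hN; have [[b1 b2] [b3 b4] [b5 b6] [b7 b8]] := HB l l0 hX hN.
have [r10 r20] := root_neq0 hb l0 hX.
have q1 := rootp_sq hb l0; have q2 := rootm_sq hb l0.
have kn := kap_neq0 hb; have ks := kap_sq hb.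
split=> [eps u w y p c d As u0 y0 eps0 h1 h2|u w y p As ini x x01].
- have [H1 H2] := @approx_bc _ _ _ _ _ _ ks l0 kn r10 r20 q1 q2 D D1 (BD _ b1) (BD _ b2)
    (BD _ b3) (BD _ b4) (BD _ b5) (BD _ b6) (BD _ b7) (BD _ b8) eps u w y p
    k1%:C k2%:C k3%:C k4%:C As u0 y0 eps0 h1 h2 e1 e2 e3 e4.
  move: H1 H2; rewrite -/(bcrow1 l c d) -/(bcrow2 l c d) -/K => H1 H2.
  have Ke : 0 <= K * eps by rewrite mulr_ge0.
  have MKe : 0 <= M * (K * eps) by rewrite mulr_ge0.
  have KE : (K + 2 * M * K) * eps = K * eps + (M * (K * eps) + M * (K * eps)) by ring.
  have big z : cabs z <= K * eps -> cabs z <= (K + 2 * M * K) * eps.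
    by move=> hz; apply: le_trans hz _; rewrite KE lerDl addr_ge0.
  have [n11 n12 _ _] := @entries_bound D k1%:C k2%:C l _ _ D1 e1 e2 (BD _ b1) (BD _ b3) (BD _ b4) (BD _ b5) (BD _ b6).
  have [_ _ n21 n22] := @entries_bound D k3%:C k4%:C l _ _ D1 e3 e4 (BD _ b1) (BD _ b3) (BD _ b4) (BD _ b5) (BD _ b6).
  have cr (z z' : C) : cabs z <= M -> cabs z' <= M ->
      cabs (z * bcrow1 l c d - z' * bcrow2 l c d) <= (K + 2 * M * K) * eps.
    move=> hz hz'; apply: le_trans (cabsB _ _) _; rewrite !cabsM.
    have t1 : cabs z * cabs (bcrow1 l c d) <= M * (K * eps) by apply: ler_pM => //; exact: cabs_ge0.
    have t2 : cabs z' * cabs (bcrow2 l c d) <= M * (K * eps) by apply: ler_pM => //; exact: cabs_ge0.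
    by apply: le_trans (lerD t1 t2) _; rewrite KE lerDr.
  split; [exact: big|exact: big| |].
  + rewrite (_ : chi l * c = m22 k3%:C k4%:C l (rootp b l) (rootm b l) * bcrow1 l c d
       - m12 k1%:C k2%:C l (rootp b l) (rootm b l) * bcrow2 l c d); first exact: cr.
    by rewrite /charfun /chardet /bcrow1 /bcrow2; move: m11 m12 m21 m22 => f g h k; ring.
  + rewrite (_ : chi l * d = - (m21 k3%:C k4%:C l (rootp b l) (rootm b l) * bcrow1 l c d
       - m11 k1%:C k2%:C l (rootp b l) (rootm b l) * bcrow2 l c d)).
      by rewrite cabsN; exact: cr.
    by rewrite /charfun /chardet /bcrow1 /bcrow2; move: m11 m12 m21 m22 => f g h k; ring.
- have [z1 z2 z3 z4] := @approx_zero _ _ _ _ _ _ ks l0 kn r10 r20 q1 q2 D D1 (BD _ b1) (BD _ b2)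
    (BD _ b3) (BD _ b4) (BD _ b5) (BD _ b6) (BD _ b7) (BD _ b8) 0 u w y p As ini (lexx 0) x x01.
  have Z z : cabs z <= approx_cst D * 0 -> z = 0.
    rewrite mulr0 => hz; apply/eqP; rewrite -cabs_eq0 eq_le hz; exact: cabs_ge0.
  by split; exact: Z.
Qed.

Lemma system_approx l (eps : R) f g u w y p : beam_system b%:C l f g u w y p ->
  (forall x : R, 0 <= x <= 1 -> cabs (f x) <= eps /\ cabs (g x) <= eps) ->
  approx_sol b%:C l eps u w y p.
Proof.
move=> [c1 c2 _ H] hfg; split => //.
- by move=> x x01; have [] := H x x01.
- exists f, g => x x01; have [_ _ dw dp] := H x x01.
  have [|hf hg] := hfg x; first by case/andP: x01 => ? ?; rewrite !ltW.
  by [].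
Qed.

Lemma beam_system_comb l f g u w y p f' g' u' w' y' p' (s : C) :
  beam_system b%:C l f g u w y p -> beam_system b%:C l f' g' u' w' y' p' ->
  beam_system b%:C l (fun x => f x + s * f' x) (fun x => g x + s * g' x)
    (fun x => u x + s * u' x) (fun x => w x + s * w' x)
    (fun x => y x + s * y' x) (fun x => p x + s * p' x).
Proof.
move=> [[cu cw] [cy cp] [u0 y0] H] [[cu' cw'] [cy' cp'] [u0' y0'] H'].
have cZD (F G : R -> C^o) : continuous01 F -> continuous01 G ->
    continuous01 (fun x => F x + s * G x).
  by move=> cF cG; apply: continuous01D => //; exact: continuous01Z.
split; [by split; exact: cZD|by split; exact: cZD|by rewrite u0 u0' y0 y0' mulr0 addr0|].
move=> x x01; have [du dy dw dp] := H x x01; have [du' dy' dw' dp'] := H' x x01.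
split.
- by apply: cder_eq (cderD du (cderZ s du')) _; ring.
- by apply: cder_eq (cderD dy (cderZ s dy')) _; ring.
- by apply: cder_eq (cderD dw (cderZ s dw')) _; ring.
- by apply: cder_eq (cderD dp (cderZ s dp')) _; ring.
Qed.

(** A change of the spectral parameter is a source. *)
Lemma beam_system_shift l l' f g u w y p : beam_system b%:C l f g u w y p ->
  beam_system b%:C l' (fun x => f x + (l ^+ 2 - l' ^+ 2) * u x)
    (fun x => g x + (l ^+ 2 - l' ^+ 2) * y x) u w y p.
Proof.
move=> [c1 c2 z H]; split => // x x01; have [du dy dw dp] := H x x01.
by split => //; [apply: cder_eq dw _|apply: cder_eq dp _]; ring.
Qed.

Lemma vanish_linear (D K h0 : R) : 0 < h0 ->
  (forall t : R, 0 < t -> t <= h0 -> D <= K * t) -> D <= 0.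
Proof.
move=> h00 H; rewrite leNgt; apply/negP => D0.
pose t := Num.min h0 (D / (2 * (`|K| + 1))).
have K1 : 0 < `|K| + 1 by have := normr_ge0 K; lra.
have t0 : 0 < t by rewrite lt_min h00 /= divr_gt0 // mulr_gt0.
have th : t <= h0 by rewrite ge_min lexx.
have tD : t * (2 * (`|K| + 1)) <= D.
  by rewrite -ler_pdivlMr ?mulr_gt0 // ge_min lexx orbT.
have := H t t0 th; have := ler_norm K; nra.
Qed.

Definition eigen_system l u w y p :=
  [/\ beam_system b%:C l (fun=> 0) (fun=> 0) u w y p, bc1 l u w = 0 & bc2 l y p = 0].

(** The equations of a generalized eigenfunction above (u, y), obtained by formally
    differentiating those of an eigenfunction with respect to l. *)
Definition chain_system l (u y : R -> C^o) u1 w1 y1 p1 :=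
  [/\ beam_system b%:C l (fun x => 2 * l * u x) (fun x => 2 * l * y x) u1 w1 y1 p1,
      bc1 l u1 w1 + (2 * l + k2%:C) * u 1 = 0 &
      bc2 l y1 p1 + (2 * l + k4%:C) * y 1 = 0].

Lemma eigen_chi l u w y p : admissible l -> eigen_system l u w y p ->
  chi l * w 0 = 0 /\ chi l * p 0 = 0.
Proof.
move=> al [S h1 h2]; have [K K0 HK] := shooting (cabs l).
have [_ _ [u0 y0] _] := S.
have As : approx_sol b%:C l 0 u w y p by apply: (system_approx S) => x _; rewrite cabs0.
have [HA _] := HK l al (lexx _).
have [_ _ z1 z2] := HA 0 u w y p As u0 y0 (lexx _)
  ltac:(by rewrite h1 cabs0) ltac:(by rewrite h2 cabs0).
have Z z : cabs z <= K * 0 -> z = 0.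
  rewrite mulr0 => hz; apply/eqP; rewrite -cabs_eq0 eq_le hz; exact: cabs_ge0.
have l0 : l != 0 by case: al.
have kn := kap_neq0 hb.
split.
- by have := Z _ z1; rewrite mulrA => /eqP; rewrite mulf_eq0 invr_eq0 (negbTE l0) orbF => /eqP.
- have := Z _ z2; rewrite mulrA => /eqP; rewrite mulf_eq0 invr_eq0 (negbTE kn) orbF.
  by rewrite mulrN oppr_eq0 => /eqP.
Qed.

Lemma eigen_zero l u w y p : admissible l -> eigen_system l u w y p ->
  w 0 = 0 -> p 0 = 0 -> forall x : R, 0 <= x <= 1 -> u x = 0 /\ y x = 0.
Proof.
move=> al [S h1 h2] w0 p0 x x01; have [K K0 HK] := shooting (cabs l).
have [_ _ [u0 y0] _] := S.
have As : approx_sol b%:C l 0 u w y p by apply: (system_approx S) => t _; rewrite cabs0.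
by have [_ /(_ _ _ _ _ As (And4 u0 w0 y0 p0) x x01) []] := HK l al (lexx _).
Qed.

Lemma double_shift_bound l d d' h : cabs h <= 1 ->
  [/\ cabs (2 * l + h) <= 2 * cabs l + 1 + cabs d + cabs d',
      cabs (2 * l + h + d) <= 2 * cabs l + 1 + cabs d + cabs d' &
      cabs (2 * l + h + d') <= 2 * cabs l + 1 + cabs d + cabs d'].
Proof.
move=> hh; have := cabsD (2 * l) h; have := cabsD (2 * l + h) d.
have := cabsD (2 * l + h) d'; have := cabs_ge0 d; have := cabs_ge0 d'.
by rewrite cabsM cabs2 => ? ? ? ? ?; split; lra.
Qed.

Section SimpleZero.
Variables (l : C).
Hypothesis (al : admissible l) (iso : isolated_zero b k1 k2 k3 k4 l).

(** Seen from l + h, an eigenfunction at l has residuals O(h). *)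
Lemma eigen_near u w y p : eigen_system l u w y p -> exists2 K : R, 0 <= K &
  forall h, cabs h <= 1 -> admissible (l + h) ->
  cabs (bcrow1 (l + h) (w 0 / (l + h)) (- p 0 / kap)) <= K * cabs h /\
  cabs (bcrow2 (l + h) (w 0 / (l + h)) (- p 0 / kap)) <= K * cabs h.
Proof.
move=> [S h1 h2]; have [K K0 HK] := shooting (cabs l + 1).
have [[cu _] [cy _] [u0 y0] _] := S.
have [Qu Qu0 HQu] := continuous01_bound cu.
have [Qy Qy0 HQy] := continuous01_bound cy.
have one : (0 : R) <= (1 : R) <= (1 : R) by rewrite ler01 /=.
pose Q := (2 * cabs l + 1 + cabs k2%:C + cabs k4%:C) * (Qu + Qy).
have g2 := cabs_ge0 k2%:C; have g4 := cabs_ge0 k4%:C; have gl := cabs_ge0 l.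
have Q0 : 0 <= Q by apply: mulr_ge0; lra.
exists (K * Q); first exact: mulr_ge0.
have fu (z : C) : cabs z <= Qu -> cabs z <= Qu + Qy by lra.
have fy (z : C) : cabs z <= Qy -> cabs z <= Qu + Qy by lra.
move=> h hh ah; have hp := cabs_ge0 h.
have lh : cabs (l + h) <= cabs l + 1 by have := cabsD l h; lra.
have e (z q : C) : cabs z <= 2 * cabs l + 1 + cabs k2%:C + cabs k4%:C ->
    cabs q <= Qu + Qy -> cabs (h * (z * q)) <= Q * cabs h.
  move=> hz hq; rewrite cabsM mulrC; apply: ler_wpM2r => //.
  by rewrite cabsM; apply: ler_pM => //; exact: cabs_ge0.
have c2l : cabs (2 * l + h) <= 2 * cabs l + 1.
  by have := cabsD (2 * l) h; rewrite cabsM cabs2; lra.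
have As : approx_sol b%:C (l + h) (Q * cabs h) u w y p.
  apply: (system_approx (beam_system_shift (l + h) S)) => x x01.
  have qu := HQu x x01; have qy := HQy x x01.
  have -> : 0 + (l ^+ 2 - (l + h) ^+ 2) * u x = - (h * ((2 * l + h) * u x)) by ring.
  have -> : 0 + (l ^+ 2 - (l + h) ^+ 2) * y x = - (h * ((2 * l + h) * y x)) by ring.
  have zP : cabs (2 * l + h) <= 2 * cabs l + 1 + cabs k2%:C + cabs k4%:C by lra.
  by rewrite !cabsN; split; apply: e => //; [exact: fu|exact: fy].
have [HA _] := HK (l + h) ah lh.
have Qh : 0 <= Q * cabs h by rewrite mulr_ge0.
have B1 : cabs (bc1 (l + h) u w) <= Q * cabs h.
  have -> : bc1 (l + h) u w = bc1 l u w + h * ((2 * l + h + k2%:C) * u 1) by ring.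
  rewrite h1 add0r; apply: e; last exact: fu (HQu 1 one).
  by have := cabsD (2 * l + h) k2%:C; lra.
have B2 : cabs (bc2 (l + h) y p) <= Q * cabs h.
  have -> : bc2 (l + h) y p = bc2 l y p + h * ((2 * l + h + k4%:C) * y 1) by ring.
  rewrite h2 add0r; apply: e; last exact: fy (HQy 1 one).
  by have := cabsD (2 * l + h) k4%:C; lra.
have [r1 r2 _ _] := HA _ _ _ _ _ As u0 y0 Qh B1 B2.
by rewrite -mulrA; split.
Qed.

(** The determinant of the two pairs of data, multiplied by that of the linear system
    at l + h, is a sum of products of two O(h) terms; the determinant of the system
    being at least c |h|, the data are proportional. *)
Lemma eigen_rank1 u w y p u' w' y' p' :
  eigen_system l u w y p -> eigen_system l u' w' y' p' -> w 0 * p' 0 = p 0 * w' 0.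
Proof.
move=> S S'; have [K K0 HK] := eigen_near S; have [K' K'0 HK'] := eigen_near S'.
have [c [h0 [c0 h00 Hiso]]] := iso.
have kn := kap_neq0 hb; have gl := cabs_ge0 l.
apply/eqP; rewrite -subr_eq0 -cabs_eq0 eq_le cabs_ge0 andbT.
set D := w 0 * p' 0 - p 0 * w' 0.
apply: (@vanish_linear _ (2 * K * K' * (cabs l + 1) * cabs kap / c) (Num.min h0 1)).
  by rewrite lt_min h00 ltr01.
move=> t t0; rewrite le_min => /andP[th0 t1].
have ht : cabs t%:C = t by rewrite cabs_real gtr0_norm.
have hh : cabs t%:C <= h0 by rewrite ht.
have hh1 : cabs t%:C <= 1 by rewrite ht.
have [ln lX low] := Hiso _ hh.
have [r1 r2] := HK _ hh1 (conj ln lX); have [r1' r2'] := HK' _ hh1 (conj ln lX).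
rewrite ht in r1 r2 r1' r2'.
have lh : cabs (l + t%:C) <= cabs l + 1 by have := cabsD l t%:C; lra.
have E := chi_cramer (l + t%:C) (w 0 / (l + t%:C)) (- p 0 / kap) (w' 0 / (l + t%:C)) (- p' 0 / kap).
have F : chi (l + t%:C) * D = - ((l + t%:C) * kap * (chi (l + t%:C) *
    (w 0 / (l + t%:C) * (- p' 0 / kap) - - p 0 / kap * (w' 0 / (l + t%:C))))).
  by rewrite /D; field; rewrite kn ln.
have up : cabs (chi (l + t%:C) * D) <= (cabs l + 1) * cabs kap * (2 * (K * t) * (K' * t)).
  rewrite F E cabsN cabsM; apply: ler_pM; rewrite ?cabs_ge0 //.
    by rewrite cabsM ler_wpM2r // cabs_ge0.
  apply: le_trans (cabsB _ _) _; rewrite !cabsM.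
  have s1 : cabs (bcrow1 (l + t%:C) (w 0 / (l + t%:C)) (- p 0 / kap)) *
    cabs (bcrow2 (l + t%:C) (w' 0 / (l + t%:C)) (- p' 0 / kap)) <= K * t * (K' * t).
    by apply: ler_pM; rewrite ?cabs_ge0.
  have s2 : cabs (bcrow2 (l + t%:C) (w 0 / (l + t%:C)) (- p 0 / kap)) *
    cabs (bcrow1 (l + t%:C) (w' 0 / (l + t%:C)) (- p' 0 / kap)) <= K * t * (K' * t).
    by apply: ler_pM; rewrite ?cabs_ge0.
  lra.
have dn : c * t * cabs D <= cabs (chi (l + t%:C) * D).
  by rewrite cabsM; apply: ler_wpM2r; [exact: cabs_ge0|rewrite -{1}ht].
rewrite mulrAC ler_pdivlMr // -(ler_pM2l t0).
rewrite (_ : t * (cabs D * c) = c * t * cabs D); last by ring.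
rewrite (_ : t * (_ * t) = (cabs l + 1) * cabs kap * (2 * (K * t) * (K' * t))); last by ring.
exact: le_trans dn up.
Qed.

(** Seen from l + h, the sum of the eigenfunction and h times the generalized
    eigenfunction has residuals O(h^2), so that its data, which tend to those of the
    eigenfunction, are O(h). *)
Lemma chain_trivial u w y p u1 w1 y1 p1 :
  eigen_system l u w y p -> chain_system l u y u1 w1 y1 p1 -> w 0 = 0 /\ p 0 = 0.
Proof.
move=> [S h1 h2] [S1 e1 e2]; have [K K0 HK] := shooting (cabs l + 1).
have [c [h0 [c0 h00 Hiso]]] := iso.
have [[cu _] [cy _] [u0 y0] _] := S; have [[cu1 _] [cy1 _] [u10 y10] _] := S1.
have [Qu Qu0 HQu] := continuous01_bound cu; have [Qu1 Qu10 HQu1] := continuous01_bound cu1.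
have [Qy Qy0 HQy] := continuous01_bound cy; have [Qy1 Qy10 HQy1] := continuous01_bound cy1.
have one : (0 : R) <= (1 : R) <= (1 : R) by rewrite ler01 /=.
have kn := kap_neq0 hb; have gl := cabs_ge0 l.
have g2 := cabs_ge0 k2%:C; have g4 := cabs_ge0 k4%:C.
pose P := 2 * cabs l + 1 + cabs k2%:C + cabs k4%:C.
pose Q := Qu + Qy + P * (Qu1 + Qy1).
have P0 : 0 <= P by rewrite /P; lra.
have Q0 : 0 <= Q by rewrite /Q addr_ge0 ?mulr_ge0 //; lra.
have fu (z : C) : cabs z <= Qu -> cabs z <= Qu + Qy by lra.
have fy (z : C) : cabs z <= Qy -> cabs z <= Qu + Qy by lra.
have fu1 (z : C) : cabs z <= Qu1 -> cabs z <= Qu1 + Qy1 by lra.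
have fy1 (z : C) : cabs z <= Qy1 -> cabs z <= Qu1 + Qy1 by lra.
have fP h : cabs h <= 1 -> [/\ cabs (2 * l + h) <= P,
    cabs (2 * l + h + k2%:C) <= P & cabs (2 * l + h + k4%:C) <= P] by exact: double_shift_bound.
have est (t : R) : 0 < t -> t <= Num.min h0 1 ->
    cabs (w 0 + t%:C * w1 0) * (c * t) <= K * (Q * t ^+ 2) * (cabs l + 1) /\
    cabs (p 0 + t%:C * p1 0) * (c * t) <= K * (Q * t ^+ 2) * cabs kap.
  move=> t0; rewrite le_min => /andP[th0 t1].
  have ht : cabs t%:C = t by rewrite cabs_real gtr0_norm.
  have hh : cabs t%:C <= h0 by rewrite ht.
  have hh1 : cabs t%:C <= 1 by rewrite ht.
  have [ln lX low] := Hiso _ hh; rewrite ht in low.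
  set h : C := t%:C in ht hh hh1 ln lX low *.
  have lh : cabs (l + h) <= cabs l + 1 by have := cabsD l h; lra.
  have e (z q q1 : C) : cabs z <= P -> cabs q <= Qu + Qy -> cabs q1 <= Qu1 + Qy1 ->
      cabs (h ^+ 2 * (q + z * q1)) <= Q * t ^+ 2.
    move=> hz hq hq1; rewrite cabsM cabsX ht mulrC; apply: ler_wpM2r; first exact: sqr_ge0.
    apply: le_trans (cabsD _ _) _; rewrite cabsM; apply: lerD => //.
    by apply: ler_pM => //; exact: cabs_ge0.
  have [zP zP2 zP4] := fP h hh1.
  have As : approx_sol b%:C (l + h) (Q * t ^+ 2) (fun x => u x + h * u1 x)
      (fun x => w x + h * w1 x) (fun x => y x + h * y1 x) (fun x => p x + h * p1 x).
    apply: (system_approx (beam_system_shift (l + h) (beam_system_comb h S S1))) => x x01.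
    have qu := HQu x x01; have qy := HQy x x01; have qu1 := HQu1 x x01; have qy1 := HQy1 x x01.
    have -> : 0 + h * (2 * l * u x) + (l ^+ 2 - (l + h) ^+ 2) * (u x + h * u1 x) =
       - (h ^+ 2 * (u x + (2 * l + h) * u1 x)) by ring.
    have -> : 0 + h * (2 * l * y x) + (l ^+ 2 - (l + h) ^+ 2) * (y x + h * y1 x) =
       - (h ^+ 2 * (y x + (2 * l + h) * y1 x)) by ring.
    by rewrite !cabsN; split; apply: e => //; [exact: fu|exact: fu1|exact: fy|exact: fy1].
  have [HA _] := HK (l + h) (conj ln lX) lh.
  have U0 : u 0 + h * u1 0 = 0 by rewrite u0 u10 mulr0 addr0.
  have Y0 : y 0 + h * y1 0 = 0 by rewrite y0 y10 mulr0 addr0.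
  have Qt : 0 <= Q * t ^+ 2 by rewrite mulr_ge0 ?sqr_ge0.
  have B1 : cabs ((l + h) * (l + h + k2%:C) * (u 1 + h * u1 1) + k1%:C * (w 1 + h * w1 1))
      <= Q * t ^+ 2.
    have -> : (l + h) * (l + h + k2%:C) * (u 1 + h * u1 1) + k1%:C * (w 1 + h * w1 1) =
      bc1 l u w + h * (bc1 l u1 w1 + (2 * l + k2%:C) * u 1)
      + h ^+ 2 * (u 1 + (2 * l + h + k2%:C) * u1 1) by ring.
    rewrite h1 e1 mulr0 !add0r; exact: e zP2 (fu _ (HQu 1 one)) (fu1 _ (HQu1 1 one)).
  have B2 : cabs ((l + h) * (l + h + k4%:C) * (y 1 + h * y1 1) + k3%:C * (p 1 + h * p1 1))
      <= Q * t ^+ 2.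
    have -> : (l + h) * (l + h + k4%:C) * (y 1 + h * y1 1) + k3%:C * (p 1 + h * p1 1) =
      bc2 l y p + h * (bc2 l y1 p1 + (2 * l + k4%:C) * y 1)
      + h ^+ 2 * (y 1 + (2 * l + h + k4%:C) * y1 1) by ring.
    rewrite h2 e2 mulr0 !add0r; exact: e zP4 (fy _ (HQy 1 one)) (fy1 _ (HQy1 1 one)).
  have [_ _ r1 r2] := HA _ _ _ _ _ As U0 Y0 Qt B1 B2.
  have fin (z q : C) (s : R) : q != 0 -> cabs q <= s -> cabs (chi (l + h) * (z / q)) <= K * (Q * t ^+ 2) ->
      cabs z * (c * t) <= K * (Q * t ^+ 2) * s.
    move=> qn qs hz.
    have -> : cabs z = cabs (z / q) * cabs q by rewrite -cabsM divfK.
    have ct : 0 <= c * t by rewrite mulr_ge0 // ltW.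
    rewrite mulrAC; apply: ler_pM => //; [exact: mulr_ge0 (cabs_ge0 _) ct|exact: cabs_ge0|].
    by apply: le_trans hz; rewrite [cabs (chi _ * _)]cabsM [leRHS]mulrC; apply: ler_wpM2l => //; exact: cabs_ge0.
  split; first by apply: fin r1.
  rewrite -[X in X * _]cabsN; exact: fin r2.
have lim (q q1 : C) (s : R) : (forall t : R, 0 < t -> t <= Num.min h0 1 ->
    cabs (q + t%:C * q1) * (c * t) <= K * (Q * t ^+ 2) * s) -> q = 0.
  move=> H; apply/eqP; rewrite -cabs_eq0 eq_le cabs_ge0 andbT.
  apply: (@vanish_linear _ (K * Q * s / c + cabs q1) (Num.min h0 1)).
    by rewrite lt_min h00 ltr01.
  move=> t t0 th; have := H t t0 th.
  have -> : K * (Q * t ^+ 2) * s = K * Q * s / c * t * (c * t) by field; rewrite gt_eqF.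
  rewrite ler_pM2r ?mulr_gt0 // => H1.
  have := cabsB (q + t%:C * q1) (t%:C * q1); rewrite addrK cabsM cabs_real gtr0_norm //; lra.
split.
- by apply: (lim _ (w1 0) (cabs l + 1)) => t t0 th; have [] := est t t0 th.
- by apply: (lim _ (p1 0) (cabs kap)) => t t0 th; have [] := est t t0 th.
Qed.
End SimpleZero.
End Pencil.

(** * Simplicity of the eigenvalues *)

Lemma scale_state (R : realType) (l : R[i]) (u v y z : R -> R[i]^o) (eta gam : R[i]^o) :
  l *: ((u, v, y, z, eta, gam) : state R) =
  ((fun x => l * u x), (fun x => l * v x), (fun x => l * y x), (fun x => l * z x), l * eta, l * gam) :> state R.
Proof. by []. Qed.
Lemma sub_state (R : realType) (u v y z u' v' y' z' : R -> R[i]^o) (eta gam eta' gam' : R[i]^o) :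
  ((u, v, y, z, eta, gam) : state R) - (u', v', y', z', eta', gam') =
  ((fun x => u x - u' x), (fun x => v x - v' x), (fun x => y x - y' x), (fun x => z x - z' x), eta - eta', gam - gam') :> state R.
Proof. by []. Qed.

Section Spectrum.
Variable R : realType.
Notation mu := (@lebesgue_measure R).
Notation Omega := (`]0, 1[%classic : set R).
Notation cabs := (@cabs R).
Notation C := R[i].
Variables (b k1 k2 k3 k4 : R).
Hypothesis hb : 0 < b.
Implicit Types (u w y p : R -> C^o) (l c d : C) (U : state R).
Notation chi := (charfun b k1 k2 k3 k4).
Notation kap := (kap b).
Notation op := (timo_op 1 b k1 k2 k3 k4).
Notation eigen_system := (eigen_system b k1 k2 k3 k4).
Notation chain_system := (chain_system b k1 k2 k3 k4).
Notation admissible := (admissible b).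

Definition eigenstate l u y : state R :=
  (u, (fun x => l * u x) : R -> C^o, y, (fun x => l * y x) : R -> C^o,
   (l * u 1) : C^o, (l * y 1) : C^o).

Lemma kernel_vector l : chi l = 0 -> exists c d,
  [/\ bcrow1 b k1 k2 l c d = 0, bcrow2 b k3 k4 l c d = 0 & c != 0 \/ d != 0].
Proof.
rewrite /charfun /chardet /bcrow1 /bcrow2.
move: (m11 _ _ _ _ _) (m12 _ _ _ _ _) (m21 _ _ _ _ _) (m22 _ _ _ _ _) => f g h k D.
have [f0|f0] := eqVneq f 0; last first.
  by exists (- g), f; split; [ring|rewrite -[RHS]D; ring|right].
have [g0|g0] := eqVneq g 0; last first.
  by exists (- g), f; split; [ring|rewrite -[RHS]D; ring|left; rewrite oppr_eq0].
have [h0|h0] := eqVneq h 0; last first.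
  by exists (- k), h; split; [rewrite f0 g0; ring|ring|right].
have [k0|k0] := eqVneq k 0; last first.
  by exists (- k), h; split; [rewrite f0 g0; ring|ring|left; rewrite oppr_eq0].
by exists 1, 0; split; [rewrite f0; ring|rewrite h0; ring|left; exact: oner_neq0].
Qed.

(** Explicit solutions are smooth on the whole line, so their weak derivatives are
    their derivatives. If u and y vanish, then so do w - y = u' and p = y', and the
    initial data. *)
Lemma smooth_eigenstate l u w y p :
  (forall x : R, cder u x (w x - y x)) -> (forall x : R, cder w x (l ^+ 2 * u x)) ->
  (forall x : R, cder y x (p x)) -> (forall x : R, cder p x (l ^+ 2 * y x + b%:C * w x)) ->
  eigen_system l u w y p -> (w 0 != 0 \/ p 0 != 0) ->
  [/\ timo_dom (eigenstate l u y), ~ eqH (eigenstate l u y) 0 &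
      eqH (op (eigenstate l u y)) (l *: eigenstate l u y)].
Proof.
move=> du dw dy dp [S h1 h2] nz; have [_ _ [u0 y0] _] := S.
have cu := cder_ccont du; have cw := cder_ccont dw.
have cy := cder_ccont dy; have cp := cder_ccont dp.
have dwy (x : R) : cder (fun t => w t - y t) x (l ^+ 2 * u x - p x) := cderB (dw x) (dy x).
have cwy := cder_ccont dwy.
have ccu : ccont (fun x => l ^+ 2 * u x) := cder_ccont (fun x => cderZ (l ^+ 2) (du x)).
have cup : ccont (fun x => l ^+ 2 * u x - p x) := cder_ccont (fun x => cderB (cderZ (l ^+ 2) (du x)) (dp x)).
have cyw : ccont (fun x => l ^+ 2 * y x + b%:C * w x) :=
  cder_ccont (fun x => cderD (cderZ (l ^+ 2) (dy x)) (cderZ b%:C (dw x))).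
have clu : ccont (fun x => l * u x) := cder_ccont (fun x => cderZ l (du x)).
have cly : ccont (fun x => l * y x) := cder_ccont (fun x => cderZ l (dy x)).
have clwy : ccont (fun x => l * (w x - y x)) := cder_ccont (fun x => cderZ l (dwy x)).
have clp : ccont (fun x => l * p x) := cder_ccont (fun x => cderZ l (dp x)).
have [Hu wu] := C1_H1 (ccont_L2 cu) (eq01_refl u) du cwy.
have [Hy wy] := C1_H1 (ccont_L2 cy) (eq01_refl y) dy cp.
have [L2wu _] := wderiv_spec Hu; have [L2wy _] := wderiv_spec Hy.
have [Hwu _] := C1_H1 L2wu wu dwy cup.
have [Hwy wwy] := C1_H1 L2wy wy dp cyw.
have [Hlu _] := C1_H1 (ccont_L2 clu) (eq01_refl _) (fun x => cderZ l (du x)) clwy.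
have [Hly _] := C1_H1 (ccont_L2 cly) (eq01_refl _) (fun x => cderZ l (dy x)) clp.
have wuy : eq01 (wderiv u + y) w.
  by apply: aeS wu => x E Ox; rewrite [LHS]/= !fctE E // subrK.
have [_ wwuy] := C1_H1 (L2_add L2wu (ccont_L2 cy)) wuy dw ccu.
have one : (0 : R) <= (1 : R) <= (1 : R) by rewrite ler01 /=.
have zero : (0 : R) <= (0 : R) <= (1 : R) by rewrite ler01 lexx.
split.
- split; [split; [split|exact: ccont_L2|split|exact: ccont_L2]|split; [split|split|..]] => //.
  + by rewrite (trace_eq (ccont01 cu) (eq01_refl u) zero).
  + by rewrite (trace_eq (ccont01 cy) (eq01_refl y) zero).
  + by split => //; rewrite (trace_eq (ccont01 clu) (eq01_refl _) zero) u0 mulr0.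
  + by split => //; rewrite (trace_eq (ccont01 cly) (eq01_refl _) zero) y0 mulr0.
  + by rewrite (trace_eq (ccont01 clu) (eq01_refl _) one).
  + by rewrite (trace_eq (ccont01 cly) (eq01_refl _) one).
- move=> [zu _ zy _ _].
  have zu' : eq01 u (fun=> 0) := zu; have zy' : eq01 y (fun=> 0) := zy.
  have d0 (x : R) : cder (fun=> 0 : C) x 0 := cder_cst 0 x.
  have c0 : ccont (fun=> 0 : C) := cder_ccont d0.
  have [_ wu0] := C1_H1 (ccont_L2 cu) zu' d0 c0.
  have [_ wy0] := C1_H1 (ccont_L2 cy) zy' d0 c0.
  have W0 : w 0 - y 0 = 0.
    by apply: (continuous01_eq (ccont01 cwy) (ccont01 c0) (eq01_trans (eq01_sym wu) wu0) zero).
  have P0 : p 0 = 0.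
    by apply: (continuous01_eq (ccont01 cp) (ccont01 c0) (eq01_trans (eq01_sym wy) wy0) zero).
  by move: W0 nz; rewrite y0 subr0 P0 => ->; rewrite eqxx => -[].
- have tw : trace (wderiv u) 1 + trace y 1 = w 1.
    by rewrite (trace_eq (ccont01 cwy) wu one) (trace_eq (ccont01 cy) (eq01_refl y) one) subrK.
  have tp : trace (wderiv y) 1 = p 1 by rewrite (trace_eq (ccont01 cp) wy one).
  have E2 : eq01 (wderiv (wderiv u + y)) (fun x => l * (l * u x)).
    by apply: aeS wwuy => x E Ox; rewrite E // mulrA.
  have E4 : eq01 (fun x => 1%:C * wderiv (wderiv y) x - b%:C * (wderiv u + y) x) (fun x => l * (l * y x)).
    by apply: aeS2 wwy wuy => x Ea Eb Ox; rewrite Ea // Eb //; ring.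
  have E5 : - k1%:C * (trace (wderiv u) 1 + trace y 1) - k2%:C * (l * u 1) = l * (l * u 1).
    rewrite tw; apply/eqP; rewrite -subr_eq0 -oppr_eq0 -h1; apply/eqP; ring.
  have E6 : - k3%:C * trace (wderiv y) 1 - k4%:C * (l * y 1) = l * (l * y 1).
    rewrite tp; apply/eqP; rewrite -subr_eq0 -oppr_eq0 -h2; apply/eqP; ring.
  rewrite /eigenstate scale_state.
  split; [exact: eq01_refl|exact: E2|exact: eq01_refl|exact: E4|split; [exact: E5|exact: E6]].
Qed.

Lemma eigenfunction l : admissible l -> chi l = 0 -> exists u w y p,
  [/\ eigen_system l u w y p, w 0 != 0 \/ p 0 != 0, timo_dom (eigenstate l u y),
      ~ eqH (eigenstate l u y) 0 & eqH (op (eigenstate l u y)) (l *: eigenstate l u y)].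
Proof.
move=> [l0 hX] /kernel_vector[c [d [r1 r2 cd]]].
have [r10 r20] := root_neq0 hb l0 hX.
have q1 := rootp_sq hb l0; have q2 := rootm_sq hb l0.
have kn := kap_neq0 hb; have ks := kap_sq hb.
pose u : R -> C^o := sol_u l (rootp b l) (rootm b l) c d.
pose w : R -> C^o := sol_w l (rootp b l) (rootm b l) c d.
pose y : R -> C^o := sol_y kap (rootp b l) (rootm b l) c d.
pose p : R -> C^o := sol_p kap (rootp b l) (rootm b l) c d.
have [u0 w0 y0 p0] := sol_init kap l0 r10 r20 c d.
have du := sol_u_der l0 r10 r20 q1 q2 c d.
have dw := sol_w_der l0 r10 r20 c d.
have dy := sol_y_der kap r10 r20 c d.
have dp := sol_p_der ks r10 r20 q1 q2 c d.
have S : eigen_system l u w y p.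
  split.
  - split; [split; apply: ccont01; [exact: cder_ccont du|exact: cder_ccont dw]
           |split; apply: ccont01; [exact: cder_ccont dy|exact: cder_ccont dp]|by []|].
    move=> x _; split; [exact: du|exact: dy| |].
    + by apply: cder_eq (dw x) _; rewrite addr0.
    + by apply: cder_eq (dp x) _; rewrite addr0.
  - by rewrite /u /w sol_bc1.
  - by rewrite /y /p sol_bc2 -/(bcrow2 b k3 k4 l c d) r2 mulr0.
have nz : w 0 != 0 \/ p 0 != 0.
  case: cd => h; [left|right].
  + by rewrite /w w0 mulf_neq0.
  + by rewrite /p p0 mulf_neq0 // oppr_eq0.
have [h1 h2 h3] := smooth_eigenstate du dw dy dp S nz.
by exists u, w, y, p.
Qed.

Lemma eqH_residual l U : eqH (op U) (l *: U) ->
  eqH (op U - l *: U) (fun=> 0, fun=> 0, fun=> 0, fun=> 0, 0, 0).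
Proof.
case: U => [[[[[u v] y] z] eta] gam]; rewrite /timo_op scale_state sub_state.
move=> [E1 E2 E3 E4 [E5 E6]].
have sub (f g : R -> C^o) : eq01 f g -> eq01 (fun x => f x - g x) (fun=> 0).
  by apply: aeS => x E Ox; rewrite E // subrr.
split; [exact: (sub _ _ E1)|exact: (sub _ _ E2)|exact: (sub _ _ E3)|exact: (sub _ _ E4)|].
by split; [rewrite E5 subrr|rewrite E6 subrr].
Qed.

Lemma eigenvalue_chi l : admissible l -> is_eigenvalue op l -> chi l = 0.
Proof.
move=> al [U [dU nU /eqH_residual EU]].
have cc : continuous01 (fun=> 0 : C^o) by split=> x; exact: cvg_cst.
have [u [w [y [p [S EUu h1 h2]]]]] := resolvent_regularity cc cc cc cc dU EU.
have S' : eigen_system l u w y p.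
  split.
  - by move: S; rewrite !mulr0 addr0.
  - by rewrite -[RHS]h1; ring.
  - by rewrite -[RHS]h2; ring.
have [c1 c2] := eigen_chi hb al S'.
apply/eqP/negPn/negP => cn; apply: nU.
have w0 : w 0 = 0 by apply/eqP; move/eqP: c1; rewrite mulf_eq0 (negbTE cn).
have p0 : p 0 = 0 by apply/eqP; move/eqP: c2; rewrite mulf_eq0 (negbTE cn).
have Z := eigen_zero hb al S' w0 p0.
have one : (0 : R) <= (1 : R) <= (1 : R) by rewrite ler01 /=.
have [u1 y1] := Z 1 one.
have in01 (x : R) : Omega x -> 0 <= x <= 1.
  by rewrite /= in_itv /= => /andP[? ?]; rewrite !ltW.
move: EUu {dU EU}; case: U => [[[[[U1 U2] U3] U4] U5] U6] [E1 E2 E3 E4 [E5 E6]].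
have e1 : eq01 U1 (fun=> 0) by apply: aeS E1 => x E Ox; rewrite E // (Z x (in01 x Ox)).1.
have e2 : eq01 U2 (fun=> 0).
  by apply: aeS E2 => x E Ox; rewrite E // (Z x (in01 x Ox)).1 mulr0 addr0.
have e3 : eq01 U3 (fun=> 0) by apply: aeS E3 => x E Ox; rewrite E // (Z x (in01 x Ox)).2.
have e4 : eq01 U4 (fun=> 0).
  by apply: aeS E4 => x E Ox; rewrite E // (Z x (in01 x Ox)).2 mulr0 addr0.
have e5 : U5 = 0 by rewrite E5 u1 mulr0 addr0.
have e6 : U6 = 0 by rewrite E6 y1 mulr0 addr0.
by split.
Qed.

Section Simple.
Variable l : C.
Hypothesis (al : admissible l) (iso : isolated_zero b k1 k2 k3 k4 l).

Lemma eigen_scale c u w y p : eigen_system l u w y p ->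
  eigen_system l (fun x => c * u x) (fun x => c * w x) (fun x => c * y x) (fun x => c * p x).
Proof.
move=> [[[cu cw] [cy cp] [u0 y0] H] h1 h2]; split.
- split; [by split; exact: continuous01Z|by split; exact: continuous01Z|by rewrite u0 y0 mulr0|].
  move=> x x01; have [du dy dw dp] := H x x01; split.
  + by apply: cder_eq (cderZ c du) _; ring.
  + by apply: cder_eq (cderZ c dy) _; ring.
  + by apply: cder_eq (cderZ c dw) _; ring.
  + by apply: cder_eq (cderZ c dp) _; ring.
- by rewrite -[RHS](mulr0 c) -h1; ring.
- by rewrite -[RHS](mulr0 c) -h2; ring.
Qed.

Lemma eigen_sub c u w y p u' w' y' p' : eigen_system l u w y p -> eigen_system l u' w' y' p' ->
  eigen_system l (fun x => u x + c * u' x) (fun x => w x + c * w' x)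
    (fun x => y x + c * y' x) (fun x => p x + c * p' x).
Proof.
move=> [S h1 h2] [S' h1' h2']; split.
- have := beam_system_comb c S S'; by rewrite mulr0 addr0.
- transitivity ((l * (l + k2%:C) * u 1 + k1%:C * w 1) + c * (l * (l + k2%:C) * u' 1 + k1%:C * w' 1)).
    by ring.
  by rewrite h1 h1' mulr0 addr0.
- transitivity ((l * (l + k4%:C) * y 1 + k3%:C * p 1) + c * (l * (l + k4%:C) * y' 1 + k3%:C * p' 1)).
    by ring.
  by rewrite h2 h2' mulr0 addr0.
Qed.

(** One step of the induction on the length of Jordan chains. [chain_trivial] forces
    c = 0, since the data of c times the eigenfunction vanish; then U is an
    eigenvector and [eigen_rank1] makes it proportional to the given one. *)
Lemma generalized_eigenvector c U u w y p :
  eigen_system l u w y p -> w 0 != 0 \/ p 0 != 0 -> timo_dom U ->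
  eqH (op U - l *: U) (c *: eigenstate l u y) ->
  exists t, eqH U (t *: eigenstate l u y).
Proof.
move=> S nz dU; rewrite /eigenstate scale_state => EU; have [[[cu _] [cy _] _ _] _ _] := S.
have clu := continuous01Z l cu; have cly := continuous01Z l cy.
have [u1 [w1 [y1 [p1 [S1 EUu h1 h2]]]]] := resolvent_regularity
  (continuous01Z c cu) (continuous01Z c clu) (continuous01Z c cy) (continuous01Z c cly) dU EU.
have {}h1 : k1%:C * w1 1 + (l + k2%:C) * (l * u1 1 + c * u 1) + c * (l * u 1) = 0 := h1.
have {}h2 : k3%:C * p1 1 + (l + k4%:C) * (l * y1 1 + c * y 1) + c * (l * y 1) = 0 := h2.
have Sc := eigen_scale c S.
have ch : chain_system l (fun x => c * u x) (fun x => c * y x) u1 w1 y1 p1.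
  split.
  - move: S1; congr beam_system; apply/funext => x; ring.
  - by rewrite -[RHS]h1; ring.
  - by rewrite -[RHS]h2; ring.
have [cw cp] := chain_trivial hb iso Sc ch.
have c0 : c = 0.
  apply/eqP; case: nz => n; [move/eqP: cw|move/eqP: cp]; by rewrite mulf_eq0 (negbTE n) orbF.
have S1' : eigen_system l u1 w1 y1 p1.
  split.
  - move: S1; congr beam_system; apply/funext => x; by rewrite c0; ring.
  - by rewrite -[RHS]h1 c0; ring.
  - by rewrite -[RHS]h2 c0; ring.
have rk := eigen_rank1 hb iso S1' S.
have [t [tw tp]] : exists t, w1 0 = t * w 0 /\ p1 0 = t * p 0.
  case: nz => n.
  - exists (w1 0 / w 0); split; first by rewrite divfK.
    apply: (mulIf n); rewrite -rk; field; exact: n.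
  - exists (p1 0 / p 0); split; last by rewrite divfK.
    apply: (mulIf n); rewrite rk; field; exact: n.
exists t.
have Sd := eigen_sub (- t) S1' S.
have Z (x : R) : 0 <= x <= 1 -> u1 x = t * u x /\ y1 x = t * y x.
  move=> x01; have [z1 z2] : u1 x + - t * u x = 0 /\ y1 x + - t * y x = 0.
    by apply: (eigen_zero hb al Sd) => //; [rewrite tw|rewrite tp]; ring.
  by split; apply/eqP; rewrite -subr_eq0 -mulNr; apply/eqP.
have one : (0 : R) <= (1 : R) <= (1 : R) by rewrite ler01 /=.
have [t1 t2] := Z 1 one.
have in01 (x : R) : Omega x -> 0 <= x <= 1.
  by rewrite /= in_itv /= => /andP[? ?]; rewrite !ltW.
move: EUu {dU EU}; rewrite c0; case: U => [[[[[U1 U2] U3] U4] U5] U6] [E1 E2 E3 E4 [E5 E6]].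
have e1 : eq01 U1 (fun x => t * u x) by apply: aeS E1 => x E Ox; rewrite E // (Z x (in01 x Ox)).1.
have e2 : eq01 U2 (fun x => t * (l * u x)).
  by apply: aeS E2 => x E Ox; rewrite E // (Z x (in01 x Ox)).1; ring.
have e3 : eq01 U3 (fun x => t * y x) by apply: aeS E3 => x E Ox; rewrite E // (Z x (in01 x Ox)).2.
have e4 : eq01 U4 (fun x => t * (l * y x)).
  by apply: aeS E4 => x E Ox; rewrite E // (Z x (in01 x Ox)).2; ring.
have e5 : U5 = t * (l * u 1) by rewrite E5 t1; ring.
have e6 : U6 = t * (l * y 1) by rewrite E6 t2; ring.
by rewrite scale_state; split.
Qed.

Lemma simple_eigenvalue : chi l = 0 -> is_simple_eigenvalue op l.
Proof.
move=> hl; have [u [w [y [p [S nz dU nU EU]]]]] := eigenfunction al hl.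
split; first by exists (eigenstate l u y).
exists (eigenstate l u y); elim=> [|n IH] U /=.
  by move=> HU; exists 0; rewrite scale0r.
move=> [dU' /IH[c Hc]]; exact: (generalized_eigenvector S nz dU' Hc).
Qed.
End Simple.
End Spectrum.

(** * Splitting of the spectrum *)

Lemma kappa_conservative (R : realType) (b k1 k3 : R) j : kappa b k1 0 k3 0 j = 0.
Proof. by rewrite /kappa /d01 !(mul0r, mulr0, addr0, subr0, oppr0). Qed.

(** Applies to both operators: the conservative one is the case k2 = k4 = 0. *)
Lemma spectrum_split (R : realType) (b k1 k2 k3 k4 : R) :
  0 < b ->
  k1 <> k3 \/ (forall k : nat, (0 < k)%N -> Num.sqrt b <> 2 * k%:R * pi) ->
  exists (k0 : nat) (lam : 'I_2 -> int -> R[i]),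
    large_eigenvalues_split (timo_op 1 b k1 k2 k3 k4) k0 lam /\
    forall j, o_inv_sq (fun k : int =>
      lam j k - ((- (kappa b k1 k2 k3 k4 j / pi ^+ 2 / k%:~R ^+ 2))
        +i* (k%:~R * pi + (b / 8 - tau0 b k1 k3 j) / pi / k%:~R))).
Proof.
move=> hb hyp.
have [k0 [lam [Hz Hi [M HM] Ho]]] := large_roots k2 k4 hb hyp.
exists k0, lam; split => //; split => //.
- move=> j k hk; have [z iso] := Hz j k hk.
  have al : admissible b (lam j k).
    have [c [h0 [_ h00 /(_ 0)]]] := iso; rewrite cabs0 addr0.
    by move=> /(_ (ltW h00)) [].
  exact: (simple_eigenvalue hb al iso z).
- exists M => l; rewrite norm_cabs lecR => hl ev.
  have [l0 hX H] := HM l hl; apply: H.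
  by apply: (eigenvalue_chi hb _ ev); split.
Qed.

Theorem proposition3p6 (R : realType) (b k1 k2 k3 k4 : R)
  (hb : 0 < b) (hk1 : 0 < k1) (hk2 : 0 < k2) (hk3 : 0 < k3) (hk4 : 0 < k4)
  (hyp : k1 <> k3 \/
         (forall k : nat, (0 < k)%N -> Num.sqrt b <> 2 * k%:R * pi)) :
  exists alpha beta : 'I_2 -> R,
    [/\ forall j, 0 < beta j,
        exists (k0 : nat) (lam : 'I_2 -> int -> R[i]),
          large_eigenvalues_split (timo_op 1 b k1 k2 k3 k4) k0 lam /\
          forall j, o_inv_sq (fun k : int =>
            lam j k - ((- (beta j / k%:~R ^+ 2))
                       +i* (k%:~R * pi + alpha j / k%:~R))) &
        exists (k00 : nat) (lam0 : 'I_2 -> int -> R[i]),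
          large_eigenvalues_split (timo_op0 1 b k1 k3) k00 lam0 /\
          forall j, o_inv_sq (fun k : int =>
            lam0 j k - (0 +i* (k%:~R * pi + alpha j / k%:~R)))].
Proof.
exists (fun j => (b / 8 - tau0 b k1 k3 j) / pi), (fun j => kappa b k1 k2 k3 k4 j / pi ^+ 2).
split; [|exact: spectrum_split|].
- by move=> j; rewrite divr_gt0 ?kappa_gt0 // exprn_gt0 // pi_gt0.
- have [k0 [lam [Hs Ho]]] := spectrum_split 0 0 hb hyp.
  exists k0, lam; split => // j; have := Ho j.
  by congr o_inv_sq; apply/funext => k; rewrite kappa_conservative !mul0r oppr0.
Qed.
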